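(* Let $\mathbf{A}\in\mathbb{Q}^{m\times n}$ with $m\ge n$ and let $r\le s\le l\le\min\{m,n\}$. Let $\boldsymbol{\Omega}\in\mathbb{Q}^{n\times s}$ and $\boldsymbol{\Psi}\in\mathbb{Q}^{l\times m}$ be independent standard Gaussian quaternion matrices, and put $\mathbf{Y}=\mathbf{A}\boldsymbol{\Omega}$, $\mathbf{W}=\boldsymbol{\Psi}\mathbf{A}$. Let $\mathbf{H}\in\mathbb{Q}^{m\times s}$ be produced from $\mathbf{Y}$ by a rangefinder map (so $\mathbf{H}$ is determined by $\mathbf{Y}$), such that $\mathcal{R}(\mathbf{H})=\mathcal{R}(\mathbf{Y})$ and $\mathbf{H}$ has full column rank (almost surely), and let $\mathbf{X}=(\boldsymbol{\Psi}\mathbf{H})^\dagger\mathbf{W}$. Then $$\mathbb{E}\|\mathbf{H}\mathbf{X}-\mathbf{A}\|_F^2\le(1+f(s,l))(1+f(r,s))\|\Sigma_2\|_F^2=\left(\frac{2l+1}{2(l-s)+1}\right)\left(\frac{2s+1}{2(s-r)+1}\right)\|\Sigma_2\|_F^2 ,$$ where $f(p,q):=\frac{4p}{4(q-p)+2}$.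
   Context: $\mathbb{Q}$ denotes the real quaternions; for a quaternion matrix, $\mathcal{R}(\cdot)$ is the right linear span of the columns, $\|\cdot\|_F$ is the Frobenius norm, $^\dagger$ is the Moore-Penrose inverse. A quaternion matrix $G_w+G_x\mathbf{i}+G_y\mathbf{j}+G_z\mathbf{k}$ is standard Gaussian if all entries of the real matrices $G_w,G_x,G_y,G_z$ are i.i.d. standard normal random variables. $\Sigma_2$ is the diagonal block of the quaternion SVD of $\mathbf{A}$ containing all singular values except the $r$ largest, i.e. $\|\Sigma_2\|_F^2=\sum_{j>r}\sigma_j(\mathbf{A})^2$ with $\sigma_1(\mathbf A)\ge\sigma_2(\mathbf A)\ge\cdots$ the singular values of $\mathbf{A}$. *)

(* Defs.v *)
From HB Require Import structures.
From mathcomp Require Import all_boot all_order all_algebra ring.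
From mathcomp Require Import all_classical all_reals all_analysis.
Set Implicit Arguments.
Unset Strict Implicit.
Unset Printing Implicit Defensive.
Import Order.TTheory GRing.Theory Num.Theory.

Local Open Scope classical_set_scope.
Local Open Scope ring_scope.

Record quat (R : Type) := Quat { qw : R; qx : R; qy : R; qz : R }.

Section QuatRing.
Variable R : comNzRingType.
Implicit Types p q r : quat R.

Definition tuple_of_quat q : R * R * R * R := (qw q, qx q, qy q, qz q).
Definition quat_of_tuple (t : R * R * R * R) : quat R :=
  Quat t.1.1.1 t.1.1.2 t.1.2 t.2.

Lemma tuple_of_quatK : cancel tuple_of_quat quat_of_tuple.
Proof. by case. Qed.

HB.instance Definition _ := Choice.copy (quat R) (can_type tuple_of_quatK).

Definition qadd p q :=
  Quat (qw p + qw q) (qx p + qx q) (qy p + qy q) (qz p + qz q).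
Definition qopp q := Quat (- qw q) (- qx q) (- qy q) (- qz q).
Definition qmul p q := Quat
  (qw p * qw q - qx p * qx q - qy p * qy q - qz p * qz q)
  (qw p * qx q + qx p * qw q + qy p * qz q - qz p * qy q)
  (qw p * qy q - qx p * qz q + qy p * qw q + qz p * qx q)
  (qw p * qz q + qx p * qy q - qy p * qx q + qz p * qw q).

Lemma qaddA : associative qadd.
Proof. by move=> [????] [????] [????]; congr Quat; apply: addrA. Qed.
Lemma qaddC : commutative qadd.
Proof. by move=> [????] [????]; congr Quat; apply: addrC. Qed.
Lemma qadd0 : left_id (Quat 0 0 0 0) qadd.
Proof. by move=> [????]; congr Quat; apply: add0r. Qed.
Lemma qaddN : left_inverse (Quat 0 0 0 0) qopp qadd.
Proof. by move=> [????]; congr Quat; apply: addNr. Qed.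

HB.instance Definition _ :=
  GRing.isZmodule.Build (quat R) qaddA qaddC qadd0 qaddN.

Lemma qmulA : associative qmul.
Proof. by move=> [????] [????] [????]; congr Quat => /=; ring. Qed.
Lemma qmul1 : left_id (Quat 1 0 0 0) qmul.
Proof. by move=> [????]; congr Quat => /=; ring. Qed.
Lemma qmul1r : right_id (Quat 1 0 0 0) qmul.
Proof. by move=> [????]; congr Quat => /=; ring. Qed.
Lemma qmulDl : left_distributive qmul qadd.
Proof. by move=> [????] [????] [????]; congr Quat => /=; ring. Qed.
Lemma qmulDr : right_distributive qmul qadd.
Proof. by move=> [????] [????] [????]; congr Quat => /=; ring. Qed.
Lemma q1_neq0 : Quat 1 0 0 0 != 0 :> quat R.
Proof. by apply/eqP => -[] /eqP; rewrite oner_eq0. Qed.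

HB.instance Definition _ := GRing.Zmodule_isNzRing.Build (quat R)
  qmulA qmul1 qmul1r qmulDl qmulDr q1_neq0.

Definition qreal (a : R) : quat R := Quat a 0 0 0.
Definition qconj q : quat R := Quat (qw q) (- qx q) (- qy q) (- qz q).
Definition qnorm2 q : R := qw q ^+ 2 + qx q ^+ 2 + qy q ^+ 2 + qz q ^+ 2.

Definition qcoord (c : 'I_4) q : R := nth 0 [:: qw q; qx q; qy q; qz q] c.

End QuatRing.

Section QuatMatrix.
Variable R : realType.

Definition adjmx m n (M : 'M[quat R]_(m, n)) : 'M[quat R]_(n, m) :=
  map_mx (@qconj R) M^T.

Definition unitary n (U : 'M[quat R]_n) : Prop :=
  adjmx U *m U = 1%:M /\ U *m adjmx U = 1%:M.

Definition frobenius m n (M : 'M[quat R]_(m, n)) : R :=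
  Num.sqrt (\sum_(i < m) \sum_(j < n) qnorm2 (M i j)).

(* The coefficients multiply the columns on the right:
   (M *m x) i 0 = \sum_j M i j * x j 0. *)
Definition colspan m n (M : 'M[quat R]_(m, n)) : set 'cV[quat R]_m :=
  range (fun x : 'cV[quat R]_n => M *m x).

Definition full_column_rank m n (M : 'M[quat R]_(m, n)) : Prop :=
  forall x : 'cV[quat R]_n, M *m x = 0 -> x = 0.

Definition penrose m n (M : 'M[quat R]_(m, n)) (X : 'M[quat R]_(n, m)) : Prop :=
  [/\ M *m X *m M = M, X *m M *m X = X,
      adjmx (M *m X) = M *m X & adjmx (X *m M) = X *m M].

(* The unique matrix satisfying the four Penrose equations. *)
Definition mpinv m n (M : 'M[quat R]_(m, n)) : 'M[quat R]_(n, m) :=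
  xget 0 [set X | penrose M X].

(* A = U Sigma V^* with Sigma the m x n matrix having sigma 0, sigma 1, ... on
   its diagonal; only sigma j with j < minn m n matter. *)
Definition qsvd m n (A : 'M[quat R]_(m, n)) (U : 'M[quat R]_m)
    (sigma : nat -> R) (V : 'M[quat R]_n) : Prop :=
  [/\ unitary U, unitary V,
      forall i, (i < minn m n)%N -> 0 <= sigma i,
      forall i j, (i <= j)%N -> (j < minn m n)%N -> sigma j <= sigma i &
      A = U *m (\matrix_(i < m, j < n)
                  if i == j :> nat then qreal (sigma i) else 0) *m adjmx V].

End QuatMatrix.

Section Random.
Context d (T : measurableType d) (R : realType) (P : probability T R).

Definition mutually_independent (I : finType) (X : I -> T -> R) : Prop :=
  forall (J : {set I}) (B : I -> set R), (forall i, measurable (B i)) ->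
    P (\bigcap_(i in [set` J]) (X i @^-1` B i)) =
    (\prod_(i in J) P (X i @^-1` B i))%E.

Definition standard_normal (X : T -> R) : Prop :=
  measurable_fun [set: T] X /\
  forall B : set R, measurable B -> P (X @^-1` B) = normal_prob 0 1 B.

(* The 4mn real random variables formed by the entries of G_w, G_x, G_y, G_z. *)
Definition real_entries m n (G : T -> 'M[quat R]_(m, n))
    (k : 'I_4 * 'I_m * 'I_n) (w : T) : R :=
  qcoord k.1.1 (G w k.1.2 k.2).

Definition standard_gaussian m n (G : T -> 'M[quat R]_(m, n)) : Prop :=
  (forall k, standard_normal (real_entries G k)) /\
  mutually_independent (real_entries G).

Definition sigma_generated m n (G : T -> 'M[quat R]_(m, n)) : set (set T) :=
  <<s [set E | exists k (B : set R),
         measurable B /\ E = real_entries G k @^-1` B] >>.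

Definition independent_matrices m n m' n' (G : T -> 'M[quat R]_(m, n))
    (G' : T -> 'M[quat R]_(m', n')) : Prop :=
  forall E E', sigma_generated G E -> sigma_generated G' E' ->
    P (E `&` E') = (P E * P E')%E.

End Random.

(* The subtraction is that of R, not the truncated one of nat. *)
Definition ferr (R : realType) (p q : nat) : R :=
  (4 * p%:R) / (4 * (q%:R - p%:R) + 2).

(* Main.v *)
(** Write Y = A Omega, M = Psi Y, and let B be the component of A orthogonal to
the columns of Y, with ^H the conjugate transpose.  When M has full column rank,
  HX - A = Y (M^H M)^-1 M^H Psi B - B,
and the two terms are orthogonal.  The first is controlled without inverse
Wishart moments: replace (M^H M)^-1 by the bounded smooth
  V = (M^H M + e Y^H Y)^-1,   N = M V Y^H,   tau = tr (Y V Y^H),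
and apply Stein's identity  E <G, F G> = E (div F)(G)  to the Gaussian matrix
G = Psi.  The field F = N gives  E tau <= s / (4 (l - s) + 2);  the field
F = N N^H G B B^H gives
  E |Y V M^H G B|^2 = 4 |B|^2 E |N|^2 <= 4 |B|^2 E tau <= f(s, l) |B|^2.
Letting e go to 0, Fatou's lemma yields  E |HX - A|^2 <= (1 + f(s, l)) E |B|^2.
As B is a best approximation error, it is at most |A - Y C| for a well-chosen C,
and the same two moment bounds with G = Omega^H and with the leading r right
singular vectors in place of Y give  E |B|^2 <= (1 + f(r, s)) |Sigma_2|^2. *)

Require Import Defs.
From HB Require Import structures.
From mathcomp Require Import all_boot all_order all_algebra ring lra.
From mathcomp Require Import all_classical all_reals all_analysis.
From mathcomp Require Import measurable_realfun measurable_fun_approximation.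
Set Implicit Arguments.
Unset Strict Implicit.
Unset Printing Implicit Defensive.
Import Order.TTheory GRing.Theory Num.Theory.
Import numFieldNormedType.Exports.

Local Open Scope classical_set_scope.
Local Open Scope ring_scope.

(** * Quaternion matrices *)

(** The inverse of M^H M is unbounded near rank deficient M, while Stein's identity asks for fields
    with controlled growth. For e > 0 the inverse V is bounded uniformly in Psi, and the terms in e
    that the divergence produces have a favourable sign, so the moment bounds do not depend on e.
    The constants come from the quaternion units: summed over u = 1, i, j, k, the products conj(u) a
    u give 4 Re a and the products conj(u) a conj(u) give - 2 conj(a). The derivative of N in a
    direction D is W D Z - N D^H N with W = 1 - M V M^H and Z = Y V Y^H. Its divergence is therefore
    4 tr W tr Z + 2 |N|^2, about (4 (l - s) + 2) tau, whereas <Psi, N> is at most s. Traces are real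
    parts of traces throughout: these are cyclic although quaternions do not commute, and they take
    over the part of determinants and eigenvalues. *)

Section QuatBasics.
Variable R : realType.
Implicit Types (p q : quat R) (a : R).

Lemma qw_is_zmod_morphism : zmod_morphism (@qw R).
Proof. by []. Qed.
HB.instance Definition _ :=
  GRing.isZmodMorphism.Build (quat R) R (@qw R) qw_is_zmod_morphism.

Lemma qcoord_is_zmod_morphism c : zmod_morphism (@qcoord R c).
Proof. by case: c => [[|[|[|[|//]]]]] ? []. Qed.
HB.instance Definition _ c :=
  GRing.isZmodMorphism.Build (quat R) R (@qcoord R c) (qcoord_is_zmod_morphism c).

Lemma qconj_is_zmod_morphism : zmod_morphism (@qconj R).
Proof. by move=> [a b c d] [a' b' c' d']; congr Quat => /=; ring. Qed.
HB.instance Definition _ :=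
  GRing.isZmodMorphism.Build (quat R) (quat R) (@qconj R) qconj_is_zmod_morphism.

Lemma qreal_is_zmod_morphism : zmod_morphism (@qreal R).
Proof. by move=> a b; congr Quat => /=; ring. Qed.
HB.instance Definition _ :=
  GRing.isZmodMorphism.Build R (quat R) (@qreal R) qreal_is_zmod_morphism.
Lemma qreal_is_monoid_morphism : monoid_morphism (@qreal R).
Proof. by split=> // a b; congr Quat => /=; ring. Qed.
HB.instance Definition _ :=
  GRing.isMonoidMorphism.Build R (quat R) (@qreal R) qreal_is_monoid_morphism.

Lemma qconjK : involutive (@qconj R).
Proof. by move=> [a b c d]; congr Quat => /=; ring. Qed.

Lemma qconjM p q : qconj (p * q) = qconj q * qconj p.
Proof. by move: p q => [????] [????]; congr Quat => /=; ring. Qed.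

Lemma qconj_real a : qconj (qreal a) = qreal a.
Proof. by congr Quat => /=; ring. Qed.

Lemma qw_mulC p q : qw (p * q) = qw (q * p).
Proof. by move: p q => [????] [????] /=; ring. Qed.

Lemma qreal_comm a p : qreal a * p = p * qreal a.
Proof. by move: p => [????]; congr Quat => /=; ring. Qed.

Lemma qw_realM a p : qw (qreal a * p) = a * qw p.
Proof. by move: p => [????] /=; ring. Qed.

Lemma qnorm2E p : qnorm2 p = qw (qconj p * p).
Proof. by move: p => [????]; rewrite /qnorm2 /=; ring. Qed.

Lemma qnorm2_ge0 p : 0 <= qnorm2 p.
Proof. by rewrite /qnorm2 !addr_ge0 ?sqr_ge0. Qed.

Lemma qnorm2_eq0 p : (qnorm2 p == 0) = (p == 0).
Proof.
apply/eqP/eqP => [|->]; last by rewrite /qnorm2 /=; ring.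
case: p => [a b c d]; rewrite /qnorm2 /= => h.
have [a0 b0 c0 d0] : [/\ a = 0, b = 0, c = 0 & d = 0] by split; nra.
by rewrite a0 b0 c0 d0.
Qed.

Lemma sqr_qcoord_le c p : qcoord c p ^+ 2 <= qnorm2 p.
Proof.
by move: p => [w x y z]; case: c => [[|[|[|[|//]]]]] i;
  rewrite /qcoord /qnorm2 /=; nra.
Qed.

End QuatBasics.

Section QuatMatrixTheory.
Variable R : realType.
Local Notation Q := (quat R).

Lemma adjmxE m n (A : 'M[Q]_(m, n)) i j : adjmx A i j = qconj (A j i).
Proof. by rewrite !mxE. Qed.

Lemma adjmxK m n (A : 'M[Q]_(m, n)) : adjmx (adjmx A) = A.
Proof. by apply/matrixP => i j; rewrite !adjmxE qconjK. Qed.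

Lemma adjmx_is_zmod_morphism m n : zmod_morphism (@adjmx R m n).
Proof. by move=> A B; apply/matrixP => i j; rewrite !mxE raddfB. Qed.
HB.instance Definition _ m n := GRing.isZmodMorphism.Build
  'M[Q]_(m, n) 'M[Q]_(n, m) (@adjmx R m n) (@adjmx_is_zmod_morphism m n).

Lemma adjmxM m n p (A : 'M[Q]_(m, n)) (B : 'M[Q]_(n, p)) :
  adjmx (A *m B) = adjmx B *m adjmx A.
Proof.
apply/matrixP => i j; rewrite !mxE raddf_sum.
by apply: eq_bigr => k _; rewrite /= qconjM !adjmxE.
Qed.

Lemma adjmx_scale m n a (A : 'M[Q]_(m, n)) :
  adjmx (qreal a *: A) = qreal a *: adjmx A.
Proof.
by apply/matrixP => i j; rewrite !mxE qconjM qconj_real qreal_comm.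
Qed.

Lemma adjmx_real n a : adjmx ((qreal a)%:M : 'M[Q]_n) = (qreal a)%:M.
Proof.
apply/matrixP => i j; rewrite !mxE eq_sym.
by case: eqP => _; rewrite ?mulr1n ?mulr0n ?qconj_real ?raddf0.
Qed.

Lemma adjmx1 n : adjmx (1%:M : 'M[Q]_n) = 1%:M.
Proof. by have := adjmx_real n 1; rewrite rmorph1. Qed.

Lemma mulmx_scaler m n p a (A : 'M[Q]_(m, n)) (B : 'M[Q]_(n, p)) :
  A *m (qreal a *: B) = qreal a *: (A *m B).
Proof.
apply/matrixP => i j; rewrite !mxE mulr_sumr; apply: eq_bigr => k _.
by rewrite !mxE !mulrA qreal_comm.
Qed.

Lemma mulmx_real m n a (A : 'M[Q]_(m, n)) : A *m (qreal a)%:M = qreal a *: A.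
Proof. by rewrite -scalemx1 mulmx_scaler mulmx1. Qed.

Definition rtr n (A : 'M[Q]_n) : R := \sum_i qw (A i i).

Lemma rtr_is_zmod_morphism n : zmod_morphism (@rtr n).
Proof.
by move=> A B; rewrite /rtr -sumrB; apply: eq_bigr => i _; rewrite !mxE.
Qed.
HB.instance Definition _ n := GRing.isZmodMorphism.Build
  'M[Q]_n R (@rtr n) (@rtr_is_zmod_morphism n).

Lemma rtrC m n (A : 'M[Q]_(m, n)) (B : 'M[Q]_(n, m)) :
  rtr (A *m B) = rtr (B *m A).
Proof.
rewrite /rtr; under eq_bigr do rewrite mxE raddf_sum.
rewrite exchange_big /=; apply: eq_bigr => j _; rewrite mxE raddf_sum.
by apply: eq_bigr => i _; exact: qw_mulC.
Qed.

Lemma rtr_adj n (A : 'M[Q]_n) : rtr (adjmx A) = rtr A.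
Proof. by apply: eq_bigr => i _; rewrite adjmxE. Qed.

Lemma rtr_scale n a (A : 'M[Q]_n) : rtr (qreal a *: A) = a * rtr A.
Proof.
by rewrite /rtr mulr_sumr; apply: eq_bigr => i _; rewrite !mxE qw_realM.
Qed.

Lemma rtr1 n : rtr (1%:M : 'M[Q]_n) = n%:R.
Proof.
rewrite /rtr; under eq_bigr do rewrite mxE eqxx.
by rewrite sumr_const card_ord.
Qed.

Definition qdot m n (A B : 'M[Q]_(m, n)) : R := rtr (adjmx A *m B).
Definition norm2 m n (A : 'M[Q]_(m, n)) : R := qdot A A.

Lemma qdotE m n (A B : 'M[Q]_(m, n)) :
  qdot A B = \sum_i \sum_j qw (qconj (A i j) * B i j).
Proof.
rewrite /qdot /rtr exchange_big /=; apply: eq_bigr => j _.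
by rewrite mxE raddf_sum; apply: eq_bigr => i _; rewrite adjmxE.
Qed.

Lemma norm2E m n (A : 'M[Q]_(m, n)) :
  norm2 A = \sum_i \sum_j qnorm2 (A i j).
Proof.
by rewrite /norm2 qdotE; do 2![apply: eq_bigr => ? _]; rewrite qnorm2E.
Qed.

Lemma norm2_ge0 m n (A : 'M[Q]_(m, n)) : 0 <= norm2 A.
Proof. by rewrite norm2E; do 2![apply: sumr_ge0 => ? _]; exact: qnorm2_ge0. Qed.

Lemma sqr_frobenius m n (A : 'M[Q]_(m, n)) : frobenius A ^+ 2 = norm2 A.
Proof. by rewrite /frobenius -norm2E sqr_sqrtr// norm2_ge0. Qed.

Lemma qnorm2_le_norm2 m n (A : 'M[Q]_(m, n)) i j : qnorm2 (A i j) <= norm2 A.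
Proof.
rewrite norm2E (bigD1 i)//= (bigD1 j)//= -addrA lerDl addr_ge0//.
  by apply: sumr_ge0 => ? _; exact: qnorm2_ge0.
by do 2![apply: sumr_ge0 => ? _]; exact: qnorm2_ge0.
Qed.

Lemma norm2_eq0 m n (A : 'M[Q]_(m, n)) : (norm2 A == 0) = (A == 0).
Proof.
apply/eqP/eqP => [h|->]; last by rewrite /norm2 /qdot mulmx0 raddf0.
apply/matrixP => i j; rewrite mxE; apply/eqP; rewrite -qnorm2_eq0.
by rewrite eq_le qnorm2_ge0 andbT -h qnorm2_le_norm2.
Qed.

Lemma norm2_0 m n : norm2 (0 : 'M[Q]_(m, n)) = 0.
Proof. by apply/eqP; rewrite norm2_eq0. Qed.

Lemma norm2_gt0 m n (A : 'M[Q]_(m, n)) : (0 < norm2 A) = (A != 0).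
Proof. by rewrite lt_neqAle norm2_ge0 andbT eq_sym norm2_eq0. Qed.

Lemma qdotC m n (A B : 'M[Q]_(m, n)) : qdot A B = qdot B A.
Proof. by rewrite /qdot -rtr_adj adjmxM adjmxK. Qed.

Lemma qdotDl m n (A B C : 'M[Q]_(m, n)) :
  qdot (A + B) C = qdot A C + qdot B C.
Proof. by rewrite /qdot raddfD mulmxDl raddfD. Qed.

Lemma qdotDr m n (A B C : 'M[Q]_(m, n)) :
  qdot A (B + C) = qdot A B + qdot A C.
Proof. by rewrite /qdot mulmxDr raddfD. Qed.

Lemma qdotNr m n (A B : 'M[Q]_(m, n)) : qdot A (- B) = - qdot A B.
Proof. by rewrite /qdot mulmxN raddfN. Qed.

Lemma qdotZr m n a (A B : 'M[Q]_(m, n)) :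
  qdot A (qreal a *: B) = a * qdot A B.
Proof. by rewrite /qdot mulmx_scaler rtr_scale. Qed.

Lemma qdotZl m n a (A B : 'M[Q]_(m, n)) :
  qdot (qreal a *: A) B = a * qdot A B.
Proof. by rewrite qdotC qdotZr qdotC. Qed.

Lemma norm2_adj m n (A : 'M[Q]_(m, n)) : norm2 (adjmx A) = norm2 A.
Proof. by rewrite /norm2 /qdot adjmxK rtrC. Qed.

Lemma norm2Z m n a (A : 'M[Q]_(m, n)) :
  norm2 (qreal a *: A) = a ^+ 2 * norm2 A.
Proof. by rewrite /norm2 qdotZr qdotZl mulrA expr2. Qed.

Lemma norm2N m n (A : 'M[Q]_(m, n)) : norm2 (- A) = norm2 A.
Proof. by rewrite /norm2 qdotNr qdotC qdotNr opprK. Qed.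

Lemma norm2D m n (A B : 'M[Q]_(m, n)) :
  norm2 (A + B) = norm2 A + 2 * qdot A B + norm2 B.
Proof.
rewrite /norm2 qdotDl !qdotDr (qdotC B A).
by move: (qdot A A) (qdot A B) (qdot B B) => a b c; ring.
Qed.

Lemma qdot_CS m n (A B : 'M[Q]_(m, n)) :
  qdot A B ^+ 2 <= norm2 A * norm2 B.
Proof.
have [->|B0] := eqVneq B 0.
  by rewrite /norm2 /qdot !mulmx0 raddf0 mulr0 expr0n.
have nB : 0 < norm2 B by rewrite norm2_gt0.
have := norm2_ge0 (qreal (norm2 B) *: A + qreal (- qdot A B) *: B).
rewrite norm2D !norm2Z qdotZl qdotZr.
move: (norm2 A) (norm2 B) (qdot A B) nB => a b c b0 h.
have : 0 <= b * (a * b - c ^+ 2).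
  by apply: le_trans h _; rewrite le_eqVlt; apply/orP; left; apply/eqP; ring.
by rewrite pmulr_rge0// subr_ge0.
Qed.

Lemma norm2_triangle m n (A B : 'M[Q]_(m, n)) a b : 0 <= a -> 0 <= b ->
  norm2 A <= a ^+ 2 -> norm2 B <= b ^+ 2 -> norm2 (A + B) <= (a + b) ^+ 2.
Proof.
move=> a0 b0 hA hB; rewrite norm2D.
have h : qdot A B <= a * b.
  apply: le_trans (ler_norm _) _.
  rewrite -(@ler_pXn2r _ 2)// ?nnegrE ?mulr_ge0// real_normK ?num_real//.
  by rewrite (le_trans (qdot_CS A B))// exprMn ler_pM ?norm2_ge0.
move: (norm2 A) (norm2 B) (qdot A B) hA hB h => x y z hA hB h.
by rewrite sqrrD -mulr_natl; lra.
Qed.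

Lemma norm2_row m n (A : 'M[Q]_(m, n)) : norm2 A = \sum_i norm2 (row i A).
Proof.
rewrite norm2E; apply: eq_bigr => i _.
by rewrite norm2E big_ord1; apply: eq_bigr => j _; rewrite mxE.
Qed.

Lemma norm2_col m n (A : 'M[Q]_(m, n)) : norm2 A = \sum_j norm2 (col j A).
Proof.
rewrite norm2E exchange_big; apply: eq_bigr => j _.
by rewrite norm2E; apply: eq_bigr => i _; rewrite big_ord1 mxE.
Qed.

(** [qdot_CS] sees only the real part of a product. It is applied to
    [norm2 z = qdot (adjmx A *m z) B], where [norm2 (adjmx A *m z) = norm2 z * norm2 A]; one factor
    [norm2 z] then cancels. *)
Lemma norm2_scalar_mulmx n (A : 'rV[Q]_n) (B : 'cV[Q]_n) :
  norm2 (A *m B) <= norm2 A * norm2 B.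
Proof.
set z := A *m B.
have zE : norm2 z = qdot (adjmx A *m z) B.
  by rewrite /norm2 /qdot adjmxM adjmxK -mulmxA.
have nzA : norm2 (adjmx A *m z) = norm2 z * norm2 A.
  rewrite {1 2}/norm2 {1 2}/qdot adjmxM adjmxK -mulmxA (mulmxA A).
  (* A quaternion times its conjugate is real, so the Gram matrix of a row is a real scalar and
     commutes past [z]. *)
  have AA : A *m adjmx A = (qreal (norm2 A))%:M.
    apply/matrixP => i j; rewrite !ord1 [RHS]mxE eqxx mulr1n mxE norm2E big_ord1.
    rewrite raddf_sum; apply: eq_bigr => k _; rewrite adjmxE.
    by case: (A 0 k) => ? ? ? ?; congr Quat => /=; rewrite /qnorm2 /=; ring.
  by rewrite AA mul_scalar_mx mulmx_scaler rtr_scale mulrC.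
have [z0|z0] := eqVneq z 0.
  by rewrite z0 norm2_0 mulr_ge0 ?norm2_ge0.
have z1 : 0 < norm2 z by rewrite norm2_gt0.
rewrite -(ler_pM2l z1) -expr2 {1}zE (le_trans (qdot_CS _ _))//.
by rewrite nzA mulrA.
Qed.

Lemma norm2M m n p (A : 'M[Q]_(m, n)) (B : 'M[Q]_(n, p)) :
  norm2 (A *m B) <= norm2 A * norm2 B.
Proof.
rewrite (norm2_row A) (norm2_col B) mulr_suml norm2E ler_sum// => i _.
rewrite mulr_sumr ler_sum// => j _.
have -> : qnorm2 ((A *m B) i j) = norm2 (row i A *m col j B).
  rewrite norm2E !big_ord1; congr qnorm2; rewrite !mxE.
  by apply: eq_bigr => k _; rewrite !mxE.
exact: norm2_scalar_mulmx.
Qed.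

Lemma full_column_rank_mx m n p (A : 'M[Q]_(m, n)) (B : 'M[Q]_(n, p)) :
  full_column_rank A -> A *m B = 0 -> B = 0.
Proof.
move=> hA AB; apply/matrixP => i j.
have : col j B = 0.
  apply: hA; apply/matrixP => i' j'; move/matrixP/(_ i' j): AB; rewrite !mxE.
  by move=> AB; rewrite -[RHS]AB; apply: eq_bigr => k _; rewrite mxE.
by move/matrixP/(_ i 0); rewrite !mxE.
Qed.

Definition self_adjoint n (S : 'M[Q]_n) := adjmx S = S.
Definition posdef n (S : 'M[Q]_n) :=
  self_adjoint S /\ forall x : 'cV[Q]_n, x != 0 -> 0 < rtr (adjmx x *m S *m x).

(* Schur complement recursion, an inverse for positive definite S (qinvP). *)
Fixpoint qinv n : 'M[Q]_n -> 'M[Q]_n :=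
  match n with
  | 0 => fun=> 0
  | n'.+1 => fun S : 'M[Q]_(1 + n') =>
    let a := qreal (qw (S 0 0))^-1 in
    let b := dlsubmx S in
    let c := ursubmx S in
    let L := qinv (drsubmx S - a *: (b *m c)) in
    block_mx (a%:M + (a * a) *: (c *m L *m b)) (- (a *: (c *m L)))
             (- (a *: (L *m b))) L
  end.

Lemma real_diag_hermitian n (S : 'M[Q]_n) i :
  self_adjoint S -> S i i = qreal (qw (S i i)).
Proof.
move=> /matrixP/(_ i i); rewrite adjmxE; case: (S i i) => a b c d [h1 h2 h3].
by congr Quat; lra.
Qed.

Lemma adjmx_block m1 m2 n1 n2 (A : 'M[Q]_(m1, n1)) (B : 'M[Q]_(m1, n2))
  (C : 'M[Q]_(m2, n1)) (D : 'M[Q]_(m2, n2)) :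
  adjmx (block_mx A B C D) = block_mx (adjmx A) (adjmx C) (adjmx B) (adjmx D).
Proof. by rewrite /adjmx tr_block_mx map_block_mx. Qed.

Lemma adjmx_col m1 m2 n1 (A : 'M[Q]_(m1, n1)) (B : 'M[Q]_(m2, n1)) :
  adjmx (col_mx A B) = row_mx (adjmx A) (adjmx B).
Proof. by rewrite /adjmx tr_col_mx map_row_mx. Qed.

(** Induction works because the Schur complement is again positive definite. Only [S *m X = 1%:M] is
    computed blockwise: the candidate [X] is self-adjoint, so taking adjoints yields the other
    side. *)
Lemma qinvP n (S : 'M[Q]_n) : posdef S ->
  [/\ S *m qinv S = 1%:M, qinv S *m S = 1%:M & self_adjoint (qinv S)].
Proof.
elim: n S => [|n IH] S [hS pS].
  by split; apply/matrixP => -[].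
pose S' : 'M[Q]_(1 + n) := S.
set b := dlsubmx S'; set c := ursubmx S'; set D := drsubmx S'.
set a0 := qw (S 0 0); pose a := qreal a0^-1.
have S'E : S' = block_mx (qreal a0)%:M c b D.
  rewrite -{1}[S']submxK; congr block_mx; apply/matrixP => i j.
  rewrite !ord1 !mxE eqxx mulr1n -(real_diag_hermitian _ hS).
  by congr (S _ _); apply/val_inj.
have [cE DE] : c = adjmx b /\ adjmx D = D.
  have : adjmx S' = S' by exact: hS.
  rewrite S'E adjmx_block => /eq_block_mx[_ <- _ ->].
  by [].
have a0_gt0 : 0 < a0.
  pose x : 'cV[Q]_(1 + n) := col_mx 1%:M 0.
  have x0 : x != 0.
    apply/eqP => /(congr1 usubmx); rewrite col_mxKu => /matrixP/(_ 0 0).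
    by rewrite !mxE /= => -[] /eqP; rewrite oner_eq0.
  have : 0 < rtr (adjmx x *m S' *m x) by exact: pS.
  rewrite S'E /x adjmx_col raddf0 adjmx1.
  rewrite mul_row_block mul_row_col !mul1mx !mul0mx !mulmx0 !addr0 mulmx1.
  by rewrite /rtr big_ord1 mxE eqxx.
have a0a : qreal a0 * a = 1 by rewrite -rmorphM divff ?gt_eqF// rmorph1.
have aa0 : a * qreal a0 = 1 by rewrite -rmorphM mulVf ?gt_eqF// rmorph1.
set D' := D - a *: (b *m c).
have pD' : posdef D'.
  split.
    by rewrite /self_adjoint raddfB /= adjmx_scale adjmxM DE {1}cE adjmxK -cE.
  (* The top block minimises the form for fixed [y]: it annihilates the first row of [S' *m x] and
     leaves [D' *m y] below. *)
  move=> y y0; pose x : 'cV[Q]_(1 + n) := col_mx (- (a *: (c *m y))) y.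
  have x0 : x != 0.
    by apply: contraNneq y0; rewrite -[0]col_mx0 => /eq_col_mx[_ ->].
  have Sx : S' *m x = col_mx 0 (D' *m y).
    rewrite S'E mul_block_col mul_scalar_mx scalerN scalerA a0a scale1r addNr.
    by rewrite mulmxN mulmx_scaler mulmxBl -scalemxAl -mulmxA addrC.
  have : 0 < rtr (adjmx x *m S' *m x) by exact: pS.
  rewrite -mulmxA Sx adjmx_col mul_row_col mulmx0 add0r.
  by rewrite mulmxA.
have [DL LD hL] := IH _ pD'.
set L := qinv D' in DL LD hL.
pose X : 'M[Q]_(1 + n) := block_mx (a%:M + (a * a) *: (c *m L *m b))
  (- (a *: (c *m L))) (- (a *: (L *m b))) L.
have DLE : D *m L = 1%:M + a *: (b *m c *m L).
  by rewrite -DL mulmxBl -scalemxAl subrK.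
have one_block : (1%:M : 'M[Q]_(1 + n)) = block_mx 1%:M 0 0 1%:M.
  exact: scalar_mx_block.
have herm : adjmx X = X.
  rewrite /X adjmx_block !raddfN !raddfD /= -rmorphM !adjmx_scale.
  by rewrite !adjmxM adjmx_real hL cE !adjmxK !mulmxA.
have right : S' *m X = 1%:M.
  rewrite S'E mulmx_block one_block; congr block_mx.
  - rewrite mul_scalar_mx scalerDr scale_scalar_mx a0a scalerA mulrA a0a mul1r.
    by rewrite mulmxN mulmx_scaler mulmxA addrK.
  - by rewrite mul_scalar_mx scalerN scalerA a0a scale1r addNr.
  - rewrite mulmxDr mulmx_real -scalerA !mulmx_scaler mulmxN mulmx_scaler.
    rewrite !mulmxA DLE mulmxDl mul1mx -scalemxAl scalerDr.
    by rewrite addrN.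
  - by rewrite mulmxN mulmx_scaler mulmxA DLE addrC addrK.
have left : X *m S' = 1%:M.
  have : adjmx (S' *m X) = 1%:M by rewrite right adjmx1.
  by rewrite adjmxM herm (_ : adjmx S' = S').
by split.
Qed.

End QuatMatrixTheory.

(** * Least squares, Moore-Penrose inverses and changes of basis *)

Section LeastSquares.
Variable R : realType.
Local Notation Q := (quat R).

Lemma posdef_gram m n (M : 'M[Q]_(m, n)) :
  full_column_rank M -> posdef (adjmx M *m M).
Proof.
move=> hM; split; first by rewrite /self_adjoint adjmxM adjmxK.
move=> x x0; rewrite mulmxA -adjmxM -mulmxA -[rtr _]/(norm2 (M *m x)) norm2_gt0.
by apply: contra_neq x0; exact: hM.
Qed.

Lemma qdot_orth m n p (Y : 'M[Q]_(m, n)) (X : 'M[Q]_(n, p)) (B : 'M[Q]_(m, p)) :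
  adjmx Y *m B = 0 -> qdot (Y *m X) B = 0.
Proof. by move=> YB; rewrite /qdot adjmxM -mulmxA YB mulmx0 raddf0. Qed.

Lemma norm2_pythagoras m n p (Y : 'M[Q]_(m, n)) (X : 'M[Q]_(n, p))
  (B : 'M[Q]_(m, p)) :
  adjmx Y *m B = 0 -> norm2 (Y *m X + B) = norm2 (Y *m X) + norm2 B.
Proof. by move=> YB; rewrite norm2D qdot_orth// mulr0 addr0. Qed.

Lemma norm2_pythagorasB m n p (Y : 'M[Q]_(m, n)) (X : 'M[Q]_(n, p))
  (B : 'M[Q]_(m, p)) :
  adjmx Y *m B = 0 -> norm2 (Y *m X - B) = norm2 (Y *m X) + norm2 B.
Proof.
by move=> YB; rewrite norm2D qdotNr qdot_orth// oppr0 mulr0 addr0 norm2N.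
Qed.

(** The component B of [A] orthogonal to the columns of [Y], provided that [Y] has full column rank;
    otherwise the Gram matrix is singular and its [qinv] is a junk value. *)
Definition residual m n p (Y : 'M[Q]_(m, n)) (A : 'M[Q]_(m, p)) :=
  A - Y *m (qinv (adjmx Y *m Y) *m adjmx Y *m A).

Section Residual.
Variables (m n p : nat) (Y : 'M[Q]_(m, n)) (A : 'M[Q]_(m, p)).
Hypothesis Yfull : full_column_rank Y.

Lemma adjmx_residual : adjmx Y *m residual Y A = 0.
Proof.
have [YY _ _] := qinvP (posdef_gram Yfull).
by rewrite mulmxBr !mulmxA YY mul1mx subrr.
Qed.

Lemma norm2_residual_le (C : 'M[Q]_(n, p)) :
  norm2 (residual Y A) <= norm2 (A - Y *m C).
Proof.
set C0 := qinv (adjmx Y *m Y) *m adjmx Y *m A.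
have -> : A - Y *m C = Y *m (C0 - C) + residual Y A.
  by rewrite /residual -/C0 mulmxBr [RHS]addrC addrA subrK.
by rewrite norm2_pythagoras ?adjmx_residual// lerDr norm2_ge0.
Qed.

End Residual.

(** Real traces replace determinants: the orthogonal projection [P] onto the columns of [B] has
    trace [n], and the squared norm of the projection [1%:M - P] equals its trace, which is 0. *)
Lemma mulmx1C n (A B : 'M[Q]_n) : A *m B = 1%:M -> B *m A = 1%:M.
Proof.
move=> AB.
have Bfull : full_column_rank B.
  by move=> x Bx; rewrite -[x]mul1mx -AB -mulmxA Bx mulmx0.
have [BB LB hL] := qinvP (posdef_gram Bfull).
set L := qinv _ in BB LB hL.
have P1 : B *m L *m adjmx B = 1%:M.
  apply/eqP; rewrite eq_sym -subr_eq0 -norm2_eq0; set P := B *m L *m adjmx B.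
  have hP : adjmx P = P by rewrite /P !adjmxM adjmxK hL mulmxA.
  have PP : P *m P = P.
    by rewrite /P -!mulmxA (mulmxA (adjmx B)) (mulmxA L _ (L *m _)) LB mul1mx.
  have h1P : adjmx (1%:M - P) = 1%:M - P by rewrite raddfB /= adjmx1 hP.
  have -> : norm2 (1%:M - P) = rtr (1%:M - P).
    by rewrite /norm2 /qdot h1P mulmxBl mul1mx mulmxBr mulmx1 PP subrr subr0.
  by rewrite raddfB /= {1}/P rtrC mulmxA rtrC mulmxA -mulmxA LB subrr.
have -> : A = L *m adjmx B.
  by rewrite -[A]mulmx1 -P1 !mulmxA AB mul1mx.
by rewrite mulmxA.
Qed.

(** [mpinv] is a choice among the solutions of the Penrose equations, so uniqueness has to be shown.
    Another solution [X'] is also a left inverse of [M], and taking adjoints in M X' = (M X)(M X')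
    gives M X' = M X. *)
Lemma mpinv_eq m n (M : 'M[Q]_(m, n)) (X : 'M[Q]_(n, m)) :
  X *m M = 1%:M -> self_adjoint (M *m X) -> mpinv M = X.
Proof.
move=> XM hMX.
have PX : penrose M X.
  by split=> //; rewrite ?XM ?mul1mx ?adjmx1// -mulmxA XM mulmx1.
rewrite /mpinv; case: xgetP => [X' _ /= [h1 h2 h3 _]|/(_ X)/=]; last by [].
have X'M : X' *m M = 1%:M.
  by rewrite -[LHS]mul1mx -XM -!mulmxA (mulmxA M X') h1 XM.
have MXX' : M *m X' = M *m X.
  have e : M *m X' = (M *m X) *m (M *m X').
    by rewrite -!mulmxA (mulmxA X) XM mul1mx.
  rewrite -[LHS]h3 e adjmxM h3 hMX.
  by rewrite -!mulmxA (mulmxA X') X'M mul1mx.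
by rewrite -h2 -mulmxA MXX' mulmxA X'M mul1mx.
Qed.

Lemma colspan_mulmx m n p (H : 'M[Q]_(m, n)) (Y : 'M[Q]_(m, p)) :
  colspan H `<=` colspan Y -> exists C, H = Y *m C.
Proof.
move=> HY.
have /choice [f fP] (j : 'I_n) : exists x : 'cV[Q]_p, Y *m x = col j H.
  have [|x _ <-] := HY (col j H); last by exists x.
  exists (delta_mx j 0) => //; apply/matrixP => i k; rewrite !mxE.
  rewrite (bigD1 j)//= big1 ?addr0 => [|k' k'j]; rewrite mxE.
    by rewrite !eqxx ord1 mulr1.
  by rewrite (negPf k'j) mulr0.
exists (\matrix_(i, j) f j i 0); apply/matrixP => i j.
have /matrixP/(_ i 0) := fP j; rewrite !mxE => <-.
by apply: eq_bigr => k _; rewrite !mxE.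
Qed.

Section SameColspan.
Variables (m n : nat) (H Y : 'M[Q]_(m, n)).
Hypotheses (HY : colspan H = colspan Y) (Hfull : full_column_rank H).

(** [H] and [Y] have equally many columns, so the change of basis is square and [mulmx1C]
    applies. *)
Lemma same_colspan_inv : exists C D, [/\ H = Y *m C, C *m D = 1%:M & D *m C = 1%:M].
Proof.
have [C HC] : exists C, H = Y *m C by apply: colspan_mulmx; rewrite HY.
have [D YD] : exists D, Y = H *m D by apply: colspan_mulmx; rewrite HY.
exists C, D.
have DC : D *m C = 1%:M.
  apply/eqP; rewrite -subr_eq0; apply/eqP; apply: (full_column_rank_mx Hfull).
  by rewrite mulmxBr mulmxA -YD -HC mulmx1 subrr.
by split=> //; exact: mulmx1C.
Qed.

Lemma same_colspan_full : full_column_rank Y.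
Proof.
have [C [D [HC CD DC]]] := same_colspan_inv => x Yx.
have /Hfull/(congr1 (mulmx C)) : H *m (D *m x) = 0.
  by rewrite HC -mulmxA (mulmxA C) CD mul1mx.
by rewrite mulmxA CD mul1mx mulmx0.
Qed.

(** The change of basis cancels between [H] and the pseudoinverse, so the approximation depends on
    the rangefinder only through the column space of [Y]. *)
Lemma same_colspan_mpinv l p (Psi : 'M[Q]_(l, m)) (W : 'M[Q]_(l, p)) :
  let M := Psi *m Y in full_column_rank M ->
  H *m (mpinv (Psi *m H) *m W) = Y *m (qinv (adjmx M *m M) *m adjmx M *m W).
Proof.
move=> M Mfull; have [C [D [HC CD DC]]] := same_colspan_inv.
have [_ LM hL] := qinvP (posdef_gram Mfull); set L := qinv _ in LM hL *.
have PH : Psi *m H = M *m C by rewrite HC mulmxA.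
have -> : mpinv (Psi *m H) = D *m L *m adjmx M.
  rewrite PH; apply: mpinv_eq.
    by rewrite mulmxA -(mulmxA _ (adjmx M)) -(mulmxA D) LM mulmx1.
  have -> : M *m C *m (D *m L *m adjmx M) = M *m L *m adjmx M.
    by rewrite -!mulmxA (mulmxA C) CD mul1mx.
  clearbody M; by rewrite /self_adjoint !adjmxM adjmxK hL mulmxA.
by rewrite HC -!mulmxA (mulmxA C) CD mul1mx.
Qed.

End SameColspan.

End LeastSquares.

(** * Ridge-regularised Gram matrices *)

(** The triangle inequality |u| <= |u'| + e w |u|, taken between square roots and squared again. *)
Lemma norm2_perturb (R : realType) N r (Z : 'M[quat R]_N)
  (u u' : 'M[quat R]_(N, r)) (e w : R) :
  0 <= e -> 0 <= w -> e * w <= 1 -> norm2 Z <= w ^+ 2 ->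
  u = u' + qreal e *: (Z *m u) -> (1 - e * w) ^+ 2 * norm2 u <= norm2 u'.
Proof.
move=> e0 w0 ew nZ uE.
have s0 (x : R) : 0 <= Num.sqrt x by exact: sqrtr_ge0.
have h1 : norm2 u <= (Num.sqrt (norm2 u') + e * w * Num.sqrt (norm2 u)) ^+ 2.
  rewrite {1}uE; apply: norm2_triangle => //; first by rewrite !mulr_ge0.
    by rewrite sqr_sqrtr ?norm2_ge0.
  rewrite norm2Z (exprMn _ (e * _)) exprMn sqr_sqrtr; last exact: norm2_ge0.
  rewrite -[leRHS]mulrA; apply: ler_wpM2l; first exact: sqr_ge0.
  by apply: le_trans (norm2M _ _) _; apply: ler_wpM2r; first exact: norm2_ge0.
have h2 : Num.sqrt (norm2 u) <= Num.sqrt (norm2 u') + e * w * Num.sqrt (norm2 u).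
  rewrite -[leRHS]ger0_norm; last by rewrite addr_ge0 ?mulr_ge0.
  by rewrite -sqrtr_sqr; exact: ler_wsqrtr.
rewrite -[leRHS]sqr_sqrtr ?norm2_ge0// -[X in _ * X <= _]sqr_sqrtr ?norm2_ge0//.
rewrite -exprMn; apply: lerXn2r; rewrite ?nnegrE ?mulr_ge0 ?subr_ge0//.
by move: h2; lra.
Qed.

Section Ridge.
Variable R : realType.
Local Notation Q := (quat R).

(* The multiple of Y^H Y, rather than of 1, makes ridgeZ invariant under a change
   of basis of the column space of Y. *)
Definition ridge p N q (G : 'M[Q]_(p, N)) (Y : 'M[Q]_(N, q)) (e : R) : 'M[Q]_q :=
  adjmx (G *m Y) *m (G *m Y) + qreal e *: (adjmx Y *m Y).
Definition ridgeZ p N q (G : 'M[Q]_(p, N)) (Y : 'M[Q]_(N, q)) (e : R) :=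
  Y *m qinv (ridge G Y e) *m adjmx Y.
Definition ridgeN p N q (G : 'M[Q]_(p, N)) (Y : 'M[Q]_(N, q)) (e : R) :=
  G *m Y *m qinv (ridge G Y e) *m adjmx Y.

Variables (p N q : nat) (G : 'M[Q]_(p, N)) (Y : 'M[Q]_(N, q)) (e : R).
Hypotheses (Yfull : full_column_rank Y) (e0 : 0 < e).
Local Notation M := (G *m Y).
Local Notation S := (ridge G Y e).
Local Notation T := (qinv S).
Local Notation Z := (ridgeZ G Y e).
Local Notation NN := (ridgeN G Y e).
Local Notation tau := (rtr Z).

Lemma ridge_posdef : posdef S.
Proof.
split.
  by rewrite /self_adjoint /ridge raddfD /= adjmx_scale 2!(adjmxM (adjmx _)) !adjmxK.
move=> x x0; rewrite /ridge mulmxDr mulmxDl raddfD /= mulmx_scaler -scalemxAl.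
rewrite rtr_scale !mulmxA -!adjmxM -!mulmxA.
rewrite -[rtr _]/(norm2 (G *m (Y *m x))) -[X in e * X]/(norm2 (Y *m x)).
rewrite ltr_wpDl ?norm2_ge0// mulr_gt0// norm2_gt0.
by apply: contra_neq x0; exact: Yfull.
Qed.

Lemma ridgeMV : S *m T = 1%:M. Proof. by have [] := qinvP ridge_posdef. Qed.
Lemma ridgeVM : T *m S = 1%:M. Proof. by have [] := qinvP ridge_posdef. Qed.
Lemma adjmx_ridgeV : adjmx T = T. Proof. by have [] := qinvP ridge_posdef. Qed.

Lemma adjmx_ridgeZ : adjmx Z = Z.
Proof. by rewrite /ridgeZ !adjmxM adjmxK adjmx_ridgeV mulmxA. Qed.

Lemma ridgeVE : T = T *m adjmx M *m M *m T + qreal e *: (T *m adjmx Y *m Y *m T).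
Proof.
rewrite -{1}[T]mulmx1 -{1}ridgeMV mulmxA {2}/ridge mulmxDr mulmxDl.
by rewrite mulmx_scaler -scalemxAl !mulmxA.
Qed.

(** Comes from V = V S V. It exhibits [Z] as a sum of two Gram matrices, the source of [ridgeZ_ge0],
    [norm2_ridgeN_le] and [norm2_ridgeZ_le]. *)
Lemma ridgeZE : Z = adjmx NN *m NN + qreal e *: (adjmx Z *m Z).
Proof.
rewrite adjmx_ridgeZ {1}/ridgeZ ridgeVE mulmxDr mulmxDl mulmx_scaler -scalemxAl.
rewrite /ridgeN !(adjmxM (M *m T)) !(adjmxM M) adjmxK adjmx_ridgeV.
by rewrite /ridgeZ !mulmxA.
Qed.

Lemma rtr_ridgeZ : tau = norm2 NN + e * norm2 Z.
Proof. by rewrite {1}ridgeZE raddfD /= rtr_scale. Qed.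

Lemma ridgeZ_ge0 : 0 <= tau.
Proof. by rewrite rtr_ridgeZ addr_ge0 ?norm2_ge0// mulr_ge0 ?norm2_ge0// ltW. Qed.

Lemma norm2_ridgeN_le : norm2 NN <= tau.
Proof. by rewrite rtr_ridgeZ lerDl mulr_ge0 ?norm2_ge0// ltW. Qed.

(** For a positive semidefinite matrix the Frobenius norm is at most the trace. No eigenvalues are
    used: the two Gram terms of [ridgeZE] have norms at most [norm2 NN] and [e * norm2 Z], which add
    up to tau. *)
Lemma norm2_ridgeZ_le : norm2 Z <= tau ^+ 2.
Proof.
rewrite {1}ridgeZE rtr_ridgeZ; apply: norm2_triangle.
- exact: norm2_ge0.
- by rewrite mulr_ge0 ?norm2_ge0// ltW.
- by apply: le_trans (norm2M _ _) _; rewrite norm2_adj expr2.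
- rewrite norm2Z exprMn ler_wpM2l ?sqr_ge0//.
  by apply: le_trans (norm2M _ _) _; rewrite norm2_adj expr2.
Qed.

Lemma rtr_ridge_gram : rtr (adjmx M *m M *m T) = q%:R - e * tau.
Proof.
have -> : adjmx M *m M = S - qreal e *: (adjmx Y *m Y) by rewrite /ridge addrK.
rewrite mulmxBl raddfB /= ridgeMV rtr1 -scalemxAl rtr_scale; congr (_ - _ * _).
by rewrite -mulmxA rtrC.
Qed.

Lemma rtr_ridge_hat : rtr (M *m T *m adjmx M) = q%:R - e * tau.
Proof. by rewrite rtrC mulmxA rtr_ridge_gram. Qed.

(** The gap q - e tau is the trace of the ridge hat matrix M V M^H, which V = V S V turns into |M V
    M^H|^2 + e |Y V M^H|^2. *)
Lemma ridgeZ_ub : e * tau <= q%:R.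
Proof.
rewrite -subr_ge0 -rtr_ridge_hat {1}ridgeVE mulmxDr mulmxDl raddfD /=.
rewrite mulmx_scaler -scalemxAl rtr_scale.
apply: addr_ge0.
  rewrite [X in rtr X](_ : _ = adjmx (M *m T *m adjmx M) *m (M *m T *m adjmx M)).
    exact: norm2_ge0.
  by rewrite !(adjmxM (M *m T)) !(adjmxM M) adjmxK adjmx_ridgeV !mulmxA.
apply: mulr_ge0; first exact: ltW.
rewrite [X in rtr X](_ : _ = adjmx (Y *m T *m adjmx M) *m (Y *m T *m adjmx M)).
  exact: norm2_ge0.
by rewrite !(adjmxM (Y *m T)) !(adjmxM Y) adjmxK adjmx_ridgeV !mulmxA.
Qed.

(** Uniform in [G]: a left inverse of [Y] recovers V from [Z], whose trace is at most q / e. Stein's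
    identity draws on this bound twice, for the growth of V and for its differentiability. *)
Lemma norm2_ridgeV_ub :
  norm2 T <= (norm2 (qinv (adjmx Y *m Y) *m adjmx Y) * (q%:R / e)) ^+ 2.
Proof.
have [_ LY hL] := qinvP (posdef_gram Yfull); set L := qinv _ in LY hL *.
have -> : T = (L *m adjmx Y) *m Z *m adjmx (L *m adjmx Y).
  rewrite adjmxM adjmxK hL /ridgeZ -!mulmxA (mulmxA (adjmx Y) Y L).
  have -> : adjmx Y *m Y *m L = 1%:M by have [] := qinvP (posdef_gram Yfull).
  by rewrite mulmx1 (mulmxA (adjmx Y)) mulmxA LY mul1mx.
apply: le_trans (norm2M _ _) _; rewrite norm2_adj.
have h : norm2 Z <= (q%:R / e) ^+ 2.
  rewrite (le_trans norm2_ridgeZ_le)// ler_pXn2r ?nnegrE ?ridgeZ_ge0//.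
    by rewrite ler_pdivlMr// mulrC ridgeZ_ub.
  by rewrite divr_ge0 ?ler0n// ltW.
have h' := le_trans (norm2M _ _) (ler_wpM2l (norm2_ge0 (L *m adjmx Y)) h).
apply: le_trans (ler_wpM2r (norm2_ge0 _) h') _.
by rewrite le_eqVlt; apply/orP; left; apply/eqP; ring.
Qed.

(** [Y *m x] is a nonzero fixed vector of e Z, and the norm of [Z] is at most tau. *)
Lemma ridge_singular (x : 'cV[Q]_q) : M *m x = 0 -> x != 0 -> 1 <= e * tau.
Proof.
move=> Mx x0.
have xE : Y *m x = qreal e *: (Z *m (Y *m x)).
  rewrite -{1}[x]mul1mx -ridgeVM {2}/ridge mulmxDr mulmxDl.
  rewrite -!mulmxA (mulmxA G) Mx !mulmx0 add0r -scalemxAl !mulmx_scaler.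
  by rewrite /ridgeZ !mulmxA.
have nY : 0 < norm2 (Y *m x).
  by rewrite norm2_gt0; apply: contra_neq x0; exact: Yfull.
have : norm2 (Y *m x) <= (e * tau) ^+ 2 * norm2 (Y *m x).
  rewrite {1}xE norm2Z exprMn -[leRHS]mulrA ler_wpM2l ?sqr_ge0//.
  apply: le_trans (norm2M _ _) _.
  by rewrite ler_wpM2r ?norm2_ge0// norm2_ridgeZ_le.
rewrite -{1}[norm2 _]mul1r ler_pM2r// => h.
by rewrite -(@ler_pXn2r _ 2) ?nnegrE ?ler01 ?expr1n// mulr_ge0 ?ridgeZ_ge0// ltW.
Qed.

(** The summand e Y^H makes the regularised map Y V (M^H G + e Y^H) fix [Y] exactly, because M^H G Y
    + e Y^H Y is the matrix that V inverts. Only the residual of [Y'] is left, and on it the extra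
    summand vanishes. *)
Lemma ridge_residual r (Y' : 'M[Q]_(N, r)) :
  Y *m T *m (adjmx M *m G + qreal e *: adjmx Y) *m Y' - Y' =
  Y *m T *m adjmx M *m G *m residual Y Y' - residual Y Y'.
Proof.
set B := residual Y Y'.
have AE : Y' = Y *m (qinv (adjmx Y *m Y) *m adjmx Y *m Y') + B.
  by rewrite /B /residual addrC subrK.
set C := qinv _ *m _ *m _ in AE.
have YB : adjmx Y *m B = 0 by exact: adjmx_residual.
have : Y *m T *m (adjmx M *m G + qreal e *: adjmx Y) *m Y = Y.
  have -> : (Y *m T *m (adjmx M *m G + qreal e *: adjmx Y) *m Y) = Y *m T *m S.
    by rewrite /ridge -mulmxA mulmxDl -scalemxAl !mulmxA.
  by rewrite -mulmxA ridgeVM mulmx1.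
set K := Y *m T *m _ => KY.
rewrite AE (mulmxDr K) (mulmxA K) KY opprD addrACA subrr add0r /K.
by rewrite -mulmxA mulmxDl -scalemxAl YB scaler0 addr0 -!mulmxA.
Qed.

Section Limit.
Variable L : 'M[Q]_q.
Hypotheses (LR : adjmx M *m M *m L = 1%:M) (hL : adjmx L = L).
Local Notation w := (rtr (Y *m L *m adjmx Y)).

Lemma gramV_ridgeV : L = T + qreal e *: (T *m (adjmx Y *m Y) *m L).
Proof.
rewrite -{1}[L]mul1mx -ridgeVM {2}/ridge mulmxDr mulmxDl -[X in X + _]mulmxA LR.
by rewrite mulmx1 mulmx_scaler -scalemxAl.
Qed.

Lemma gramVE : L = L *m adjmx M *m M *m L.
Proof. by rewrite -2!(mulmxA L) LR mulmx1. Qed.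

(** By the resolvent identity the difference is e times the trace of a product of two positive
    semidefinite matrices. The upper bound no longer depends on [e]. *)
Lemma ridgeZ_le_gram : tau <= w.
Proof.
have -> : w = tau + e * rtr (Z *m (Y *m L *m adjmx Y)).
  rewrite {1}gramV_ridgeV mulmxDr mulmxDl raddfD /= mulmx_scaler -scalemxAl.
  by rewrite rtr_scale /ridgeZ !mulmxA.
rewrite lerDl mulr_ge0 ?(ltW e0)//.
have -> : Y *m L *m adjmx Y = adjmx (M *m L *m adjmx Y) *m (M *m L *m adjmx Y).
  rewrite {1}gramVE !(adjmxM (M *m L)) !(adjmxM M) adjmxK hL.
  by rewrite !mulmxA.
set V := M *m L *m adjmx Y.
rewrite mulmxA rtrC mulmxA.
rewrite {1}ridgeZE mulmxDr mulmxDl raddfD /= mulmx_scaler -scalemxAl rtr_scale.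
have e1 r (K : 'M[Q]_(r, N)) :
    rtr (V *m (adjmx K *m K) *m adjmx V) = norm2 (K *m adjmx V).
  by rewrite /norm2 /qdot adjmxM adjmxK !mulmxA.
apply: addr_ge0; first by rewrite e1; exact: norm2_ge0.
by apply: mulr_ge0; [exact: ltW|rewrite e1; exact: norm2_ge0].
Qed.

(** The resolvent identity gives u = u' + e Z u with |Z| <= w, so the cost of the regularisation is
    explicit in [e]. *)
Lemma norm2_ridge_limit r (v : 'M[Q]_(p, r)) : e * w <= 1 ->
  (1 - e * w) ^+ 2 * norm2 (Y *m L *m adjmx M *m v) <=
  norm2 (Y *m T *m adjmx M *m v).
Proof.
move=> ew; set u := Y *m L *m adjmx M *m v; set u' := Y *m T *m adjmx M *m v.
have uE : u = u' + qreal e *: (Z *m u).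
  rewrite /u {1}gramV_ridgeV mulmxDr !mulmxDl mulmx_scaler -!scalemxAl.
  by rewrite /u' /u /ridgeZ !mulmxA.
have w0 : 0 <= w by apply: le_trans ridgeZ_ge0 ridgeZ_le_gram.
have ew0 : 0 <= e * w by apply: mulr_ge0 => //; exact: ltW.
have nZ : norm2 Z <= w ^+ 2.
  apply: le_trans norm2_ridgeZ_le _.
  apply: lerXn2r ridgeZ_le_gram; rewrite nnegrE; [exact: ridgeZ_ge0|exact: w0].
exact: norm2_perturb (ltW e0) w0 ew nZ uE.
Qed.

End Limit.

End Ridge.

(** * Function classes closed under quaternion matrix operations *)

Section FunctionAlgebra.
Variables (R : realType) (E : Type).
Local Notation Q := (quat R).

(** The instances are the measurable functions, the tame functions and the functions continuous at a
    point; closure under matrix operations is proved once for all three. *)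
Record subalgebra (C : (E -> R) -> Prop) : Prop := Subalgebra {
  subalgebra_cst : forall a, C (fun=> a);
  subalgebra_add : forall f g, C f -> C g -> C (fun x => f x + g x);
  subalgebra_mul : forall f g, C f -> C g -> C (fun x => f x * g x) }.

Definition quat_in (C : (E -> R) -> Prop) (f : E -> Q) :=
  forall c, C (fun x => qcoord c (f x)).
Definition mx_in (C : (E -> R) -> Prop) m n (F : E -> 'M[Q]_(m, n)) :=
  forall i j, quat_in C (fun x => F x i j).

Variable C : (E -> R) -> Prop.
Hypothesis CP : subalgebra C.
Let Cc := subalgebra_cst CP.
Let Ca := subalgebra_add CP.
Let Cm := subalgebra_mul CP.

Lemma subalgebra_opp f : C f -> C (fun x => - f x).
Proof.
move=> h; have -> : (fun x => - f x) = (fun x => -1 * f x).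
  by apply/funext => x; rewrite mulN1r.
exact: Cm (Cc _) h.
Qed.

Lemma subalgebra_sub f g : C f -> C g -> C (fun x => f x - g x).
Proof. by move=> hf /subalgebra_opp; exact: Ca. Qed.

Lemma subalgebra_sum I (s : seq I) (f : I -> E -> R) :
  (forall i, C (f i)) -> C (fun x => \sum_(i <- s) f i x).
Proof.
move=> h; elim: s => [|i s IH].
  by under eq_fun do rewrite big_nil; exact: Cc.
by under eq_fun do rewrite big_cons; exact: Ca.
Qed.

Lemma quat_inP (f : E -> Q) :
  quat_in C f <-> [/\ C (fun x => qw (f x)), C (fun x => qx (f x)),
                      C (fun x => qy (f x)) & C (fun x => qz (f x))].
Proof.
split=> [h|[h0 h1 h2 h3]].
  by split; [exact: (h 0)|exact: (h 1)|exact: (h 2%:R)|exact: (h 3%:R)].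
by case=> [[|[|[|[|//]]]] i].
Qed.

Lemma quat_in_cst q : quat_in C (fun=> q).
Proof. by move=> c; exact: Cc. Qed.

Lemma quat_in_add f g : quat_in C f -> quat_in C g -> quat_in C (fun x => f x + g x).
Proof. by move=> hf hg c; under eq_fun do rewrite raddfD; exact: Ca (hf c) (hg c). Qed.

Lemma quat_in_opp f : quat_in C f -> quat_in C (fun x => - f x).
Proof. by move=> hf c; under eq_fun do rewrite raddfN; exact: subalgebra_opp (hf c). Qed.

Lemma quat_in_mul f g : quat_in C f -> quat_in C g -> quat_in C (fun x => f x * g x).
Proof.
move=> /quat_inP[f0 f1 f2 f3] /quat_inP[g0 g1 g2 g3]; apply/quat_inP.
have M u v : C u -> C v -> C (fun x => u x * v x) by exact: Cm.
have B u v : C u -> C v -> C (fun x => u x - v x) by exact: subalgebra_sub.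
have D u v : C u -> C v -> C (fun x => u x + v x) by exact: Ca.
by split; [apply: (B (fun x => _ - _ - _)) (M _ _ f3 g3);
    apply: (B (fun x => _ - _)) (M _ _ f2 g2); apply: B (M _ _ f1 g1)
  |apply: (B (fun x => _ + _ + _)) (M _ _ f3 g2);
    apply: (D (fun x => _ + _)) (M _ _ f2 g3); apply: D (M _ _ f1 g0)
  |apply: (D (fun x => _ - _ + _)) (M _ _ f3 g1);
    apply: (D (fun x => _ - _)) (M _ _ f2 g0); apply: B (M _ _ f1 g3)
  |apply: (D (fun x => _ + _ - _)) (M _ _ f3 g0);
    apply: (B (fun x => _ + _)) (M _ _ f2 g1); apply: D (M _ _ f1 g2)];
  apply: M.
Qed.

Lemma quat_in_conj f : quat_in C f -> quat_in C (fun x => qconj (f x)).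
Proof.
move=> /quat_inP[f0 f1 f2 f3]; apply/quat_inP.
by split => //=; apply: subalgebra_opp.
Qed.

Lemma quat_in_real f : C f -> quat_in C (fun x => qreal (f x)).
Proof. by move=> h; apply/quat_inP; split => //=; exact: Cc. Qed.

Lemma quat_in_sum I (s : seq I) (f : I -> E -> Q) :
  (forall i, quat_in C (f i)) -> quat_in C (fun x => \sum_(i <- s) f i x).
Proof.
by move=> h c; under eq_fun do rewrite raddf_sum; apply: subalgebra_sum => i; exact: (h i c).
Qed.

Section Matrices.
Variables m n : nat.
Implicit Types F H : E -> 'M[Q]_(m, n).

Lemma mx_in_cst (M : 'M[Q]_(m, n)) : mx_in C (fun=> M).
Proof. by move=> i j; exact: quat_in_cst. Qed.

Lemma mx_in_add F H : mx_in C F -> mx_in C H -> mx_in C (fun x => F x + H x).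
Proof.
by move=> hF hH i j; under eq_fun do rewrite mxE; exact: quat_in_add (hF i j) (hH i j).
Qed.

Lemma mx_in_opp F : mx_in C F -> mx_in C (fun x => - F x).
Proof. by move=> hF i j; under eq_fun do rewrite mxE; exact: quat_in_opp (hF i j). Qed.

Lemma mx_in_sub F H : mx_in C F -> mx_in C H -> mx_in C (fun x => F x - H x).
Proof. by move=> hF /mx_in_opp; exact: mx_in_add. Qed.

Lemma mx_in_sum I (s : seq I) (f : I -> E -> 'M[Q]_(m, n)) :
  (forall i, mx_in C (f i)) -> mx_in C (fun x => \sum_(i <- s) f i x).
Proof.
move=> h i j; under eq_fun do rewrite summxE.
by apply: quat_in_sum => k; exact: (h k i j).
Qed.

Lemma mx_in_scale (f : E -> Q) F :
  quat_in C f -> mx_in C F -> mx_in C (fun x => f x *: F x).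
Proof.
by move=> hf hF i j; under eq_fun do rewrite mxE; exact: quat_in_mul hf (hF i j).
Qed.

Lemma mx_in_adj F : mx_in C F -> mx_in C (fun x => adjmx (F x)).
Proof.
by move=> hF i j; under eq_fun do rewrite adjmxE; exact: quat_in_conj (hF j i).
Qed.

Lemma mx_in_mul p F (H : E -> 'M[Q]_(n, p)) :
  mx_in C F -> mx_in C H -> mx_in C (fun x => F x *m H x).
Proof.
move=> hF hH i j; under eq_fun do rewrite mxE.
by apply: quat_in_sum => k; exact: quat_in_mul (hF i k) (hH k j).
Qed.

Lemma in_norm2 F : mx_in C F -> C (fun x => norm2 (F x)).
Proof.
move=> hF; under eq_fun do rewrite norm2E.
apply: subalgebra_sum => i; apply: subalgebra_sum => j.
have /quat_inP[f0 f1 f2 f3] := hF i j.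
by rewrite /qnorm2; do ![apply: Ca|apply: Cm].
Qed.

Lemma in_qdot F H : mx_in C F -> mx_in C H -> C (fun x => qdot (F x) (H x)).
Proof.
move=> hF hH; under eq_fun do rewrite qdotE.
apply: subalgebra_sum => i; apply: subalgebra_sum => j.
have /quat_in_conj fF := hF i j.
by have /quat_inP[] := quat_in_mul fF (hH i j).
Qed.

End Matrices.

Lemma in_rtr n (F : E -> 'M[Q]_n) : mx_in C F -> C (fun x => rtr (F x)).
Proof. by move=> hF; apply: subalgebra_sum => i; have /quat_inP[] := hF i i. Qed.

Lemma mx_in_block m1 m2 n1 n2 (F11 : E -> 'M[Q]_(m1, n1)) (F12 : E -> 'M[Q]_(m1, n2))
  (F21 : E -> 'M[Q]_(m2, n1)) (F22 : E -> 'M[Q]_(m2, n2)) :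
  mx_in C F11 -> mx_in C F12 -> mx_in C F21 -> mx_in C F22 ->
  mx_in C (fun x => block_mx (F11 x) (F12 x) (F21 x) (F22 x)).
Proof.
move=> h1 h2 h3 h4 i j.
have [i' ->|i' ->] := split_ordP i; have [j' ->|j' ->] := split_ordP j.
- by under eq_fun do rewrite block_mxEul; exact: h1.
- by under eq_fun do rewrite block_mxEur; exact: h2.
- by under eq_fun do rewrite block_mxEdl; exact: h3.
- by under eq_fun do rewrite block_mxEdr; exact: h4.
Qed.

(** The Schur recursion is rational in the entries, so a class closed under inversion suffices.
    Measurable functions form such a class; tame functions do not. *)
Lemma mx_in_qinv n (F : E -> 'M[Q]_n) :
  (forall f, C f -> C (fun x => (f x)^-1)) ->
  mx_in C F -> mx_in C (fun x => qinv (F x)).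
Proof.
move=> Cv; elim: n F => [|n IH] F hF; first by move=> [].
pose a x := qreal (qw (F x 0 0))^-1.
pose b x := dlsubmx (F x : 'M[Q]_(1 + n)).
pose c x := ursubmx (F x : 'M[Q]_(1 + n)).
pose L x := qinv (drsubmx (F x : 'M[Q]_(1 + n)) - a x *: (b x *m c x)).
have hb : mx_in C b by move=> i j; rewrite /b; under eq_fun do rewrite !mxE; exact: hF.
have hc : mx_in C c by move=> i j; rewrite /c; under eq_fun do rewrite !mxE; exact: hF.
have hD : mx_in C (fun x => drsubmx (F x : 'M[Q]_(1 + n))).
  by move=> i j; under eq_fun do rewrite !mxE; exact: hF.
have ha : quat_in C a.
  by apply/quat_in_real/Cv; have /quat_inP[] := hF 0 0.
have haa : quat_in C (fun x => a x * a x) by exact: quat_in_mul.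
have hL : mx_in C L.
  by apply: IH; apply: mx_in_sub => //; apply: mx_in_scale => //; exact: mx_in_mul.
have hcL : mx_in C (fun x => c x *m L x) by exact: mx_in_mul.
have h11 : mx_in C (fun x => (a x)%:M + (a x * a x) *: (c x *m L x *m b x)).
  apply: mx_in_add; last by apply: mx_in_scale => //; exact: mx_in_mul.
  move=> i j; under eq_fun do rewrite !mxE.
  by case: (i == j); [exact: ha|exact: quat_in_cst].
have h12 : mx_in C (fun x => - (a x *: (c x *m L x))).
  by apply: mx_in_opp; exact: mx_in_scale.
have h21 : mx_in C (fun x => - (a x *: (L x *m b x))).
  by apply: mx_in_opp; apply: mx_in_scale => //; exact: mx_in_mul.
exact: (mx_in_block h11 h12 h21 hL).
Qed.

End FunctionAlgebra.

(** * Independence and Stein's identity *)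

Section Decoupling.
Context d (T : measurableType d) (R : realType) (P : probability T R).
Context d1 d2 (E1 : measurableType d1) (E2 : measurableType d2).

Definition independent_maps (X1 : T -> E1) (X2 : T -> E2) :=
  forall A B, measurable A -> measurable B ->
    P (X1 @^-1` A `&` X2 @^-1` B) = (P (X1 @^-1` A) * P (X2 @^-1` B))%E.

(** The law of the pair is the product of the two laws, since they agree on rectangles; Tonelli's
    theorem then separates the variables. *)
Lemma decoupling (X1 : T -> E1) (X2 : T -> E2) (f : (E1 * E2)%type -> \bar R) :
  measurable_fun setT X1 -> measurable_fun setT X2 -> independent_maps X1 X2 ->
  measurable_fun setT f -> (forall x, 0 <= f x)%E ->
  (\int[P]_w f (X1 w, X2 w) = \int[P]_w \int[P]_w' f (X1 w, X2 w'))%E.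
Proof.
move=> mX1 mX2 ind mf f0.
pose Y1 : {mfun T >-> E1} := HB.pack X1 (isMeasurableFun.Build _ _ _ _ _ mX1).
pose Y2 : {mfun T >-> E2} := HB.pack X2 (isMeasurableFun.Build _ _ _ _ _ mX2).
have mX12 : measurable_fun setT (fun w => (X1 w, X2 w)) by exact: measurable_fun_pair.
pose Y12 : {mfun T >-> (E1 * E2)%type} :=
  HB.pack (fun w => (X1 w, X2 w)) (isMeasurableFun.Build _ _ _ _ _ mX12).
pose m1 := distribution P Y1; pose m2 := distribution P Y2.
have mE : forall X, measurable X -> (m1 \x m2)%E X = distribution P Y12 X.
  by apply: product_measure_unique => A B mA mB; exact: ind.
transitivity (\int[distribution P Y12]_z f z)%E.
  by rewrite ge0_integral_distribution.
rewrite (@eq_measure_integral _ _ _ _ (m1 \x m2)%E); last by move=> A mA _; exact/esym/mE.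
rewrite fubini_tonelli1// ge0_integral_distribution//=; last 2 first.
- exact: measurable_fun_fubini_tonelli_F.
- by move=> x; exact: integral_ge0.
apply: eq_integral => w _; rewrite /= /fubini_F ge0_integral_distribution//.
exact: measurable_fun_pair2.
Qed.

End Decoupling.

(** * The product sigma-algebra on finite families of reals *)

Section FunctionSpace.
Variables (K : finType) (R : realType).

Definition box (B : K -> set R) : set (K -> R) := [set x | forall k, B k (x k)].
Definition boxes : set (set (K -> R)) :=
  [set A | exists2 B, (forall k, measurable (B k)) & A = box B].
Definition fspace := g_sigma_algebraType boxes.

Lemma boxesI : setI_closed boxes.
Proof.
move=> _ _ [B mB ->] [B' mB' ->]; exists (fun k => B k `&` B' k).
  by move=> k; exact: measurableI.
apply/seteqP; split=> x /=; first by move=> [h h'] k; split.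
by move=> h; split=> k; have [] := h k.
Qed.

Lemma boxesT : boxes setT.
Proof.
exists (fun=> setT) => //.
by apply/seteqP; split=> x.
Qed.

Lemma measurable_coord k : measurable_fun setT (fun x : fspace => x k).
Proof.
move=> _ B mB; rewrite setTI; apply: sub_sigma_algebra.
exists (fun j => if j == k then B else setT); first by move=> j; case: ifP.
apply/seteqP; split=> x /=; first by move=> Bx j; case: eqP => // ->.
by move=> /(_ k); rewrite eqxx.
Qed.

Lemma measurable_fspace d (T : measurableType d) (f : T -> fspace) :
  (forall k, measurable_fun setT (fun w => f w k)) -> measurable_fun setT f.
Proof.
move=> mf; apply: (@measurability _ _ T fspace setT f boxes) => //.
move=> _ [_ [B mB ->] <-]; rewrite setTI.
have -> : f @^-1` box B = \big[setI/setT]_(k : K) ((fun w => f w k) @^-1` B k).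
  apply/seteqP; split=> w /=; rewrite -bigcap_seq.
    by move=> h k _; exact: h.
  by move=> h k; apply: h; rewrite /= mem_index_enum.
apply: bigsetI_measurable => k _.
by rewrite -[X in measurable X]setTI; exact: mf.
Qed.

Lemma fspace_measure_eq (m1 m2 : {measure set fspace -> \bar R}) :
  (m1 setT < +oo)%E -> (forall B, (forall k, measurable (B k)) -> m1 (box B) = m2 (box B)) ->
  forall A, measurable A -> m1 A = m2 A.
Proof.
move=> m1oo h; apply: (@measure_unique _ R fspace boxes (fun=> setT) _ _ _ _ m1 m2) => //.
- exact: boxesI.
- by move=> _; exact: boxesT.
- by rewrite bigcup_const.
- by move=> _ [B mB ->]; exact: h.
Qed.

End FunctionSpace.

Section Independence.
Context d (T : measurableType d) (R : realType) (P : probability T R).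

Definition entries m n (G : T -> 'M[quat R]_(m, n)) (w : T) :
  fspace ('I_4 * 'I_m * 'I_n)%type R := fun k => real_entries G k w.

(** [entries G] is measurable for the sigma-algebra generated by [G], which brings in events that
    involve many entries at once. *)
Lemma independent_entries m n m' n' (G : T -> 'M[quat R]_(m, n))
    (G' : T -> 'M[quat R]_(m', n')) :
  independent_matrices P G G' -> independent_maps P (entries G) (entries G').
Proof.
move=> ind A B mA mB; apply: ind.
  pose C := [set E | exists k (B : set R),
         measurable B /\ E = real_entries G k @^-1` B].
  have h : measurable_fun setT (entries G : g_sigma_algebraType C -> _).
    apply: measurable_fspace => k _ D mD; rewrite setTI.
    by apply: sub_sigma_algebra; exists k, D.
  by have := h measurableT A mA; rewrite setTI.
pose C := [set E | exists k (B : set R),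
       measurable B /\ E = real_entries G' k @^-1` B].
have h : measurable_fun setT (entries G' : g_sigma_algebraType C -> _).
  apply: measurable_fspace => k _ D mD; rewrite setTI.
  by apply: sub_sigma_algebra; exists k, D.
by have := h measurableT B mB; rewrite setTI.
Qed.

Section Coordinate.
Variables (K : finType) (X : K -> T -> R).
Hypotheses (mX : forall k, measurable_fun setT (X k))
           (indX : mutually_independent P X).

(** Coordinate [k] is set to 0 instead of being removed, so that the index type stays [K]. *)
Definition reset (k : K) (w : T) : fspace K R :=
  fun i => if i == k then 0 else X i w.

Lemma measurable_reset k : measurable_fun setT (reset k).
Proof.
apply: measurable_fspace => i; rewrite /reset; case: eqP => _ //.
Qed.

(** For fixed [B], both sides are finite measures in [A]. They are compared on boxes, where mutual
    independence gives product formulas. *)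
Lemma independent_reset k : independent_maps P (reset k) (X k).
Proof.
move=> A B mA mB.
have mXB : measurable (X k @^-1` B) by rewrite -[X in measurable X]setTI; exact: mX.
pose Y : {mfun T >-> fspace K R} :=
  HB.pack (reset k) (isMeasurableFun.Build _ _ _ _ _ (@measurable_reset k)).
pose c : {nonneg R} := NngNum (fine_ge0 (measure_ge0 P (X k @^-1` B))).
have cE : (c%:num)%:E = P (X k @^-1` B) by rewrite /= fineK// fin_num_measure.
have mY := @measurable_reset k.
pose m1 : {measure set (fspace K R) -> \bar R} :=
  pushforward (mrestr P mXB) Y.
pose m2 : {measure set (fspace K R) -> \bar R} := mscale c (distribution P Y).
suff : m1 mY A = m2 A.
  by rewrite /m1 /m2 /= /pushforward /mrestr /mscale /= cE muleC.
apply: fspace_measure_eq mA; rewrite /m1 /= /pushforward /mrestr.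
  by rewrite preimage_setT setTI (le_lt_trans (probability_le1 P mXB))// ltry.
move=> C mC; rewrite /m2 /mscale /= cE /distribution /pushforward.
(* Coordinate [k] receives a free event [D]: taking [B] gives the joint probability, taking [setT]
   the marginal one. *)
have key D : measurable D ->
    P (\bigcap_(i in [set` [set: K]%SET]) (X i @^-1` (if i == k then D else C i))) =
    (P (X k @^-1` D) * \prod_(i | i != k) P (X i @^-1` C i))%E.
  move=> mD; rewrite (indX [set: K]%SET (_ : forall i, measurable (if i == k then D else C i)));
    last by move=> i; case: ifP.
  rewrite (bigD1 k) ?inE//= eqxx; congr (_ * _)%E.
  by apply: eq_big => [i|i /andP[_ /negPf ->]]; rewrite ?inE.
(* [reset k] always has value 0 at [k]: a box that excludes 0 there has empty preimage, and any
   other box leaves [X k] unconstrained. *)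
have [C0|C0] := pselect (C k 0); last first.
  have -> : Y @^-1` box C = set0.
    by apply/seteqP; split=> w //= /(_ k); rewrite /reset eqxx.
  by rewrite set0I measure0 mule0.
have YE D : Y @^-1` box C `&` X k @^-1` D =
    \bigcap_(i in [set` [set: K]%SET]) (X i @^-1` (if i == k then D else C i)).
  apply/seteqP; split=> w /=.
    move=> [h1 h2] i _ /=; case: eqP => [->//|/eqP ik].
    by have := h1 i; rewrite /reset (negPf ik).
  move=> h; split; last by have := h k; rewrite /= eqxx; apply; rewrite inE.
  move=> i; rewrite /reset; case: eqP => [->//|/eqP ik].
  by have := h i; rewrite /= (negPf ik); apply; rewrite inE.
rewrite YE key//; congr (_ * _)%E.
rewrite -[Y @^-1` _]setIT -(preimage_setT (X k)) YE key//.
by rewrite preimage_setT probability_setT mul1e.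
Qed.

End Coordinate.

End Independence.

(** * Stein's identity for one standard normal variable *)

Section NormalStein.
Variable R : realType.
Local Notation mu := (@lebesgue_measure R).
Local Notation N01 := (@normal_prob R 0 1).
Local Notation phi := (@normal_pdf R 0 1).

Lemma ge0_integral_normal (f : R -> \bar R) : (forall x, (0 <= f x)%E) ->
  measurable_fun setT f ->
  (\int[N01]_x f x = \int[mu]_x (f x * (phi x)%:E))%E.
Proof.
move=> f0 mf; have dom := @normal_prob_dominates R 0 1.
rewrite -(Radon_Nikodym_SigmaFinite.change_of_variables dom)//.
have mphi : measurable_fun setT (EFin \o phi).
  by apply/measurable_EFinP; exact: measurable_normal_pdf.
have gi := Radon_Nikodym_SigmaFinite.f_integrable dom.
apply: ge0_ae_eq_integral => //.
- by apply: emeasurable_funM => //; exact: measurable_int gi.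
- exact: emeasurable_funM.
- by move=> x _; rewrite mule_ge0// Radon_Nikodym_SigmaFinite.f_ge0.
- by move=> x _; rewrite mule_ge0// lee_fin normal_pdf_ge0.
- apply: ae_eqe_mul2l; apply: integral_ae_eq => //.
  by move=> E _ mE; rewrite -Radon_Nikodym_SigmaFinite.f_integral.
Qed.

Lemma normal_pdf1E m t :
  normal_pdf m 1 t = normal_peak 1 * expR (- (t - m) ^+ 2 / 2) :> R.
Proof.
by rewrite normal_pdfE ?oner_eq0// /normal_fun expr1n -[1 *+ 2]/(2%:R).
Qed.

(** Completing the square: exponential tilting shifts the mean. Integrated over t, this is the
    moment generating function. *)
Lemma expR_normal_pdf b t :
  expR (b * t) * phi t = expR (b ^+ 2 / 2) * normal_pdf b 1 t.
Proof.
rewrite !normal_pdf1E mulrCA [RHS]mulrCA -!expRD; congr (_ * expR _).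
by field.
Qed.

Lemma integral_expR_normal_lty b :
  (\int[mu]_t (expR (b * `|t|) * phi t)%:E < +oo)%E.
Proof.
have mexp c : measurable_fun setT (fun t : R => (expR (c * t) * phi t)%:E).
  apply/measurable_EFinP; apply: measurable_funM; last exact: measurable_normal_pdf.
  by apply: measurableT_comp => //; exact: measurable_funM.
have h c : (\int[mu]_t (expR (c * t) * phi t)%:E = (expR (c ^+ 2 / 2))%:E)%E.
  under eq_integral do rewrite expR_normal_pdf EFinM.
  rewrite ge0_integralZl//.
  - by rewrite integral_normal_pdf mule1.
  - by apply/measurable_EFinP; exact: measurable_normal_pdf.
  - by move=> x _; rewrite lee_fin normal_pdf_ge0.
have h0 c t : (0 <= (expR (c * t) * phi t)%:E)%E.
  by rewrite lee_fin mulr_ge0 ?expR_ge0 ?normal_pdf_ge0.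
(* exp(b |t|) is one of exp(b t) and exp(- b t), hence at most their sum. *)
apply: (@le_lt_trans _ _ (\int[mu]_t ((expR (b * t) * phi t)%:E +
                                     (expR ((- b) * t) * phi t)%:E))%E).
  apply: ge0_le_integral => //.
  - by move=> t _; rewrite lee_fin mulr_ge0 ?expR_ge0 ?normal_pdf_ge0.
  - apply/measurable_EFinP; apply: measurable_funM; last exact: measurable_normal_pdf.
    apply: measurableT_comp => //; apply: measurable_funM => //.
  - by apply: emeasurable_funD; exact: mexp.
  - move=> t _; rewrite -EFinD lee_fin -mulrDl ler_wpM2r ?normal_pdf_ge0//.
    by case: (ger0P t) => _; rewrite ?mulrN -?mulNr ?lerDl ?lerDr expR_ge0.
have h' c : (\int[mu]_t (expR (c * t) * phi t)%:E < +oo)%E by rewrite h ltry.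
rewrite ge0_integralD//; first by apply: lte_add_pinfty; exact: h'.
all: exact: mexp.
Qed.

Lemma is_derive_normal_pdf (t : R) : is_derive t 1 (phi : R -> R) (- t * phi t).
Proof.
have -> : (phi : R -> R) =
    normal_peak 1 *: (expR \o (fun x : R => (- (2^-1) : R) *: (x ^+ 2))).
  apply/funext => x; rewrite normal_pdf1E subr0 -[RHS]/(_ * expR (_ * _)).
  by congr (_ * expR _); rewrite mulrC mulrN mulNr.
have hq : is_derive t 1 (fun x : R => (- (2^-1) : R) *: (x ^+ 2)) (- t).
  apply: is_derive_eq; change (- 2^-1 * (t * 1 + t * 1) = - t :> R); by field.
have hc := is_derive1_comp (is_derive_expR _) hq.
have hz := is_deriveZ (normal_peak 1 : R) hc.
apply: (is_derive_eq hz); set E := expR _.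
by change (normal_peak 1 * (E * - t) = - t * (normal_peak 1 * E) :> R); ring.
Qed.

Lemma expR_gauss_cvg0 (a : R) :
  expR (a * n%:R) * phi n%:R @[n --> \oo] --> 0.
Proof.
(* Here a n - n^2 / 2 <= (a + 1)^2 / 2 - n, the difference being (n - (a + 1))^2 / 2, and exp(- n)
   <= 1 / (n + 1). *)
pose c := normal_peak 1 * expR ((a + 1) ^+ 2 / 2) : R.
apply: (@squeeze_cvgr _ _ _ _ (cst 0) (fun n => c * (n.+1%:R)^-1)).
- near=> n; rewrite mulr_ge0 ?expR_ge0 ?normal_pdf_ge0//= normal_pdf1E subr0.
  rewrite mulrCA /c -mulrA ler_wpM2l ?normal_peak_ge0// -expRD.
  apply: (@le_trans _ _ (expR ((a + 1) ^+ 2 / 2) * expR (- n%:R))).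
    rewrite -expRD ler_expR -subr_ge0.
    have -> : (a + 1) ^+ 2 / 2 + - n%:R - (a * n%:R + - n%:R ^+ 2 / 2) =
      (n%:R - (a + 1)) ^+ 2 / 2 :> R by field.
    by rewrite divr_ge0// sqr_ge0.
  rewrite ler_wpM2l ?expR_ge0// expRN lef_pV2 ?posrE ?expR_gt0//.
  by rewrite -natr1 addrC expR_ge1Dx.
- exact: cvg_cst.
- rewrite -(mulr0 c); apply: cvgM; first exact: cvg_cst.
  exact: cvg_harmonic.
Unshelve. all: by end_near. Qed.

Section Stein1.
Variables (h h' : R -> R) (C a : R).
Hypotheses
  (dh : forall t : R, is_derive t 1 h (h' t)) (ch' : continuous h')
  (bh : forall t, `|h t| <= C * expR (a * `|t|))
  (bh' : forall t, `|h' t| <= C * expR (a * `|t|)).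

Let u t := t * h t - h' t.
Let g t := u t * phi t.

Let ch : continuous h.
Proof.
by move=> t; apply: differentiable_continuous; apply/derivable1_diffP; case: (dh t).
Qed.

Let cu : continuous u.
Proof.
move=> t; apply: cvgB; last exact: ch'.
by apply: cvgM; [exact: cvg_id|exact: ch].
Qed.

Let cg : continuous g.
Proof.
move=> t; apply: cvgM; first exact: cu.
exact: continuous_normal_pdf.
Qed.

Let C0 : 0 <= C.
Proof.
have := le_trans (normr_ge0 _) (bh 0).
by rewrite pmulr_lge0// expR_gt0.
Qed.

(** The additional 1 in the rate absorbs the factor t of [u], by 1 + |t| <= exp |t|. *)
Let g_ub t : `|g t| <= 2 * C * (expR ((a + 1) * `|t|) * phi t).
Proof.
rewrite /g normrM (ger0_norm (normal_pdf_ge0 _ _ _)) mulrA.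
rewrite ler_wpM2r ?normal_pdf_ge0//.
have e1 : 1 + `|t| <= expR `|t| by exact: expR_ge1Dx.
have -> : 2 * C * expR ((a + 1) * `|t|) = 2 * (C * expR (a * `|t|)) * expR `|t|.
  have -> : (a + 1) * `|t| = a * `|t| + `|t| by ring.
  by rewrite expRD !mulrA.
set B := C * _.
have B0 : 0 <= B by rewrite mulr_ge0 ?expR_ge0.
apply: le_trans (ler_normB _ _) _; rewrite normrM.
have := bh t; have := bh' t; rewrite -/B => k1 k2.
have := ler_wpM2l (normr_ge0 t) k2.
have := ler_wpM2l B0 e1; have := normr_ge0 t.
nra.
Qed.

Let mg : measurable_fun setT (EFin \o g).
Proof. by apply/measurable_EFinP; exact: continuous_measurable_fun. Qed.

Let ig : mu.-integrable setT (EFin \o g).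
Proof.
apply/integrableP; split => //.
apply: (@le_lt_trans _ _
  (\int[mu]_t ((2 * C)%:E * (expR ((a + 1) * `|t|) * phi t)%:E))%E).
  apply: ge0_le_integral => //.
  - exact: measurableT_comp.
  - apply: emeasurable_funM => //; apply/measurable_EFinP.
    apply: measurable_funM; last exact: measurable_normal_pdf.
    by apply: measurableT_comp => //; apply: measurable_funM.
  - by move=> t _; rewrite -EFinM lee_fin g_ub.
rewrite ge0_integralZl//.
- by rewrite lte_mul_pinfty ?lee_fin ?mulr_ge0// integral_expR_normal_lty.
- apply/measurable_EFinP; apply: measurable_funM; last exact: measurable_normal_pdf.
  by apply: measurableT_comp => //; apply: measurable_funM.
- by move=> t _; rewrite lee_fin mulr_ge0 ?expR_ge0 ?normal_pdf_ge0.
- by rewrite lee_fin mulr_ge0.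
Qed.

(** A primitive of [g], because phi' = - t phi. *)
Let F t := - (h t * phi t).

Let dF (t : R) : is_derive t 1 F (g t).
Proof.
have hp := is_deriveN (is_deriveM (dh t) (is_derive_normal_pdf t)).
apply: (is_derive_eq hp).
by change (- (h t * (- t * phi t) + phi t * h' t) = (t * h t - h' t) * phi t); ring.
Qed.

Let FTC (n : nat) : (0 < n)%N ->
  (\int[mu]_(t in `[(- n%:R)%R, n%:R]) (g t)%:E = (F n%:R - F (- n%:R))%:E)%E.
Proof.
move=> n0; rewrite EFinB; apply: continuous_FTC2.
- by rewrite gtrN// ltr0n.
- exact: continuous_subspaceT.
- have cF : continuous F.
    by move=> t; apply: differentiable_continuous; apply/derivable1_diffP; case: (dF t).
  split; first by move=> t _; case: (dF t).
    by apply: cvg_at_right_filter; exact: cF.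
  by apply: cvg_at_left_filter; exact: cF.
- by move=> t _; rewrite derive1E; case: (dF t).
Qed.

Let F_cvg0 : (F n%:R - F (- n%:R)) @[n --> \oo] --> 0.
Proof.
have F_ub t : `|F t| <= C * (expR (a * `|t|) * phi t).
  rewrite normrN normrM (ger0_norm (normal_pdf_ge0 _ _ _)) mulrA.
  by rewrite ler_wpM2r ?normal_pdf_ge0.
have phiN t : phi (- t) = phi t by rewrite !normal_pdf1E !subr0 sqrrN.
pose B n : R := 2 * C * (expR (a * n%:R) * phi n%:R).
have B0 : B n @[n --> \oo] --> 0.
  rewrite -(mulr0 (2 * C)); apply: cvgM; first exact: cvg_cst.
  exact: expR_gauss_cvg0.
apply: (@squeeze_cvgr _ _ _ _ (fun n => - B n) B) => //; last first.
  by rewrite -oppr0; exact: cvgN.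
near=> n; rewrite -ler_norml; apply: le_trans (ler_normB _ _) _.
have E (t : R) : `|t| = n%:R -> phi t = phi n%:R -> `|F t| <= C * (expR (a * n%:R) * phi n%:R).
  by move=> t1 t2; have := F_ub t; rewrite t1 t2.
have nn : `|n%:R| = n%:R :> R by rewrite ger0_norm.
have h1 := E n%:R nn erefl.
have h2 := E (- n%:R) (etrans (normrN _) nn) (phiN _).
by rewrite /B -(mulrA 2) mulr_natl mulr2n; exact: lerD.
Unshelve. all: by end_near. Qed.

(** [g] is an exact derivative: its integral over [-n, n] is a boundary term that tends to 0, and
    dominated convergence identifies the limit with the full integral. *)
Lemma integral_stein0 : (\int[mu]_t (g t)%:E = 0)%E.
Proof.
pose g_ (n : nat) := (EFin \o g) \_ `[(- n%:R)%R, n%:R].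
have mitv n : measurable `[(- n%:R : R), n%:R] by exact: measurable_itv.
have mg_ n : measurable_fun setT (g_ n).
  by apply/measurable_restrict => //; apply: measurable_funS mg.
have g_cvg : {ae mu, forall x, setT x -> g_ ^~ x @ \oo --> (EFin \o g) x}.
  apply: aeW => x _; apply: cvg_near_cst.
  near=> n; rewrite /g_ patchE mem_set//= in_itv/= -ler_norml.
  by near: n; exact: nbhs_infty_ger.
have g_ub' : {ae mu, forall x n, setT x -> (`|g_ n x| <= (abse \o (EFin \o g)) x)%E}.
  apply: aeW => x n _ /=; rewrite /g_ patchE; case: ifPn => _ //=.
  by rewrite normr0 lee_fin.
have [_ _ hcv] := @dominated_convergence _ _ R mu setT measurableT
  g_ (EFin \o g) (abse \o (EFin \o g)) mg_ mg g_cvg (integrable_abse ig) g_ub'.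
have hcv' : (\int[mu]_x g_ n x)%E @[n --> \oo] --> 0%E.
  have : (F n%:R - F (- n%:R))%:E @[n --> \oo] --> 0%E
    by apply/fine_cvgP; split; [exact: nearW|exact: F_cvg0].
  apply: cvg_trans; apply: near_eq_cvg; near=> n.
  have n0 : (0 < n)%N by near: n; exists 1%N.
  by rewrite -(FTC n0); exact: integral_mkcond.
exact: (cvg_unique _ hcv hcv').
Unshelve. all: by end_near. Qed.

(** Stated as an equality of positive and negative parts, so that it can be inserted into
    [ge0_resample], a formula for nonnegative functions. *)
Lemma stein_funeposneg :
  (\int[N01]_t (EFin \o u)^\+ t = \int[N01]_t (EFin \o u)^\- t)%E.
Proof.
have mu_ : measurable_fun setT (EFin \o u).
  by apply/measurable_EFinP; exact: continuous_measurable_fun.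
rewrite !ge0_integral_normal//; last 2 first.
- exact: measurable_funeneg.
- exact: measurable_funepos.
have -> : (\int[mu]_t ((EFin \o u)^\+ t * (phi t)%:E) = \int[mu]_t (EFin \o g)^\+ t)%E.
  apply: eq_integral => t _; rewrite !funeposE /= -!EFin_max -EFinM.
  by rewrite maxr_pMl ?normal_pdf_ge0// mul0r.
have -> : (\int[mu]_t ((EFin \o u)^\- t * (phi t)%:E) = \int[mu]_t (EFin \o g)^\- t)%E.
  apply: eq_integral => t _; rewrite !funenegE /= -!EFin_max -EFinM.
  by rewrite maxr_pMl ?normal_pdf_ge0// mul0r mulNr.
have := integral_stein0; rewrite integralE => /eqP; rewrite sube_eq ?add0e.
- by move/eqP.
- by apply: integrable_fin_num => //; exact: integrable_funepos.
- by rewrite fin_num_adde_defl//; apply: integrable_fin_num => //; exact: integrable_funeneg.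
Qed.

End Stein1.
End NormalStein.

(** * Tame functions and Stein's identity for a Gaussian family *)

Section Tame.
Variables (K : finType) (R : realType).
Implicit Types (x : fspace K R) (f : fspace K R -> R).

Definition upd x (k : K) (t : R) : fspace K R := fun i => if i == k then t else x i.

Lemma upd_same x k : upd x k (x k) = x.
Proof. by apply/funext => i; rewrite /upd; case: eqP => [->|]. Qed.

Lemma upd_upd x k t t' : upd (upd x k t) k t' = upd x k t'.
Proof. by apply/funext => i; rewrite /upd; case: eqP. Qed.

Lemma updE x k t : upd x k t k = t.
Proof. by rewrite /upd eqxx. Qed.

(** Products only add the rates, and the l1 norm in the exponent splits off a single coordinate. *)
Definition exp_growth f := exists C a, 0 <= a /\
  forall x, `|f x| <= C * expR (a * \sum_i `|x i|).

(* The regularity of f for Stein's identity that the entries of the regularised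
   inverse satisfy; continuity is only needed along coordinate lines. *)
Definition tame f :=
  [/\ measurable_fun setT f, exp_growth f &
      forall x k, continuous (fun t => f (upd x k t))].

Let sum_ge0 x : 0 <= \sum_i `|x i|. Proof. by apply: sumr_ge0. Qed.

Lemma exp_growth_ge0 f C a : (forall x, `|f x| <= C * expR (a * \sum_i `|x i|)) ->
  0 <= C.
Proof.
move=> h; have := le_trans (normr_ge0 _) (h (fun=> 0)).
by rewrite pmulr_lge0// expR_gt0.
Qed.

Lemma tame_subalgebra : subalgebra tame.
Proof.
split=> [c|f g [mf [C [a [a0 hf]]] cf] [mg [D [b [b0 hg]]] cg]|
  f g [mf [C [a [a0 hf]]] cf] [mg [D [b [b0 hg]]] cg]].
- split=> //; last by move=> x k t; exact: cvg_cst.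
  by exists `|c|, 0; split=> // x; rewrite mul0r expR0 mulr1.
- split; [exact: measurable_funD| |by move=> x k t; apply: cvgD; [exact: cf|exact: cg]].
  have C0 := exp_growth_ge0 hf; have D0 := exp_growth_ge0 hg.
  exists (C + D), (a + b); split=> [|x]; first exact: addr_ge0.
  apply: le_trans (ler_normD _ _) _; rewrite mulrDl lerD//.
    apply: le_trans (hf x) _; rewrite ler_wpM2l// ler_expR.
    by rewrite ler_wpM2r// lerDl.
  apply: le_trans (hg x) _; rewrite ler_wpM2l// ler_expR.
  by rewrite ler_wpM2r// lerDr.
- split; [exact: measurable_funM| |by move=> x k t; apply: cvgM; [exact: cf|exact: cg]].
  exists (C * D), (a + b); split=> [|x]; first exact: addr_ge0.
  rewrite normrM mulrDl expRD mulrACA; apply: ler_pM => //.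
Qed.

Lemma tame_coord k : tame (fun x => x k).
Proof.
split; first exact: measurable_coord.
  exists 1, 1; split=> // x; rewrite !mul1r (bigD1 k)//=.
  apply: le_trans (expR_ge1Dx _); rewrite addrCA lerDl addr_ge0//.
  by apply: sumr_ge0.
move=> x i t; rewrite /upd; case: eqP => _; [exact: cvg_id|exact: cvg_cst].
Qed.

Lemma subalgebra_measurable d (T : measurableType d) :
  subalgebra (fun f : T -> R => measurable_fun setT f).
Proof. by split=> *; [|exact: measurable_funD|exact: measurable_funM]. Qed.

Lemma subalgebra_cvg_at (t : R) :
  subalgebra (fun f : R -> R => {for t, continuous f}).
Proof. by split=> *; [exact: cvg_cst|exact: cvgD|exact: cvgM]. Qed.

End Tame.

Section Expectation.
Context d (T : measurableType d) (R : realType) (P : probability T R).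
Variables (K : finType) (X : K -> T -> R).
Hypotheses (nX : forall k, standard_normal P (X k))
           (indX : mutually_independent P X).

Let mX k : measurable_fun setT (X k). Proof. by have [] := nX k. Qed.
Definition joint (w : T) : fspace K R := fun k => X k w.

Lemma measurable_joint : measurable_fun setT joint.
Proof. by apply: measurable_fspace => k; exact: mX. Qed.

Lemma ge0_integral_standard_normal k (f : R -> \bar R) :
  (forall x, (0 <= f x)%E) -> measurable_fun setT f ->
  (\int[P]_w f (X k w) = \int[normal_prob 0 1]_x f x)%E.
Proof.
move=> f0 mf.
pose Y : {mfun T >-> measurableTypeR R} := HB.pack (X k : T -> measurableTypeR R)
  (isMeasurableFun.Build _ _ T (measurableTypeR R) _ (mX k)).
rewrite -(@ge0_integral_distribution _ _ _ _ _ P Y f)//.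
apply: (@eq_measure_integral _ _ R setT (normal_prob 0 1) (distribution P Y)).
move=> A mA _.
by have [_] := nX k; apply.
Qed.

(** Coordinate [k] is standard normal and independent of the others, so it may be redrawn while they
    are kept. *)
Lemma ge0_resample k (f : fspace K R -> \bar R) :
  (forall x, (0 <= f x)%E) -> measurable_fun setT f ->
  (\int[P]_w f (joint w) =
   \int[P]_w \int[normal_prob 0 1]_t f (upd (joint w) k t))%E.
Proof.
move=> f0 mf.
have mupd : measurable_fun setT (fun z : fspace K R * R => upd z.1 k z.2 : fspace K R).
  apply: measurable_fspace => i; rewrite /upd; case: eqP => _.
    exact: measurable_snd.
  exact: (measurableT_comp (measurable_coord i) measurable_fst).
pose g (z : fspace K R * R) := f (upd z.1 k z.2).
have gE w t : g (reset X k w, t) = f (upd (joint w) k t).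
  rewrite /g /=; congr f; apply/funext => i; rewrite /upd /reset /joint.
  by case: eqP.
transitivity (\int[P]_w g (reset X k w, X k w))%E.
  by apply: eq_integral => w _; rewrite gE -[X k w]/(joint w k) upd_same.
have mg : measurable_fun setT g by exact: measurableT_comp mf mupd.
rewrite (decoupling (measurable_reset mX k) (mX k) (independent_reset mX indX k) mg)//;
  last by move=> z; exact: f0.
apply: eq_integral => w _; rewrite (@ge0_integral_standard_normal k (fun t => g (reset X k w, t)))//.
- by apply: eq_integral => t _; exact: gE.
- by move=> t; exact: f0.
- exact: measurable_fun_pair2.
Qed.

Lemma tame_integrable f : tame f -> P.-integrable setT (fun w => (f (joint w))%:E).
Proof.
move=> [mf [C [a [a0 hf]]] _].
have C0 := exp_growth_ge0 hf.
apply/integrableP; split.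
  by apply/measurable_EFinP; exact: measurableT_comp mf measurable_joint.
pose b := a * #|K|%:R.
have mexp i : measurable_fun setT (fun w => (expR (b * `|X i w|))%:E).
  apply/measurable_EFinP; apply: measurableT_comp => //; apply: measurable_funM => //.
  exact: measurableT_comp.
have exp0 i w : (0 <= (expR (b * `|X i w|))%:E)%E by rewrite lee_fin expR_ge0.
(* Some coordinate is at least the average in absolute value, so one-dimensional exponential moments
   at rate [b = a * #|K|] suffice. The summand 1 covers an empty [K]. *)
have bound (x : fspace K R) :
    expR (a * \sum_i `|x i|) <= 1 + \sum_i expR (b * `|x i|).
  have s0 : 0 <= \sum_i expR (b * `|x i|) by apply: sumr_ge0 => i _; exact: expR_ge0.
  have [/eqP K0|K0] := boolP (#|K| == 0)%N.
    rewrite big1 => [|i _]; last by have := card0_eq K0 i; rewrite inE.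
    by rewrite mulr0 expR0 lerDl.
  have [i hi] : exists i, \sum_i `|x i| <= #|K|%:R * `|x i|.
    apply: contrapT => /forallNP h.
    have : \sum_(j : K) (#|K|%:R * `|x j|) < \sum_(j : K) (\sum_i `|x i|).
      have [k0 _] : exists k0 : K, k0 \in K by apply/card_gt0P; rewrite lt0n.
      apply: ltr_sum => [|j _]; last by rewrite ltNge; exact/negP.
      by apply/hasP; exists k0 => //; rewrite mem_index_enum.
    by rewrite -mulr_sumr sumr_const mulr_natl ltxx.
  rewrite [X in 1 + X](bigD1 i)//= addrCA -[leLHS]addr0 lerD//.
    by rewrite ler_expR /b -mulrA ler_wpM2l.
  by rewrite addr_ge0//; apply: sumr_ge0 => j _; exact: expR_ge0.
apply: (@le_lt_trans _ _
  (\int[P]_w (C%:E * (1 + \sum_i (expR (b * `|X i w|))%:E)))%E).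
  apply: ge0_le_integral => //.
  - by apply: measurableT_comp => //; apply/measurable_EFinP;
      exact: measurableT_comp mf measurable_joint.
  - apply: emeasurable_funM => //; apply: emeasurable_funD => //.
    exact: emeasurable_sum.
  - move=> w _; rewrite sumEFin -EFinD -EFinM lee_fin.
    by apply: le_trans (hf _) _; rewrite ler_wpM2l// bound.
rewrite ge0_integralZl//; first last.
- by move=> w _; rewrite adde_ge0// sume_ge0.
- by apply: emeasurable_funD => //; exact: emeasurable_sum.
rewrite ge0_integralD//; first last.
- exact: emeasurable_sum.
- by move=> w _; rewrite sume_ge0.
rewrite ge0_integral_sum// integral_cst//= mul1e probability_setT.
rewrite lte_mul_pinfty ?lee_fin// lte_add_pinfty ?ltry// lte_sum_pinfty// => i _.
rewrite (@ge0_integral_standard_normal i (fun t => (expR (b * `|t|))%:E)).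
- rewrite ge0_integral_normal.
  + by under eq_integral do rewrite -EFinM; exact: integral_expR_normal_lty.
  + by move=> t; rewrite lee_fin expR_ge0.
  + apply/measurable_EFinP; apply: measurableT_comp => //; exact: measurable_funM.
- by move=> t; rewrite lee_fin expR_ge0.
- apply/measurable_EFinP; apply: measurableT_comp => //; exact: measurable_funM.
Qed.

(** With the other coordinates frozen this is the one-dimensional identity along a line, averaged by
    [ge0_resample]. *)
Lemma stein (k : K) (f df : fspace K R -> R) : tame f -> tame df ->
  (forall x : fspace K R, is_derive (x k : R) 1 (fun t : R => f (upd x k t)) (df x)) ->
  (\int[P]_w (joint w k * f (joint w) - df (joint w))%:E = 0)%E.
Proof.
move=> tf tdf der.
pose u (x : fspace K R) := x k * f x - df x.
have tu : tame u.
  have h := subalgebra_mul (@tame_subalgebra K R) (@tame_coord K R k) tf.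
  exact: (subalgebra_sub (@tame_subalgebra K R) h tdf).
have [mu _ _] := tu.
have mU : measurable_fun setT (EFin \o u) by exact/measurable_EFinP.
have iu := tame_integrable tu.
have e : (\int[P]_w (EFin \o u)^\+ (joint w) = \int[P]_w (EFin \o u)^\- (joint w))%E.
  rewrite (ge0_resample k (f := (EFin \o u)^\+%E))//; last exact: measurable_funepos.
  rewrite (ge0_resample k (f := (EFin \o u)^\-%E))//; last exact: measurable_funeneg.
  apply: eq_integral => w _.
  have [_ [C [a [a0 hf]]] cf] := tf; have [_ [D [b [b0 hg]]] cg] := tdf.
  have C0 := exp_growth_ge0 hf; have D0 := exp_growth_ge0 hg.
  pose y := joint w; pose c := a + b.
  pose S := \sum_(i | i != k) `|y i|.
  have SE t : \sum_i `|upd y k t i| = `|t| + S.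
    rewrite (bigD1 k)//= updE; congr (_ + _); apply: eq_bigr => i /negPf ik.
    by rewrite /upd ik.
  have S0 : 0 <= S by apply: sumr_ge0.
  transitivity (\int[normal_prob 0 1]_t (EFin \o (fun t => u (upd y k t)))^\+ t)%E.
    by apply: eq_integral => t _; rewrite !funeposE.
  transitivity (\int[normal_prob 0 1]_t (EFin \o (fun t => u (upd y k t)))^\- t)%E;
    last by apply: eq_integral => t _; rewrite !funenegE.
  have -> : (fun t => u (upd y k t)) = (fun t => t * f (upd y k t) - df (upd y k t)).
    by apply/funext => t; rewrite /u updE.
  apply: (@stein_funeposneg R (fun t => f (upd y k t)) (fun t => df (upd y k t))
    ((C + D) * expR (c * S)) c).
  - move=> t; have := der (upd y k t); rewrite updE.
    by under eq_fun do rewrite upd_upd.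
  - exact: cg.
  - move=> t; apply: le_trans (hf _) _; rewrite SE -mulrA -expRD.
    apply: ler_pM; rewrite ?expR_ge0 ?lerDl// ler_expR addrC -mulrDr.
    by rewrite ler_wpM2r ?addr_ge0// lerDl.
  - move=> t; apply: le_trans (hg _) _; rewrite SE -mulrA -expRD.
    apply: ler_pM; rewrite ?expR_ge0 ?lerDr// ler_expR addrC -mulrDr.
    by rewrite ler_wpM2r ?addr_ge0// lerDr.
rewrite -[LHS]/(\int[P]_w (EFin \o u \o joint) w)%E integralE.
have -> : (\int[P]_w ((EFin \o u) \o joint)^\+ w =
           \int[P]_w (EFin \o u)^\- (joint w))%E.
  by rewrite -e; apply: eq_integral => w _; rewrite !funeposE.
have -> : (\int[P]_w (EFin \o u)^\- (joint w) =
           \int[P]_w ((EFin \o u) \o joint)^\- w)%E.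
  by apply: eq_integral => w _; rewrite !funenegE.
rewrite subee//; apply: (integrable_fin_num measurableT).
exact: (integrable_funeneg measurableT iu).
Qed.

End Expectation.

Lemma measurable_funV d (T : measurableType d) (R : realType) (f : T -> R) :
  measurable_fun setT f -> measurable_fun setT (fun x => (f x)^-1).
Proof.
move=> mf; apply: (measurableT_comp _ mf) => {mf f}.
rewrite -(setUv [set (0 : R)]); apply/measurable_funU.
- exact: measurable_set1.
- by apply: measurableC; exact: measurable_set1.
- split; first exact: measurable_fun_set1.
  apply: open_continuous_measurable_fun; first exact/closed_openC/closed_eq.
  by move=> x; rewrite inE /= => /eqP x0; exact: inv_continuous.
Qed.

(** * Derivatives along coordinate lines *)

Section LineDerivative.
Variable R : realType.
Local Notation Q := (quat R).
Local Notation cts_at t0 := (fun f : R -> R => {for t0, continuous f}).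

Lemma is_derive_caratheodory (f D : R -> R) (t0 : R) :
  (forall t, f t = f t0 + (t - t0) * D t) -> {for t0, continuous D} ->
  is_derive t0 1 f (D t0).
Proof.
move=> fE cD.
have h : (fun h : R => h^-1 *: ((f \o shift t0) (h *: 1) - f t0)) @ 0^' --> D t0.
  have e : {near 0^', (fun h : R => D (h + t0)) =1
      (fun h : R => h^-1 *: ((f \o shift t0) (h *: 1) - f t0))}.
    near=> h.
    have h0 : h != 0 by near: h; exact: nbhs_dnbhs_neq.
    change (D (h + t0) = h^-1 * (f (h * 1 + t0) - f t0)).
    by rewrite mulr1 fE addrK addrAC subrr add0r mulKf.
  apply: cvg_trans (near_eq_cvg e) _.
  have c0 : D (h + t0) @[h --> 0] --> D (0 + t0).
    apply: (@cvg_comp _ _ _ (fun h => h + t0) D _ (nbhs (0 + t0))).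
      by apply: cvgD; [exact: cvg_id|exact: cvg_cst].
    by rewrite add0r; exact: cD.
  rewrite add0r in c0; apply: cvg_trans c0.
  by apply: cvg_app; exact: cvg_within.
by apply: DeriveDef; [apply/cvg_ex; exists (D t0)|exact/cvg_lim].
Unshelve. all: by end_near. Qed.

Section Rules.
Variable t0 : R.
Let CC := subalgebra_cvg_at t0.

(** Caratheodory's form of the derivative, by a slope function continuous at [t0]: the product and
    inverse rules become algebraic identities between slopes, without quotients. *)
Definition mx_derive m n (F : R -> 'M[Q]_(m, n)) (F' : 'M[Q]_(m, n)) :=
  exists2 D : R -> 'M[Q]_(m, n),
    (forall t, F t = F t0 + qreal (t - t0) *: D t) & D t0 = F' /\ mx_in (cts_at t0) D.

Let cvg_lin : quat_in (cts_at t0) (fun t => qreal (t - t0)).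
Proof.
apply: (quat_in_real CC).
by apply: cvgB; [exact: cvg_id|exact: cvg_cst].
Qed.

Lemma mx_derive_continuous m n (F : R -> 'M[Q]_(m, n)) F' :
  mx_derive F F' -> mx_in (cts_at t0) F.
Proof.
move=> [D FE [_ cD]].
have -> : F = (fun t => F t0 + qreal (t - t0) *: D t) by apply/funext.
by apply: (mx_in_add CC); [exact: mx_in_cst|exact: mx_in_scale].
Qed.

Lemma mx_derive_cst m n (A : 'M[Q]_(m, n)) : mx_derive (fun=> A) 0.
Proof.
exists (fun=> 0); first by move=> t; rewrite scaler0 addr0.
by split=> //; exact: mx_in_cst.
Qed.

Lemma mx_derive_add m n (F G : R -> 'M[Q]_(m, n)) F' G' :
  mx_derive F F' -> mx_derive G G' -> mx_derive (fun t => F t + G t) (F' + G').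
Proof.
move=> [D FE [<- cD]] [E GE [<- cE]]; exists (fun t => D t + E t).
  by move=> t; rewrite FE GE scalerDr addrACA.
by split=> //; exact: mx_in_add.
Qed.

Lemma mx_derive_adj m n (F : R -> 'M[Q]_(m, n)) F' :
  mx_derive F F' -> mx_derive (fun t => adjmx (F t)) (adjmx F').
Proof.
move=> [D FE [<- cD]]; exists (fun t => adjmx (D t)).
  by move=> t; rewrite FE raddfD /= adjmx_scale.
by split=> //; exact: mx_in_adj.
Qed.

Lemma mx_derive_mul m n p (F : R -> 'M[Q]_(m, n)) (G : R -> 'M[Q]_(n, p)) F' G' :
  mx_derive F F' -> mx_derive G G' ->
  mx_derive (fun t => F t *m G t) (F' *m G t0 + F t0 *m G').
Proof.
move=> hF hG; have cG := mx_derive_continuous hG.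
move: hF hG => [D FE [<- cD]] [E GE [<- cE]].
exists (fun t => D t *m G t + F t0 *m E t).
  move=> t; rewrite {1}FE mulmxDl {1}GE mulmxDr mulmx_scaler -scalemxAl scalerDr.
  by rewrite -addrA; apply: (f_equal (fun X => _ + X)); exact: addrC.
split=> //; apply: (mx_in_add CC); first exact: mx_in_mul.
by apply: (mx_in_mul CC) => //; exact: mx_in_cst.
Qed.

Lemma mx_derive_mulr m n p (F : R -> 'M[Q]_(m, n)) (A : 'M[Q]_(n, p)) F' :
  mx_derive F F' -> mx_derive (fun t => F t *m A) (F' *m A).
Proof.
by move=> /mx_derive_mul/(_ (mx_derive_cst A)); rewrite mulmx0 addr0.
Qed.

(** Everything follows from T t - T t0 = T t (S t0 - S t) T t0: together with the bound [B] it makes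
    [T] continuous at [t0], and it then displays the slope of [T]. *)
Lemma mx_derive_inv q (S T : R -> 'M[Q]_q) S' (B : R) :
  (forall t, S t *m T t = 1%:M) -> (forall t, T t *m S t = 1%:M) ->
  (forall t, norm2 (T t) <= B) -> mx_derive S S' ->
  mx_derive T (- (T t0 *m S' *m T t0)).
Proof.
move=> ST TS bT hS; have cS := mx_derive_continuous hS.
have Tdiff t : T t - T t0 = T t *m (S t0 - S t) *m T t0.
  by rewrite mulmxBr mulmxBl TS mul1mx -mulmxA ST mulmx1.
have cT : mx_in (cts_at t0) T.
  pose u t := B * norm2 (S t0 - S t) * norm2 (T t0).
  have cu : u @ t0 --> u t0.
    have h1 : mx_in (cts_at t0) (fun t => S t0 - S t).
      by apply: (mx_in_sub CC) => //; exact: mx_in_cst.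
    have h2 := in_norm2 CC h1.
    apply: cvgM; last exact: cvg_cst.
    by apply: cvgM; [exact: cvg_cst|exact: h2].
  have u0 : u t0 = 0 by rewrite /u subrr norm2_0 mulr0 mul0r.
  move=> i j c; apply/subr_cvg0.
  (* [norm2] is a squared norm, so it is the square of the coordinate difference that gets
     squeezed. *)
  have sq : (fun t => (qcoord c (T t i j) - qcoord c (T t0 i j)) ^+ 2) @ t0 --> 0.
    apply: (@squeeze_cvgr _ _ _ _ (cst 0) u).
    - near=> t; rewrite sqr_ge0 /= -raddfB.
      have -> : T t i j - T t0 i j = (T t - T t0) i j by rewrite !mxE.
      apply: le_trans (sqr_qcoord_le _ _) _; apply: le_trans (qnorm2_le_norm2 _ _ _) _.
      rewrite Tdiff; apply: le_trans (norm2M _ _) _.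
      apply: ler_wpM2r; first exact: norm2_ge0.
      apply: le_trans (norm2M _ _) _; apply: ler_wpM2r; first exact: norm2_ge0.
      exact: bT.
    - exact: cvg_cst.
    - exact: (eq_ind (u t0) (fun z => u @ t0 --> z) cu 0 u0).
  apply/cvgr0Pnorm_le => e e0.
  have e2 : 0 < e ^+ 2 by rewrite exprn_gt0.
  move/cvgr0Pnorm_le : sq => /(_ _ e2); apply: filterS => t.
  rewrite ger0_norm ?sqr_ge0// => h.
  by rewrite -(@ler_pXn2r _ 2) ?nnegrE ?(ltW e0)// real_normK ?num_real.
case: hS => E SE [<- cE]; exists (fun t => - (T t *m E t *m T t0)).
  move=> t; rewrite scalerN scalemxAl -mulmx_scaler.
  have -> : qreal (t - t0) *: E t = S t - S t0 by rewrite (SE t) [RHS]addrC addKr.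
  by rewrite -[S t - S t0]opprB mulmxN mulNmx -Tdiff opprK addrC subrK.
split=> //; apply: (mx_in_opp CC); apply: (mx_in_mul CC); last exact: mx_in_cst.
exact: mx_in_mul.
Unshelve. all: by end_near. Qed.

Lemma mx_derive_qdot m n (A : 'M[Q]_(m, n)) (F : R -> 'M[Q]_(m, n)) F' :
  mx_derive F F' -> is_derive t0 1 (fun t => qdot A (F t)) (qdot A F').
Proof.
move=> [D FE [<- cD]].
apply: (@is_derive_caratheodory _ (fun t => qdot A (D t))).
  by move=> t; rewrite {1}FE qdotDr qdotZr.
apply: (in_qdot CC) cD; exact: mx_in_cst.
Qed.

End Rules.

End LineDerivative.

(* Both the entrywise real basis and its adjoint are frames, so that Psi and Omega^H
   are treated at once. *)
Record frame (R : realType) (K : finType) p N (D : K -> 'M[quat R]_(p, N)) : Prop :=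
  Frame {
  frame_hermitian : forall a b, \sum_k rtr (adjmx (D k) *m a *m D k *m b) =
    4 * rtr a * rtr b;
  frame_bilinear : forall a b : 'M[quat R]_(p, N),
    \sum_k rtr (adjmx (D k) *m a *m adjmx (D k) *m b) = - (2 * rtr (adjmx a *m b)) }.

Definition gmx (R : realType) (K : finType) p N (D : K -> 'M[quat R]_(p, N))
  (x : fspace K R) : 'M[quat R]_(p, N) := \sum_k qreal (x k) *: D k.

Section GaussianField.
Context d (T : measurableType d) (R : realType) (P : probability T R).
Variables (K : finType) (X : K -> T -> R).
Hypotheses (nX : forall k, standard_normal P (X k))
           (indX : mutually_independent P X).
Variables (p N : nat) (D : K -> 'M[quat R]_(p, N)).
Local Notation Q := (quat R).
Local Notation G := (gmx D).
Local Notation mx_tame := (mx_in (@tame K R)).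
Let TS := @tame_subalgebra K R.

Definition mx_gradient m n (F : fspace K R -> 'M[Q]_(m, n))
    (dF : K -> fspace K R -> 'M[Q]_(m, n)) :=
  forall x k, mx_derive (x k) (fun t => F (upd x k t)) (dF k x).

Lemma gmx_upd x k t : G (upd x k t) = G x + qreal (t - x k) *: D k.
Proof.
rewrite /gmx (bigD1 k)//= updE [X in _ = X + _](bigD1 k)//= addrAC.
rewrite -scalerDl -raddfD /= (addrC (x k)) subrK; congr (_ + _).
by apply: eq_bigr => i /negPf ik; rewrite /upd ik.
Qed.

Lemma gmx_tame : mx_tame G.
Proof.
apply: (mx_in_sum TS) => k; apply: (mx_in_scale TS); last exact: mx_in_cst.
by apply: (quat_in_real TS); exact: tame_coord.
Qed.

Lemma gmx_gradient : mx_gradient G (fun k _ => D k).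
Proof.
move=> x k; exists (fun=> D k); last first.
  by split=> //; apply: mx_in_cst; exact: subalgebra_cvg_at.
by move=> t; rewrite !gmx_upd subrr raddf0 scale0r addr0.
Qed.

Lemma mx_gradient_adj m n F (dF : K -> fspace K R -> 'M[Q]_(m, n)) :
  mx_gradient F dF -> mx_gradient (fun x => adjmx (F x)) (fun k x => adjmx (dF k x)).
Proof. by move=> h x k; apply: mx_derive_adj. Qed.

Lemma mx_gradient_mul m n r F (dF : K -> fspace K R -> 'M[Q]_(m, n))
    F2 (dF2 : K -> fspace K R -> 'M[Q]_(n, r)) :
  mx_gradient F dF -> mx_gradient F2 dF2 ->
  mx_gradient (fun x => F x *m F2 x) (fun k x => dF k x *m F2 x + F x *m dF2 k x).
Proof.
by move=> h h2 x k; have := mx_derive_mul (h x k) (h2 x k); rewrite !upd_same.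
Qed.

Lemma mx_gradient_mulr m n r F (dF : K -> fspace K R -> 'M[Q]_(m, n)) (A : 'M[Q]_(n, r)) :
  mx_gradient F dF ->
  mx_gradient (fun x => F x *m A) (fun k x => dF k x *m A).
Proof. by move=> h x k; exact: mx_derive_mulr. Qed.

Lemma mx_gradient_line m n F (dF : K -> fspace K R -> 'M[Q]_(m, n)) :
  mx_gradient F dF -> forall x k i j c,
  continuous (fun t => qcoord c (F (upd x k t) i j)).
Proof.
move=> h x k i j c t.
have h' : mx_in _ _ := mx_derive_continuous (h (upd x k t) k).
have e : (fun t' => qcoord c (F (upd (upd x k t) k t') i j)) =
         (fun t' => qcoord c (F (upd x k t') i j)).
  by apply/funext => t'; rewrite upd_upd.
by move: (h' i j c); rewrite updE e.
Qed.

(** Sums the coordinatewise identities; the sum of the [qdot (D k) (dF k x)] is the divergence of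
    [F]. *)
Lemma stein_mx F dF :
  mx_tame F -> (forall k, mx_tame (dF k)) -> mx_gradient F dF ->
  (\int[P]_w (qdot (G (joint X w)) (F (joint X w)) -
              \sum_k qdot (D k) (dF k (joint X w)))%:E = 0)%E.
Proof.
move=> tF tdF gF.
have t1 k : tame (fun x => qdot (D k) (F x)).
  by apply: (in_qdot TS) => //; exact: mx_in_cst.
have t2 k : tame (fun x => qdot (D k) (dF k x)).
  by apply: (in_qdot TS) => //; exact: mx_in_cst.
have t3 k : tame (fun x : fspace K R => x k * qdot (D k) (F x) - qdot (D k) (dF k x)).
  apply: (subalgebra_sub TS) => //.
  exact: (subalgebra_mul TS (@tame_coord K R k) (t1 k)).
transitivity (\int[P]_w (\sum_k (joint X w k * qdot (D k) (F (joint X w)) -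
    qdot (D k) (dF k (joint X w)))%:E))%E.
  apply: eq_integral => w _; rewrite sumEFin sumrB; congr ((_ - _)%:E).
  rewrite {1}/gmx /qdot raddf_sum mulmx_suml raddf_sum; apply: eq_bigr => k _.
  by rewrite -[LHS]/(qdot _ _) qdotZl.
rewrite integral_sum//; last by move=> k; exact: (tame_integrable nX (t3 k)).
rewrite big1// => k _; apply: (stein nX indX (t1 k) (t2 k)) => x.
exact: (mx_derive_qdot (D k) (gF x k)).
Qed.

End GaussianField.

(** * Moments of the regularised inverse *)

(** The product rule for N = M V Y^H in direction [D], regrouped as W D Z - N D^H N with W = 1 - M V
    M^H. Paired with [D], these are one term of each of the two shapes that a frame can sum. *)
Lemma ridgeN_gradient_eq (R : realType) p N q (D : 'M[quat R]_(p, N))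
  (Y : 'M[quat R]_(N, q)) (V : 'M[quat R]_q) (M : 'M[quat R]_(p, q)) :
  (D *m Y *m V + M *m - (V *m (adjmx (D *m Y) *m M + adjmx M *m (D *m Y)) *m V)) *m adjmx Y
  = (1%:M - M *m V *m adjmx M) *m D *m (Y *m V *m adjmx Y) -
    M *m V *m adjmx Y *m adjmx D *m (M *m V *m adjmx Y).
Proof.
have e1 : M *m (V *m (adjmx (D *m Y) *m M + adjmx M *m (D *m Y)) *m V) *m adjmx Y =
    M *m V *m adjmx Y *m adjmx D *m (M *m V *m adjmx Y) +
    M *m V *m adjmx M *m D *m (Y *m V *m adjmx Y).
  rewrite adjmxM; move: (adjmx Y) (adjmx D) (adjmx M) => Y' D' M'.
  rewrite (mulmxDr V) (mulmxDl (V *m _)) (mulmxDr M) mulmxDl.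
  by apply: (f_equal2 (fun X Z => X + Z)); rewrite !mulmxA.
have e2 : (1%:M - M *m V *m adjmx M) *m D *m (Y *m V *m adjmx Y) =
    D *m Y *m V *m adjmx Y - M *m V *m adjmx M *m D *m (Y *m V *m adjmx Y).
  rewrite mulmxBl mul1mx mulmxBl; congr (_ - _); rewrite !mulmxA; reflexivity.
rewrite mulmxN mulmxBl e1 e2 opprD addrA addrAC; reflexivity.
Qed.

Lemma rtrD (R : realType) n (A B : 'M[quat R]_n) : rtr (A + B) = rtr A + rtr B.
Proof. exact: raddfD. Qed.

Lemma rtrB (R : realType) n (A B : 'M[quat R]_n) : rtr (A - B) = rtr A - rtr B.
Proof. exact: raddfB. Qed.

Lemma adjmx_sandwich (R : realType) m n r (A : 'M[quat R]_(m, n)) (V : 'M[quat R]_n)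
  (B : 'M[quat R]_(r, n)) : adjmx V = V ->
  adjmx (A *m V *m adjmx B) = B *m V *m adjmx A.
Proof. by move=> hV; rewrite !adjmxM adjmxK hV mulmxA. Qed.

Lemma qdot_cubic (R : realType) p N t (G A : 'M[quat R]_(p, N)) (B : 'M[quat R]_(N, t)) :
  qdot G (A *m adjmx A *m G *m (B *m adjmx B)) = norm2 (adjmx A *m G *m B).
Proof.
rewrite /norm2 /qdot !adjmxM adjmxK.
move: (adjmx A) (adjmx G) (adjmx B) => a g b.
have -> : g *m (A *m a *m G *m (B *m b)) = g *m A *m (a *m G *m B) *m b.
  by rewrite !mulmxA.
by rewrite rtrC !mulmxA.
Qed.

Section Divergence.
Variables (R : realType) (K : finType) (p N t : nat).
Variables (D : K -> 'M[quat R]_(p, N)) (hD : frame D).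
Variables (W : 'M[quat R]_p) (Z : 'M[quat R]_N) (A : 'M[quat R]_(p, N)).
Local Notation dA k := (W *m D k *m Z - A *m adjmx (D k) *m A).

Lemma rtr_orth (C : 'M[quat R]_N) (B : 'M[quat R]_(N, t)) :
  adjmx B *m C = 0 -> rtr (C *m B *m adjmx B) = 0.
Proof. by move=> h; rewrite rtrC mulmxA h mul0mx raddf0. Qed.

(** Origin of the constant 4 (p - q) + 2: with [A] equal to N, the trace of [W] is p - q and
    [norm2 A] is tau, both up to terms in e, and the trace of [Z] is tau. *)
Lemma divergence_linear :
  \sum_k qdot (D k) (dA k) = 4 * rtr W * rtr Z + 2 * norm2 A.
Proof.
transitivity (\sum_k rtr (adjmx (D k) *m W *m D k *m Z) -
              \sum_k rtr (adjmx (D k) *m A *m adjmx (D k) *m A)).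
  rewrite -sumrB; apply: eq_bigr => k _.
  rewrite /qdot mulmxBr rtrB !mulmxA; reflexivity.
by rewrite (frame_hermitian hD) (frame_bilinear hD) opprK.
Qed.

Variables (G : 'M[quat R]_(p, N)) (B : 'M[quat R]_(N, t)).
Hypotheses (hW : adjmx W = W) (hZ : adjmx Z = Z)
  (BZ : adjmx B *m Z = 0) (BA : adjmx B *m adjmx A = 0).

(** [A] stands for N. After cyclic permutation four of the five terms contain [adjmx B *m Z] or
    [adjmx B *m adjmx A] and vanish; the survivor is the derivative of the factor [G] itself. *)
Lemma divergence_cubic :
  \sum_k qdot (D k) (((dA k *m adjmx A + A *m adjmx (dA k)) *m G +
    A *m adjmx A *m D k) *m (B *m adjmx B)) = 4 * norm2 A * norm2 B.
Proof.
pose BB := B *m adjmx B.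
pose s1 := \sum_k rtr (adjmx (D k) *m W *m D k *m (Z *m adjmx A *m G *m BB)).
pose s2 := \sum_k rtr (adjmx (D k) *m A *m adjmx (D k) *m (A *m adjmx A *m G *m BB)).
pose s3 := \sum_k rtr (adjmx (D k) *m (A *m Z) *m adjmx (D k) *m (W *m G *m BB)).
pose s4 := \sum_k rtr (adjmx (D k) *m (A *m adjmx A) *m D k *m (adjmx A *m G *m BB)).
pose s5 := \sum_k rtr (adjmx (D k) *m (A *m adjmx A) *m D k *m BB).
transitivity (s1 - s2 + (s3 - s4) + s5).
  rewrite /s1 /s2 /s3 /s4 /s5 -!sumrB -!big_split /=; apply: eq_bigr => k _.
  rewrite /qdot -/BB [adjmx (_ - _)]raddfB /= !adjmxM !adjmxK hW hZ.
  clearbody BB; move: (D k) (adjmx A) (adjmx (D k)) => d a d'.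
  rewrite mulmxDl mulmxDr rtrD; congr (_ + _); last first.
    rewrite !mulmxA; reflexivity.
  rewrite 2!mulmxDl mulmxDr rtrD; congr (_ + _).
    rewrite 3!mulmxBl mulmxBr rtrB; apply: (f_equal2 (fun x y => x - y));
      rewrite !mulmxA; reflexivity.
  rewrite mulmxBr 2!mulmxBl mulmxBr rtrB; apply: (f_equal2 (fun x y => x - y));
    rewrite !mulmxA; reflexivity.
have z0 (C : 'M[quat R]_N) : adjmx B *m C = 0 -> rtr (C *m BB) = 0.
  by move=> h; rewrite /BB mulmxA rtr_orth.
have -> : s1 = 0.
  rewrite /s1 (frame_hermitian hD) z0 ?mulr0//.
  by rewrite !mulmxA BZ !mul0mx.
have -> : s2 = 0.
  rewrite /s2 (frame_bilinear hD) !mulmxA -(mulmxA _ B) z0 ?mulr0 ?oppr0//.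
  by rewrite !mulmxA BA !mul0mx.
have -> : s3 = 0.
  rewrite /s3 (frame_bilinear hD) adjmxM hZ !mulmxA -(mulmxA _ B) z0 ?mulr0 ?oppr0//.
  by rewrite !mulmxA BZ !mul0mx.
have -> : s4 = 0.
  rewrite /s4 (frame_hermitian hD) z0 ?mulr0//.
  by rewrite !mulmxA BA !mul0mx.
rewrite /s5 (frame_hermitian hD) !subr0 !add0r; congr (4 * _ * _); exact: rtrC.
Qed.

End Divergence.

Section RidgeMoments.
Context d (T : measurableType d) (R : realType) (P : probability T R).
Variables (K : finType) (X : K -> T -> R).
Hypotheses (nX : forall k, standard_normal P (X k))
           (indX : mutually_independent P X).
Variables (p N q : nat) (D : K -> 'M[quat R]_(p, N)).
Hypotheses (hD : frame D) (qp : (q <= p)%N).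
Variables (Y : 'M[quat R]_(N, q)) (e : R).
Hypotheses (Yfull : full_column_rank Y) (e0 : 0 < e).
Local Notation Q := (quat R).
Local Notation G := (gmx D).
Local Notation mx_tame := (mx_in (@tame K R)).
Let TS := @tame_subalgebra K R.
Let S (x : fspace K R) := ridge (G x) Y e.
Let V (x : fspace K R) := qinv (S x).
Let M (x : fspace K R) := G x *m Y.
Let Z (x : fspace K R) := ridgeZ (G x) Y e.
Let NN (x : fspace K R) := ridgeN (G x) Y e.

Let tG : mx_tame G. Proof. exact: gmx_tame. Qed.
Let tM : mx_tame M.
Proof. by apply: (mx_in_mul TS) => //; exact: mx_in_cst. Qed.
Let tMa : mx_tame (fun x => adjmx (M x)).
Proof. exact: (mx_in_adj TS). Qed.
Let tS : mx_tame S.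
Proof.
by apply: (mx_in_add TS); [exact: (mx_in_mul TS)|exact: mx_in_cst].
Qed.

Let gM : mx_gradient M (fun k _ => D k *m Y).
Proof. exact: (mx_gradient_mulr Y (gmx_gradient D)). Qed.

Let dS k x := adjmx (D k *m Y) *m M x + adjmx (M x) *m (D k *m Y).

Let gS : mx_gradient S dS.
Proof.
have h := mx_gradient_mul (mx_gradient_adj gM) gM.
move=> x k; have := mx_derive_add (h x k) (mx_derive_cst (x k) (qreal e *: (adjmx Y *m Y))).
by rewrite addr0.
Qed.

Let gV : mx_gradient V (fun k x => - (V x *m dS k x *m V x)).
Proof.
move=> x k.
have := @mx_derive_inv R (x k) q (fun t => S (upd x k t)) (fun t => V (upd x k t)) (dS k x) _
  (fun t => ridgeMV _ Yfull e0) (fun t => ridgeVM _ Yfull e0)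
  (fun t => norm2_ridgeV_ub _ Yfull e0) (gS x k).
by rewrite upd_same.
Qed.

Let tV : mx_tame V.
Proof.
(* V is rational in the entries, hence measurable; the uniform bound gives growth at rate 0;
   differentiability gives continuity along coordinate lines. *)
move=> i j c; split.
- have mS : mx_in (fun f : fspace K R -> R => measurable_fun setT f) S.
    by move=> i' j' c'; have [] := tS i' j' c'.
  exact: (mx_in_qinv (subalgebra_measurable R (fspace K R)) (@measurable_funV _ _ R) mS).
- set B := (norm2 (qinv (adjmx Y *m Y) *m adjmx Y) * (q%:R / e)) ^+ 2.
  exists (Num.sqrt B), 0; split=> // x; rewrite mul0r expR0 mulr1.
  rewrite -sqrtr_sqr; apply: ler_wsqrtr.
  apply: le_trans (sqr_qcoord_le _ _) _; apply: le_trans (qnorm2_le_norm2 _ _ _) _.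
  exact: norm2_ridgeV_ub.
- by move=> x k; exact: (mx_gradient_line gV).
Qed.

Let tZ : mx_tame Z.
Proof.
apply: (mx_in_mul TS); last exact: mx_in_cst.
by apply: (mx_in_mul TS) => //; exact: mx_in_cst.
Qed.

Let tN : mx_tame NN.
Proof.
by apply: (mx_in_mul TS); [exact: (mx_in_mul TS)|exact: mx_in_cst].
Qed.

Let W (x : fspace K R) : 'M[Q]_p := 1%:M - M x *m V x *m adjmx (M x).

Let tW : mx_tame W.
Proof.
apply: (mx_in_sub TS); first exact: mx_in_cst.
by apply: (mx_in_mul TS) => //; exact: (mx_in_mul TS).
Qed.

Let dN k x := W x *m D k *m Z x - NN x *m adjmx (D k) *m NN x.

Let tdN k : mx_tame (dN k).
Proof.
apply: (mx_in_sub TS); apply: (mx_in_mul TS) => //; apply: (mx_in_mul TS) => //; exact: mx_in_cst.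
Qed.

Let gN : mx_gradient NN dN.
Proof.
have h := mx_gradient_mulr (adjmx Y) (mx_gradient_mul gM gV).
by move=> x k; have := h x k; rewrite (ridgeN_gradient_eq (D k) Y (V x) (M x)).
Qed.

Let tau x := rtr (Z x).
Let c : R := 4 * (p%:R - q%:R) + 2.

Let c_gt0 : 0 < c.
Proof. by rewrite /c ltr_wpDl// mulr_ge0// subr_ge0 ler_nat. Qed.

Let ttau : tame tau. Proof. exact: (in_rtr TS). Qed.
Let itau : P.-integrable setT (fun w => (tau (joint X w))%:E).
Proof. exact: (tame_integrable nX ttau). Qed.

Let qdotN x : qdot (G x) (NN x) = q%:R - e * tau x.
Proof.
rewrite /qdot /NN /ridgeN mulmxA rtrC !mulmxA.
rewrite -(@rtr_ridge_gram _ _ _ _ (G x) Y e Yfull e0); congr rtr.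
by rewrite adjmxM !mulmxA.
Qed.

Let qdotN_le x :
  qdot (G x) (NN x) - \sum_k qdot (D k) (dN k x) <= q%:R - c * tau x.
Proof.
rewrite qdotN /dN (divergence_linear hD).
have -> : rtr (W x) = p%:R - (q%:R - e * tau x).
  rewrite /W raddfB /= rtr1; congr (_ - _).
  exact: rtr_ridge_hat.
rewrite -/(tau x).
have h1 : tau x = norm2 (NN x) + e * norm2 (Z x) by exact: rtr_ridgeZ.
have h2 : norm2 (Z x) <= tau x ^+ 2 by exact: norm2_ridgeZ_le.
have h3 : 0 <= tau x by exact: ridgeZ_ge0.
have h4 := ler_wpM2l (ltW e0) h2.
have h5 : 0 <= e * tau x ^+ 2 by rewrite mulr_ge0 ?sqr_ge0// ltW.
have h6 : 0 <= e * tau x by rewrite mulr_ge0// ltW.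
have h7 : q%:R - e * tau x - (4 * (p%:R - (q%:R - e * tau x)) * tau x + 2 * norm2 (NN x)) =
    q%:R - c * tau x - e * tau x - 4 * (e * tau x ^+ 2) + 2 * (e * norm2 (Z x)).
  rewrite (_ : norm2 (NN x) = tau x - e * norm2 (Z x)); last by rewrite h1 addrK.
  by rewrite /c; ring.
rewrite h7; move: h4 h5 h6; lra.
Qed.

Let c_itau : P.-integrable setT (fun w => (c%:E * (tau (joint X w))%:E)%E).
Proof. exact: integrableZl. Qed.

Lemma expectation_ridgeZ :
  (\int[P]_w (tau (joint X w))%:E <= (q%:R / c)%:E)%E.
Proof.
have h : (0 <= \int[P]_w (q%:R - c * tau (joint X w))%:E)%E.
  rewrite -[leLHS](stein_mx nX indX D tN tdN gN); apply: le_integral => //.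
  - have t1 : tame (fun x => qdot (G x) (NN x) - \sum_k qdot (D k) (dN k x)).
      apply: (subalgebra_sub TS); first exact: (in_qdot TS).
      apply: (subalgebra_sum TS) => k; exact: (in_qdot TS (mx_in_cst TS (D k)) (tdN k)).
    exact: (tame_integrable nX t1).
  - have t1 : tame (fun x => q%:R - c * tau x).
      apply: (subalgebra_sub TS); first exact: subalgebra_cst.
      by apply: (subalgebra_mul TS) => //; exact: subalgebra_cst.
    exact: (tame_integrable nX t1).
  - by move=> w _; rewrite lee_fin; exact: qdotN_le.
have fin : (\int[P]_w (tau (joint X w))%:E)%E \is a fin_num by exact: integrable_fin_num.
move: h; under eq_integral do rewrite EFinB EFinM.
rewrite integralB//; last exact: finite_measure_integrable_cst.
rewrite integral_cst//= probability_setT mule1 integralZl//.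
rewrite -(fineK fin) -EFinM -EFinB !lee_fin subr_ge0 => h.
by rewrite ler_pdivlMr// mulrC.
Qed.

Section Orthogonal.
Variables (t : nat) (B : 'M[Q]_(N, t)).
Hypothesis YB : adjmx Y *m B = 0.

Let BY : adjmx B *m Y = 0.
Proof. by rewrite -[LHS]adjmxK adjmxM adjmxK YB raddf0. Qed.

(** Chosen so that its pairing with [G] is the squared norm to be estimated, see [qdotF]. *)
Let F x := NN x *m adjmx (NN x) *m G x *m (B *m adjmx B).
Let dF k x := ((dN k x *m adjmx (NN x) + NN x *m adjmx (dN k x)) *m G x +
  NN x *m adjmx (NN x) *m D k) *m (B *m adjmx B).

Let tNa : mx_tame (fun x => adjmx (NN x)). Proof. exact: (mx_in_adj TS). Qed.

Let tF : mx_tame F.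
Proof.
apply: (mx_in_mul TS); last exact: mx_in_cst.
by do 2![apply: (mx_in_mul TS) => //].
Qed.

Let tdF k : mx_tame (dF k).
Proof.
apply: (mx_in_mul TS); last exact: mx_in_cst.
apply: (mx_in_add TS); last first.
  by apply: (mx_in_mul TS); [exact: (mx_in_mul TS)|exact: mx_in_cst].
apply: (mx_in_mul TS) => //; apply: (mx_in_add TS); apply: (mx_in_mul TS) => //.
exact: (mx_in_adj TS).
Qed.

Let gF : mx_gradient F dF.
Proof.
exact: (mx_gradient_mulr (B *m adjmx B)
  (mx_gradient_mul (mx_gradient_mul gN (mx_gradient_adj gN)) (gmx_gradient D))).
Qed.

Let adjN x : adjmx (NN x) = Y *m V x *m adjmx (G x *m Y).
Proof.
exact: (adjmx_sandwich (M x) Y (adjmx_ridgeV (G x) Yfull e0)).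
Qed.

Let divF x : \sum_k qdot (D k) (dF k x) = 4 * norm2 (NN x) * norm2 B.
Proof.
apply: (divergence_cubic hD).
- rewrite /W raddfB /= adjmx1; apply: (f_equal2 (fun x y => x - y)) => //.
  exact: (adjmx_sandwich (M x) (M x) (adjmx_ridgeV (G x) Yfull e0)).
- exact: adjmx_ridgeZ.
- by rewrite /Z /ridgeZ 2!(mulmxA (adjmx B)) BY !mul0mx.
- by rewrite adjN 2!(mulmxA (adjmx B)) BY !mul0mx.
Qed.

Let qdotF x : qdot (G x) (F x) = norm2 (Y *m V x *m adjmx (G x *m Y) *m G x *m B).
Proof.
rewrite -adjN; exact: qdot_cubic.
Qed.

Lemma expectation_ridge_orth :
  (\int[P]_w (norm2 (Y *m V (joint X w) *m adjmx (G (joint X w) *m Y) *m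
     G (joint X w) *m B))%:E <= (4 * norm2 B * (q%:R / c))%:E)%E.
Proof.
pose u x := norm2 (Y *m V x *m adjmx (G x *m Y) *m G x *m B).
have tu : tame u.
  have -> : u = (fun x => qdot (G x) (F x)) by apply/funext => x; rewrite qdotF.
  exact: (in_qdot TS).
have iu := tame_integrable nX tu.
have b0 : 0 <= 4 * norm2 B by rewrite mulr_ge0// norm2_ge0.
have h : (\int[P]_w (u (joint X w) - 4 * norm2 B * tau (joint X w))%:E <= 0)%E.
  rewrite -[leRHS](stein_mx nX indX D tF tdF gF); apply: le_integral => //.
  - have t1 : tame (fun x => u x - 4 * norm2 B * tau x).
      apply: (subalgebra_sub TS) => //.
      by apply: (subalgebra_mul TS) => //; exact: subalgebra_cst.
    exact: (tame_integrable nX t1).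
  - have t1 : tame (fun x => qdot (G x) (F x) - \sum_k qdot (D k) (dF k x)).
      apply: (subalgebra_sub TS); first exact: (in_qdot TS).
      apply: (subalgebra_sum TS) => k; exact: (in_qdot TS (mx_in_cst TS (D k)) (tdF k)).
    exact: (tame_integrable nX t1).
  - move=> w _; rewrite lee_fin divF qdotF -/(u _) lerD2l lerN2 mulrAC.
    by apply: ler_wpM2l => //; exact: norm2_ridgeN_le.
have fin : (\int[P]_w (tau (joint X w))%:E)%E \is a fin_num by exact: integrable_fin_num.
have finu : (\int[P]_w (u (joint X w))%:E)%E \is a fin_num by exact: integrable_fin_num.
move: h; under eq_integral do rewrite EFinB EFinM.
rewrite integralB//; last exact: integrableZl.
rewrite integralZl//.
have := expectation_ridgeZ; rewrite -(fineK fin) -(fineK finu) -EFinM -EFinB !lee_fin => h1.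
rewrite subr_le0 => h2; apply: le_trans h2 _; exact: ler_wpM2l.
Qed.

End Orthogonal.

End RidgeMoments.

(** * Real coordinates of quaternion matrices *)

Section StandardFrame.
Variable R : realType.
Local Notation Q := (quat R).

Definition qunit (c : 'I_4) : Q :=
  Quat (c == 0)%:R (c == 1)%:R (c == 2%:R)%:R (c == 3%:R)%:R.

(** Summing conj(u) a u over the units cancels the imaginary part of [a] and multiplies its real
    part by 4. *)
Lemma sum_qunit_conj (a b : Q) :
  \sum_c qw (qconj (qunit c) * (a * qunit c * b)) = 4 * qw a * qw b.
Proof.
by rewrite !big_ord_recl big_ord0; case: a b => [????] [????] /=; ring.
Qed.

(** The sum of conj(u) a conj(u) over the units is - 2 conj(a); this is the origin of the summand 2
    in the denominator of [ferr]. *)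
Lemma sum_qunit_bilinear (a b : Q) :
  \sum_c qw (qconj (qunit c) * (a * qconj (qunit c) * b)) = - (2 * qw (qconj a * b)).
Proof.
by rewrite !big_ord_recl big_ord0; case: a b => [????] [????] /=; ring.
Qed.

Lemma quat_qunit (f : 'I_4 -> R) :
  \sum_c qreal (f c) * qunit c = Quat (f 0) (f 1) (f 2%:R) (f 3%:R).
Proof.
rewrite !big_ord_recl big_ord0.
have -> : lift 0 0 = 1 :> 'I_4 by exact/val_inj.
have -> : lift 0 (lift 0 0) = 2%:R :> 'I_4 by exact/val_inj.
have -> : lift 0 (lift 0 (lift 0 0)) = 3%:R :> 'I_4 by exact/val_inj.
by congr Quat => /=; ring.
Qed.

Lemma sum_triple (V : nmodType) m n (F : 'I_4 * 'I_m * 'I_n -> V) :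
  \sum_k F k = \sum_i \sum_j \sum_c F (c, i, j).
Proof.
transitivity (\sum_(p : 'I_4 * 'I_m) \sum_j F (p, j)).
  by rewrite [RHS]pair_big; apply: eq_bigr => -[].
transitivity (\sum_c \sum_i \sum_j F (c, i, j)).
  by rewrite [RHS]pair_big; apply: eq_bigr => -[].
by rewrite exchange_big; apply: eq_bigr => i _; rewrite exchange_big.
Qed.

Variables m n : nat.

Definition basis_mx (k : 'I_4 * 'I_m * 'I_n) : 'M[Q]_(m, n) :=
  qunit k.1.1 *: delta_mx k.1.2 k.2.

Lemma mulmx_delta p r (A : 'M[Q]_(p, m)) (q : Q) i j (B : 'M[Q]_(n, r)) s t :
  (A *m (q *: delta_mx i j) *m B) s t = A s i * q * B j t.
Proof.
rewrite mxE (bigD1 j)//= [X in _ + X]big1 ?addr0 => [|j' j'j].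
  congr (_ * _); rewrite mxE (bigD1 i)//= [X in _ + X]big1 ?addr0 => [|i' i'i].
    by rewrite !mxE !eqxx mulr1.
  by rewrite !mxE (negPf i'i) !mulr0.
rewrite mxE big1 ?mul0r// => i' _.
by rewrite !mxE (negPf j'j) andbF !mulr0.
Qed.

Lemma adjmx_delta (q : Q) (i : 'I_m) (j : 'I_n) :
  adjmx (q *: delta_mx i j : 'M[Q]_(m, n)) = qconj q *: delta_mx j i.
Proof.
apply/matrixP => s t; rewrite adjmxE !mxE andbC.
by case: (_ && _); rewrite ?mulr1 ?mulr0 ?raddf0.
Qed.

Lemma rtr_delta (q : Q) (i : 'I_m) (j : 'I_n) (X : 'M[Q]_(m, n)) :
  rtr (adjmx (q *: delta_mx i j : 'M[Q]_(m, n)) *m X) = qw (qconj q * X i j).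
Proof.
rewrite -[LHS]/(qdot _ _) qdotE (bigD1 i)//= (bigD1 j)//= big1 => [|j' j'j].
  rewrite big1 => [|i' i'i]; first by rewrite !mxE !eqxx mulr1 !addr0.
  apply: big1 => j' _; rewrite !mxE (negPf i'i) mulr0.
  by case: (X i' j') => ? ? ? ? /=; ring.
rewrite !mxE (negPf j'j) andbF mulr0.
by case: (X i j') => ? ? ? ? /=; ring.
Qed.

End StandardFrame.

Section Frames.
Variables (R : realType) (m n : nat).
Local Notation Q := (quat R).
Local Notation D := (@basis_mx R m n).

Lemma basis_frame : frame D.
Proof.
split=> a b.
- transitivity (\sum_i \sum_j \sum_c qw (qconj (qunit R c) * (a i i * qunit R c * b j j))).
    rewrite sum_triple; do 3![apply: eq_bigr => ? _].
    by rewrite -2!mulmxA rtr_delta mulmxA mulmx_delta.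
  under eq_bigr => i _ do (under eq_bigr => j _ do rewrite sum_qunit_conj).
  by rewrite /rtr [4 * _]mulr_sumr mulr_suml; apply: eq_bigr => i _; rewrite mulr_sumr.
- transitivity (\sum_i \sum_j \sum_c
    qw (qconj (qunit R c) * (a i j * qconj (qunit R c) * b i j))).
    rewrite sum_triple; do 3![apply: eq_bigr => ? _].
    by rewrite -2!mulmxA rtr_delta mulmxA adjmx_delta mulmx_delta.
  under eq_bigr => i _ do (under eq_bigr => j _ do rewrite sum_qunit_bilinear).
  rewrite -[rtr _]/(qdot _ _) qdotE mulr_sumr -sumrN; apply: eq_bigr => i _.
  by rewrite mulr_sumr -sumrN.
Qed.

Lemma adjmx_frame p N (K : finType) (E : K -> 'M[Q]_(p, N)) :
  frame E -> frame (fun k => adjmx (E k)).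
Proof.
move=> [h1 h2]; split=> a b.
- rewrite mulrAC -h1; apply: eq_bigr => k _; rewrite adjmxK.
  by rewrite -!mulmxA rtrC -!mulmxA rtrC -!mulmxA.
- have -> : rtr (adjmx a *m b) = rtr (adjmx (adjmx b) *m adjmx a).
    by rewrite adjmxK rtrC.
  rewrite -h2; apply: eq_bigr => k _; rewrite adjmxK -rtr_adj !adjmxM.
  by rewrite !mulmxA rtrC !mulmxA.
Qed.

Lemma gmx_basisE (x : fspace ('I_4 * 'I_m * 'I_n)%type R) i j :
  gmx D x i j =
  Quat (x (0, i, j)) (x (1, i, j)) (x (2%:R, i, j)) (x (3%:R, i, j)).
Proof.
rewrite /gmx summxE sum_triple (bigD1 i)//= (bigD1 j)//=.
rewrite [X in _ + X + _]big1 => [|j' j'j]; last first.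
  by apply: big1 => c _; rewrite !mxE [j == j']eq_sym (negPf j'j) andbF !mulr0.
rewrite [X in _ + X]big1 => [|i' i'i]; last first.
  apply: big1 => j' _; apply: big1 => c _.
  by rewrite !mxE [i == i']eq_sym (negPf i'i) !mulr0.
rewrite !addr0 -(quat_qunit (fun c => x (c, i, j))).
by apply: eq_bigr => c _; rewrite !mxE !eqxx mulr1.
Qed.

Lemma gmx_entries d (T : measurableType d) (Om : T -> 'M[Q]_(m, n)) w :
  gmx D (joint (real_entries Om) w) = Om w.
Proof.
apply/matrixP => i j; rewrite gmx_basisE /joint /real_entries /=.
by case: (Om w i j).
Qed.

Lemma gmx_adj p N (K : finType) (E : K -> 'M[Q]_(p, N)) (x : fspace K R) :
  gmx (fun k => adjmx (E k)) x = adjmx (gmx E x).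
Proof.
by rewrite /gmx raddf_sum; apply: eq_bigr => k _; rewrite /= adjmx_scale.
Qed.

End Frames.

(** * Approximation error of the range of Y *)

Lemma norm2D_young (R : realType) m n (A B : 'M[quat R]_(m, n)) (eta : R) : 0 < eta ->
  norm2 (A + B) <= (1 + eta) * norm2 B + (1 + eta^-1) * norm2 A.
Proof.
move=> h0; have e1 : eta * eta^-1 = 1 by rewrite divff ?gt_eqF.
have := norm2_ge0 (A - qreal eta *: B).
rewrite !norm2D norm2N norm2Z qdotNr qdotZr => h.
move: (norm2 A) (norm2 B) (qdot A B) h => a b c h.
have : 0 <= eta^-1 * (a + 2 * - (eta * c) + eta ^+ 2 * b).
  by rewrite mulr_ge0// invr_ge0 ltW.
have -> : eta^-1 * (a + 2 * - (eta * c) + eta ^+ 2 * b) =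
  eta^-1 * a - 2 * c * (eta * eta^-1) + eta * (eta * eta^-1) * b by ring.
by rewrite e1 !mulr1; lra.
Qed.

Lemma norm2_proj (R : realType) m n t (A : 'M[quat R]_(m, n)) (B : 'M[quat R]_(n, t)) :
  B *m adjmx B *m B = B -> norm2 (B *m adjmx B *m adjmx A) = norm2 (A *m B).
Proof.
move=> h.
have e : A *m B *m (adjmx B *m B) = A *m B by rewrite -mulmxA (mulmxA B) h.
have -> : B *m adjmx B *m adjmx A = B *m adjmx (A *m B) by rewrite adjmxM mulmxA.
move: (A *m B) e => C e.
by rewrite /norm2 /qdot adjmxM adjmxK mulmxA -(mulmxA C) e rtrC.
Qed.

Section SvdSplit.
Variables (R : realType) (n r : nat) (V : 'M[quat R]_n).
Hypotheses (rn : (r <= n)%N) (hV : unitary V).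
Local Notation Q := (quat R).

Definition head_sel : 'M[Q]_(n, r) := \matrix_(i, j) (i == j :> nat)%:R.
(** Kept square, with its first [r] columns zero, to avoid the dimension n - r. The resulting
    [svd_tail] is only a partial isometry, hence the relation B B^H B = B below in place of B^H B =
    1. *)
Definition tail_sel : 'M[Q]_n := \matrix_(i, j) ((i == j) && (r <= i)%N)%:R.
Definition svd_head := V *m head_sel.
Definition svd_tail := V *m tail_sel.

Lemma qconj_nat k : qconj (k%:R : Q) = k%:R.
Proof. by rewrite -[k%:R](rmorph_nat (@qreal R)) qconj_real. Qed.

Lemma adjmx_tail_sel : adjmx tail_sel = tail_sel.
Proof.
apply/matrixP => i j; rewrite adjmxE !mxE qconj_nat eq_sym.
by case: eqP => // ->.
Qed.

Lemma tail_sel_idem : tail_sel *m tail_sel = tail_sel.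
Proof.
apply/matrixP => i j; rewrite !mxE (bigD1 i)//= big1 => [|k ki].
  by rewrite !mxE eqxx /= addr0 -natrM mulnb andbCA andbb.
by rewrite !mxE eq_sym (negPf ki) mul0r.
Qed.

Lemma head_selK : adjmx head_sel *m head_sel = 1%:M.
Proof.
apply/matrixP => i j; rewrite !mxE (bigD1 (widen_ord rn i))//= big1 => [|k ki].
  by rewrite adjmxE !mxE eqxx qconj_nat mul1r addr0.
rewrite adjmxE !mxE qconj_nat; suff /negPf -> : k != i :> nat by rewrite mul0r.
by apply: contra ki => /eqP ki; apply/eqP/val_inj.
Qed.

Lemma head_tail_sel : adjmx head_sel *m tail_sel = 0.
Proof.
apply/matrixP => i j; rewrite !mxE big1// => k _.
rewrite adjmxE !mxE qconj_nat -natrM mulnb.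
by case: eqP => //= ki; rewrite leqNgt ki ltn_ord andbF.
Qed.

Lemma sel_partition : head_sel *m adjmx head_sel + tail_sel = 1%:M.
Proof.
apply/matrixP => i j; rewrite !mxE.
under eq_bigr => k _ do rewrite adjmxE !mxE qconj_nat -natrM mulnb.
case: (ltnP i r) => ir.
  rewrite (bigD1 (Ordinal ir))//= big1 => [|k ki].
    by rewrite eqxx /= andbF !addr0 eq_sym; congr ((_ : bool)%:R).
  suff /negPf -> : i != k :> nat by [].
  by apply: contra ki => /eqP ik; apply/eqP/val_inj.
rewrite big1 ?add0r ?andbT// => k _.
suff /negPf -> : i != k :> nat by [].
by rewrite gtn_eqF// (leq_trans _ ir).
Qed.

Let VV : adjmx V *m V = 1%:M. Proof. by case: hV. Qed.

Lemma svd_headK : adjmx svd_head *m svd_head = 1%:M.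
Proof. by rewrite adjmxM -mulmxA (mulmxA (adjmx V)) VV mul1mx head_selK. Qed.

Lemma svd_head_tail : adjmx svd_head *m svd_tail = 0.
Proof. by rewrite adjmxM -mulmxA (mulmxA (adjmx V)) VV mul1mx head_tail_sel. Qed.

Lemma svd_tailE : svd_tail *m adjmx svd_tail = V *m tail_sel *m adjmx V.
Proof. by rewrite /svd_tail adjmxM adjmx_tail_sel !mulmxA -(mulmxA V) tail_sel_idem. Qed.

Lemma svd_partition :
  svd_head *m adjmx svd_head + svd_tail *m adjmx svd_tail = 1%:M.
Proof.
rewrite svd_tailE adjmxM -!mulmxA -mulmxDr (mulmxA head_sel) -mulmxDl sel_partition.
by rewrite mul1mx; case: hV.
Qed.

Lemma svd_tail_proj : svd_tail *m adjmx svd_tail *m svd_tail = svd_tail.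
Proof.
by rewrite svd_tailE -!mulmxA (mulmxA (adjmx V)) VV mul1mx tail_sel_idem.
Qed.

End SvdSplit.

Lemma norm2_unitary (R : realType) m n (U : 'M[quat R]_m) (A : 'M[quat R]_(m, n)) :
  unitary U -> norm2 (U *m A) = norm2 A.
Proof.
by case=> UU _; rewrite /norm2 /qdot adjmxM -mulmxA (mulmxA (adjmx U)) UU mul1mx.
Qed.

(** A V = U Sigma, and [U] drops out of the norm. As n <= m, every column of Sigma has its diagonal
    entry. *)
Lemma norm2_svd_tail_sum (R : realType) m n r (A : 'M[quat R]_(m, n)) U sigma V :
  (n <= m)%N -> qsvd A U sigma V ->
  norm2 (A *m svd_tail r V) = \sum_(r <= j < n) sigma j ^+ 2.
Proof.
move=> nm [hU [VV _] _ _ ->].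
rewrite /svd_tail -!mulmxA (mulmxA (adjmx V)) VV mul1mx norm2_unitary//.
rewrite norm2E exchange_big /=.
transitivity (\sum_(j < n | (r <= j)%N) sigma j ^+ 2); last first.
  by rewrite big_geq_mkord.
rewrite [RHS]big_mkcond /=; apply: eq_bigr => j _.
rewrite (bigD1 (widen_ord nm j))//= big1 => [|i ij].
  rewrite addr0 mxE (bigD1 j)//= big1 => [|k kj].
    rewrite !mxE !eqxx /= addr0; case: ifP => _.
      by rewrite mulr1 /qnorm2 /=; ring.
    by rewrite mulr0 /qnorm2 /=; ring.
  by rewrite !mxE (negPf kj) mulr0.
rewrite mxE big1 => [|k _]; first by rewrite /qnorm2 /=; ring.
rewrite !mxE; case: eqP => [ik|]; last by rewrite mul0r.
case: eqP => [kj|]; last by rewrite mulr0.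
by case/eqP: ij; apply/val_inj; rewrite /= ik kj.
Qed.

Section RangeApproximation.
Variables (R : realType) (m n r s t : nat).
Local Notation Q := (quat R).
Variables (Y : 'M[Q]_(n, r)) (B : 'M[Q]_(n, t)) (G : 'M[Q]_(s, n)) (A : 'M[Q]_(m, n)).
Variable e : R.
Hypotheses (e0 : 0 < e) (YY : adjmx Y *m Y = 1%:M) (YB : adjmx Y *m B = 0)
  (YBp : Y *m adjmx Y + B *m adjmx B = 1%:M) (Bp : B *m adjmx B *m B = B).
Local Notation V := (qinv (ridge G Y e)).
Local Notation M := (G *m Y).
Local Notation B' := (B *m adjmx B *m adjmx A).

Let Yfull : full_column_rank Y.
Proof. by move=> x hx; rewrite -[x]mul1mx -YY -mulmxA hx mulmx0. Qed.

Let VMM : V *m adjmx M *m M = 1%:M - qreal e *: V.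
Proof.
rewrite -(ridgeVM G Yfull e0) {3}/ridge YY mulmxDr mulmx_scaler mulmx1 addrK.
exact/esym/mulmxA.
Qed.

(** N regularises (M^H)^+ Y^H, so A G^H N nearly reproduces [A] on the columns of [Y]. After taking
    adjoints, what remains is the tail [B'] and, in the column space of [Y], a bias carrying a
    factor e and a noise term; these two parts are orthogonal. *)
Lemma norm2_range_approximation :
  norm2 (A - A *m adjmx G *m ridgeN G Y e) = norm2 (A *m B) +
    norm2 (qreal e *: (ridgeZ G Y e *m adjmx A) - Y *m V *m adjmx M *m G *m B').
Proof.
have hV := adjmx_ridgeV G Yfull e0.
rewrite -(norm2_proj A Bp) -norm2_adj.
set K := V *m (qreal e *: (adjmx Y *m adjmx A) - adjmx M *m G *m B').
have KE : Y *m K = qreal e *: (ridgeZ G Y e *m adjmx A) - Y *m V *m adjmx M *m G *m B'.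
  rewrite /K 2!mulmxBr 2!mulmx_scaler /ridgeZ.
  by apply: (f_equal2 (fun x y => x - y)); [congr (_ *: _)|]; rewrite !mulmxA.
rewrite -KE.
have -> : adjmx (A - A *m adjmx G *m ridgeN G Y e) = Y *m K + B'.
  have -> : adjmx (A - A *m adjmx G *m ridgeN G Y e) =
      adjmx A - Y *m V *m adjmx M *m G *m adjmx A.
    rewrite raddfB /= (adjmxM _ (ridgeN _ _ _)) (adjmxM A) adjmxK /ridgeN.
    rewrite (adjmx_sandwich M Y hV); congr (_ - _); exact: mulmxA.
  have e1 : Y *m V *m adjmx M *m G *m adjmx A =
      Y *m adjmx Y *m adjmx A - qreal e *: (Y *m V *m adjmx Y *m adjmx A) +
      Y *m V *m adjmx M *m G *m B'.
    rewrite -{1}[adjmx A]mul1mx -YBp mulmxDl mulmxDr; congr (_ + _).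
    have -> : Y *m V *m adjmx M *m G *m (Y *m adjmx Y *m adjmx A) =
        Y *m (V *m adjmx M *m M) *m adjmx Y *m adjmx A.
      by rewrite !mulmxA.
    by rewrite VMM mulmxBr mulmx1 mulmx_scaler 2!mulmxBl -!scalemxAl.
  rewrite e1 KE /ridgeZ.
  rewrite -{1}[adjmx A]mul1mx -YBp mulmxDl.
  move: (Y *m adjmx Y *m adjmx A) B' (Y *m V *m adjmx M *m G *m _) (qreal e *: _).
  by move=> a b c d; rewrite !opprD opprK !addrA [a + b]addrC addrK -addrA addrC.
rewrite norm2_pythagoras; first exact: addrC.
by rewrite 2!(mulmxA (adjmx Y)) YB !mul0mx.
Qed.

End RangeApproximation.

Section MeasurableMatrices.
Context d (E : measurableType d) (R : realType).
Local Notation Q := (quat R).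
Local Notation mx_measurable := (mx_in (fun f : E -> R => measurable_fun setT f)).
Let MS := subalgebra_measurable R E.

Lemma measurable_gmx (K : finType) p N (D : K -> 'M[Q]_(p, N)) (x : E -> fspace K R) :
  measurable_fun setT x -> mx_measurable (fun z => gmx D (x z)).
Proof.
move=> mx; apply: (mx_in_sum MS) => k; apply: (mx_in_scale MS); last exact: mx_in_cst.
by apply: (quat_in_real MS); exact: (measurableT_comp (measurable_coord k) mx).
Qed.

Lemma measurable_ridgeV p N q (G : E -> 'M[Q]_(p, N)) (Y : E -> 'M[Q]_(N, q)) e :
  mx_measurable G -> mx_measurable Y ->
  mx_measurable (fun z => qinv (ridge (G z) (Y z) e)).
Proof.
move=> mG mY; apply: (mx_in_qinv MS); first exact: measurable_funV.
have mM : mx_measurable (fun z => G z *m Y z) by exact: (mx_in_mul MS).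
apply: (mx_in_add MS).
  by apply: (mx_in_mul MS) => //; exact: (mx_in_adj MS).
apply: (mx_in_scale MS); first exact: quat_in_cst.
by apply: (mx_in_mul MS) => //; exact: (mx_in_adj MS).
Qed.

Lemma measurable_ridgeZ p N q (G : E -> 'M[Q]_(p, N)) (Y : E -> 'M[Q]_(N, q)) e :
  mx_measurable G -> mx_measurable Y ->
  mx_measurable (fun z => ridgeZ (G z) (Y z) e).
Proof.
move=> mG mY; apply: (mx_in_mul MS); last exact: (mx_in_adj MS).
by apply: (mx_in_mul MS) => //; exact: measurable_ridgeV.
Qed.

End MeasurableMatrices.

Lemma ge0_integral_scale d (T : measurableType d) (R : realType)
  (P : {measure set T -> \bar R}) (c : R) (f : T -> R) :
  0 <= c -> measurable_fun setT f -> (forall w, 0 <= f w) ->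
  (\int[P]_w (c%:E * (f w)%:E) = c%:E * \int[P]_w (f w)%:E)%E.
Proof.
move=> c0 mf f0; apply: ge0_integralZl => //; first exact/measurable_EFinP.
by move=> w _; rewrite lee_fin.
Qed.

Section OuterBound.
Context d (T : measurableType d) (R : realType) (P : probability T R).
Variables (K : finType) (X : K -> T -> R).
Hypotheses (nX : forall k, standard_normal P (X k))
           (indX : mutually_independent P X).
Variables (m n r s t : nat).
Hypothesis rs : (r <= s)%N.
Local Notation Q := (quat R).
Variables (D : K -> 'M[Q]_(s, n)) (hD : frame D).
Variables (Y : 'M[Q]_(n, r)) (B : 'M[Q]_(n, t)) (A : 'M[Q]_(m, n)).
Hypotheses (YY : adjmx Y *m Y = 1%:M) (YB : adjmx Y *m B = 0)
  (YBp : Y *m adjmx Y + B *m adjmx B = 1%:M) (Bp : B *m adjmx B *m B = B).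
Local Notation G w := (gmx D (joint X w)).
Let kappa : R := r%:R / (4 * (s%:R - r%:R) + 2).
Let B' := B *m adjmx B *m adjmx A.

(** A measurable majorant for one matrix [C] at each point is enough, because the residual is the
    smallest error over all [C]. *)
Lemma outer_bound (eta : R) : 0 < eta -> exists f : T -> R,
  [/\ measurable_fun setT f, forall w, 0 <= f w,
      forall w, exists C, norm2 (A - A *m adjmx (G w) *m C) <= f w &
      (\int[P]_w (f w)%:E <= (norm2 (A *m B) * (1 + 4 * kappa) +
         (eta * (4 * norm2 (A *m B) * kappa) +
          (eta ^+ 2 + eta) * (r%:R * norm2 A * kappa)))%:E)%E].
Proof.
(* The ridge parameter is eta^2, with eta also the weight in Young's inequality. As e tau <= r, the
   bias e^2 |Z A^H|^2 is at most e r |A|^2 tau, and its weighted factor (1 + 1 / eta) eta^2 = eta^2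
   + eta tends to 0. *)
move=> eta0; have e0 : 0 < eta ^+ 2 by rewrite exprn_gt0.
have Yfull : full_column_rank Y.
  by move=> x hx; rewrite -[x]mul1mx -YY -mulmxA hx mulmx0.
have mG := measurable_gmx D (measurable_joint nX).
have MS := subalgebra_measurable R T.
pose tau w := rtr (ridgeZ (G w) Y (eta ^+ 2)).
pose u w := norm2 (Y *m qinv (ridge (G w) Y (eta ^+ 2)) *m adjmx (G w *m Y) *m G w *m B').
have mtau : measurable_fun setT tau.
  by apply: (in_rtr MS); apply: measurable_ridgeZ => //; exact: mx_in_cst.
have mu : measurable_fun setT u.
  apply: (in_norm2 MS); apply: (mx_in_mul MS); last exact: mx_in_cst.
  apply: (mx_in_mul MS) => //; apply: (mx_in_mul MS).
    apply: (mx_in_mul MS); first exact: mx_in_cst.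
    by apply: measurable_ridgeV => //; exact: mx_in_cst.
  by apply: (mx_in_adj MS); apply: (mx_in_mul MS) => //; exact: mx_in_cst.
have YB' : adjmx Y *m B' = 0 by rewrite /B' 2!(mulmxA (adjmx Y)) YB !mul0mx.
have tau0 w : 0 <= tau w by exact: ridgeZ_ge0.
have u0 w : 0 <= u w by exact: norm2_ge0.
have nB' : norm2 B' = norm2 (A *m B) by exact: norm2_proj.
pose c1 := 1 + eta; pose c2 := (eta ^+ 2 + eta) * (r%:R * norm2 A).
have c10 : 0 <= c1 by rewrite addr_ge0// ltW.
have c20 : 0 <= c2.
  by rewrite mulr_ge0 ?addr_ge0 ?mulr_ge0 ?norm2_ge0// ltW.
have S0 : 0 <= norm2 (A *m B) by exact: norm2_ge0.
exists (fun w => norm2 (A *m B) + (c1 * u w + c2 * tau w)); split.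
- apply: measurable_funD => //; apply: measurable_funD; exact: measurable_funM.
- by move=> w; apply: addr_ge0 => //; apply: addr_ge0; apply: mulr_ge0.
- move=> w; exists (ridgeN (G w) Y (eta ^+ 2)).
  rewrite (norm2_range_approximation (G w) A e0 YY YB YBp Bp) lerD2l -/B'.
  apply: le_trans (norm2D_young _ _ eta0) _.
  rewrite norm2N -/(u w); apply: lerD; first exact: lexx.
  rewrite norm2Z; set nZ := norm2 (_ *m adjmx A).
  have h1 : nZ <= tau w ^+ 2 * norm2 A.
    apply: le_trans (norm2M _ _) _; rewrite norm2_adj.
    apply: ler_wpM2r; first exact: norm2_ge0.
    exact: norm2_ridgeZ_le.
  have h2 : eta ^+ 2 * tau w <= r%:R by exact: ridgeZ_ub.
  have h3 : eta ^+ 2 * nZ <= r%:R * norm2 A * tau w.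
    apply: (@le_trans _ _ (eta ^+ 2 * (tau w ^+ 2 * norm2 A))).
      by apply: ler_wpM2l => //; exact: ltW.
    have -> : eta ^+ 2 * (tau w ^+ 2 * norm2 A) =
      (eta ^+ 2 * tau w) * (norm2 A * tau w) by move: (tau w) (norm2 A) => a b; ring.
    rewrite -[leRHS]mulrA; apply: ler_wpM2r h2.
    by apply: mulr_ge0 => //; exact: norm2_ge0.
  have -> : (1 + eta^-1) * ((eta ^+ 2) ^+ 2 * nZ) =
    (1 + eta^-1) * eta ^+ 2 * (eta ^+ 2 * nZ) by move: nZ {h1 h3} => a; ring.
  have -> : (1 + eta^-1) * eta ^+ 2 = eta ^+ 2 + eta by field; rewrite gt_eqF.
  rewrite /c2 -[leRHS]mulrA; apply: ler_wpM2l => //.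
  by rewrite addr_ge0// ltW.
- under eq_integral do rewrite !EFinD !EFinM.
  have mEu : measurable_fun setT (EFin \o u) by exact/measurable_EFinP.
  have mEt : measurable_fun setT (EFin \o tau) by exact/measurable_EFinP.
  have p1 w : (0 <= c1%:E * (u w)%:E)%E by rewrite -EFinM lee_fin mulr_ge0.
  have p2 w : (0 <= c2%:E * (tau w)%:E)%E by rewrite -EFinM lee_fin mulr_ge0.
  have m1 : measurable_fun setT (fun w => (c1%:E * (u w)%:E)%E).
    by apply: emeasurable_funM.
  have m2 : measurable_fun setT (fun w => (c2%:E * (tau w)%:E)%E).
    by apply: emeasurable_funM.
  have i1 : (\int[P]_w (c1%:E * (u w)%:E) = c1%:E * \int[P]_w (u w)%:E)%E.
    exact: ge0_integral_scale.
  have i2 : (\int[P]_w (c2%:E * (tau w)%:E) = c2%:E * \int[P]_w (tau w)%:E)%E.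
    exact: ge0_integral_scale.
  rewrite ge0_integralD//; first last.
  + exact: emeasurable_funD.
  + by move=> w _; rewrite adde_ge0.
  rewrite ge0_integralD// i1 i2 integral_cst//= probability_setT mule1.
  have h1 := expectation_ridge_orth nX indX hD rs Yfull e0 YB'.
  have h2 := expectation_ridgeZ nX indX hD rs Yfull e0.
  rewrite nB' -/kappa in h1; rewrite -/kappa in h2.
  apply: (@le_trans _ _ ((norm2 (A *m B))%:E +
     (c1%:E * (4 * norm2 (A *m B) * kappa)%:E + c2%:E * kappa%:E))%E).
    rewrite leeD2l//; apply: leeD; apply: lee_wpmul2l => //.
  rewrite -!EFinM -!EFinD lee_fin /c1 /c2.
  move: (norm2 (A *m B)) (norm2 A) => a b; rewrite le_eqVlt; apply/orP; left.
  by apply/eqP; ring.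
Qed.

End OuterBound.

(** * Error of the sketch *)

Section IntegralBound.
Import HBNNSimple.

(* f need not be measurable: the rangefinder is an arbitrary function. *)
Lemma ge0_le_integral_ae d (T : measurableType d) (R : realType)
    (mu : {measure set T -> \bar R}) (f g : T -> \bar R) :
  (forall x, (0 <= f x)%E) -> (forall x, (0 <= g x)%E) -> measurable_fun setT g ->
  {ae mu, forall x, (f x <= g x)%E} -> (\int[mu]_x f x <= \int[mu]_x g x)%E.
Proof.
move=> f0 g0 mg fg; rewrite ge0_integralTE//.
apply: ge_ereal_sup => _ [h /= hf <-]; rewrite -integralT_nnsfun.
apply: ae_ge0_le_integral => //.
- by move=> x _; rewrite lee_fin; exact: fun_ge0.
- exact/measurable_EFinP/measurable_funP.
- by apply: filterS fg => x fgx _; exact: le_trans (hf x) fgx.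
Qed.

End IntegralBound.

Lemma le_limn_einf (R : realType) (a : nat -> R) (b : nat -> \bar R) (l : R) :
  a n @[n --> \oo] --> l -> (forall n, ((a n)%:E <= b n)%E) -> (l%:E <= limn_einf b)%E.
Proof.
move=> al ab.
have al' : (a n)%:E @[n --> \oo] --> l%:E.
  by apply/fine_cvgP; split; [exact: nearW|exact: al].
have <- : limn_einf (fun n => (a n)%:E) = l%:E.
  by rewrite is_cvg_limn_einfE; [exact/cvg_lim|apply/cvg_ex; exists l%:E].
rewrite !limn_einf_lim; apply: lee_lim; [exact: is_cvg_einfs..|].
apply: nearW => n; apply: le_ereal_inf_tmp => _ [k /= nk <-].
apply: le_trans (ab k); apply: ereal_inf_lbound.
by exists k.
Qed.

Lemma norm2_sketch_residual (R : realType) l m n s (Y : 'M[quat R]_(m, s))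
    (A : 'M[quat R]_(m, n)) (S : 'M[quat R]_s) (N : 'M[quat R]_(s, l))
    (Psi : 'M[quat R]_(l, m)) :
  full_column_rank Y ->
  norm2 (Y *m S *m N *m Psi *m residual Y A - residual Y A) =
  norm2 (Y *m S *m N *m (Psi *m residual Y A)) + norm2 (residual Y A).
Proof.
move=> Yfull; rewrite -!mulmxA; apply: norm2_pythagorasB.
exact: adjmx_residual.
Qed.

(** Y L N Psi fixes the columns of [Y], so only the residual contributes to the error, and
    Pythagoras separates its image from itself. *)
Lemma norm2_oblique_residual (R : realType) l m n s (Y : 'M[quat R]_(m, s))
    (A : 'M[quat R]_(m, n)) (L : 'M[quat R]_s) (N : 'M[quat R]_(s, l))
    (Psi : 'M[quat R]_(l, m)) :
  full_column_rank Y -> L *m (N *m (Psi *m Y)) = 1%:M ->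
  norm2 (Y *m (L *m N *m (Psi *m A)) - A) =
  norm2 (Y *m L *m N *m (Psi *m residual Y A)) + norm2 (residual Y A).
Proof.
move=> Yfull LNY; rewrite -(norm2_sketch_residual A L N Psi Yfull).
apply: (f_equal (@norm2 R m n)); set B := residual Y A.
have AE : A = Y *m (qinv (adjmx Y *m Y) *m adjmx Y *m A) + B.
  by rewrite /B /residual addrC subrK.
move: (qinv _ *m _ *m _) AE => C AE.
have -> : Y *m (L *m N *m (Psi *m A)) = Y *m C + Y *m L *m N *m Psi *m B.
  rewrite {1}AE !mulmxDr; congr (_ + _); last by rewrite !mulmxA.
  by rewrite (mulmxA Psi) -(mulmxA L) (mulmxA N) (mulmxA L) LNY mul1mx.
by rewrite [in X in _ - X]AE opprD addrACA subrr add0r.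
Qed.

(** With x = e w: for x <= 1 use (1 - x)^2 >= 1 - 2 x; for x > 1 the left side is already at most
    [b]. The loss is thus linear in [e]. *)
Lemma shrink_lower (R : realType) (e w u g b : R) :
  0 <= e * w -> 0 <= u -> 0 <= g -> (e * w <= 1 -> (1 - e * w) ^+ 2 * u <= g) ->
  u + b - e * (2 * w * u) <= g + b.
Proof.
have -> : e * (2 * w * u) = 2 * (e * w) * u by ring.
move: (e * w) => x x0 u0 g0 h; rewrite addrAC lerD2r.
case: (leP x 1) => [/h|] x1; last by nra.
have k2 : 0 <= x ^+ 2 * u by rewrite mulr_ge0 ?sqr_ge0.
by nra.
Qed.

Lemma ridge_error_lower (R : realType) l m s n (Psi : 'M[quat R]_(l, m))
    (Y : 'M[quat R]_(m, s)) (A : 'M[quat R]_(m, n)) :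
  let M := Psi *m Y in let L := qinv (adjmx M *m M) in
  full_column_rank Y -> full_column_rank M ->
  exists c : R, forall e, 0 < e ->
  norm2 (Y *m (L *m adjmx M *m (Psi *m A)) - A) - e * c <=
  norm2 (Y *m qinv (ridge Psi Y e) *m (adjmx M *m Psi + qreal e *: adjmx Y) *m A - A).
Proof.
move=> M L Yfull Mfull.
have [LR RL hL] := qinvP (posdef_gram Mfull); rewrite -/L in LR RL hL.
pose w := rtr (Y *m L *m adjmx Y).
have w0 : 0 <= w.
  exact: le_trans (ridgeZ_ge0 Psi Yfull ltr01) (ridgeZ_le_gram Yfull ltr01 LR hL).
have LMPY : L *m (adjmx M *m (Psi *m Y)) = 1%:M by exact: RL.
rewrite (norm2_oblique_residual A Yfull LMPY).
(* The constant depends on [Psi], [Y] and [A] but not on [e], which is enough for a limit taken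
   pointwise. *)
exists (2 * w * norm2 (Y *m L *m adjmx M *m (Psi *m residual Y A))) => e e0.
rewrite ridge_residual// norm2_sketch_residual//.
apply: shrink_lower (norm2_ridge_limit Yfull e0 LR hL (Psi *m residual Y A)).
- by rewrite mulr_ge0// ltW.
- exact: norm2_ge0.
- exact: norm2_ge0.
Qed.

Definition ridge_error (R : realType) l m s n (Psi : 'M[quat R]_(l, m))
    (Y : 'M[quat R]_(m, s)) (A : 'M[quat R]_(m, n)) (e : R) : R :=
  norm2 (Y *m qinv (ridge Psi Y e) *m
         (adjmx (Psi *m Y) *m Psi + qreal e *: adjmx Y) *m A - A).

Lemma ridge_errorE (R : realType) l m s n (Psi : 'M[quat R]_(l, m))
    (Y : 'M[quat R]_(m, s)) (A : 'M[quat R]_(m, n)) (e : R) :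
  full_column_rank Y -> 0 < e -> ridge_error Psi Y A e =
  norm2 (Y *m qinv (ridge Psi Y e) *m adjmx (Psi *m Y) *m Psi *m residual Y A) +
  norm2 (residual Y A).
Proof.
move=> Yfull e0; rewrite /ridge_error (ridge_residual Psi Yfull e0 A).
have := adjmx_residual A Yfull.
move: (adjmx (Psi *m Y)) (qinv _) (residual _ _) => N S B YB.
by rewrite -!mulmxA; exact: norm2_pythagorasB.
Qed.

Lemma not_full_column_rank (R : realType) m n (M : 'M[quat R]_(m, n)) :
  ~ full_column_rank M -> exists2 x : 'cV_n, M *m x = 0 & x != 0.
Proof.
move=> /existsNP[x /not_implyP[Mx x0]]; exists x => //; exact/eqP.
Qed.

(* The penalty exceeds delta / e when Psi Y is rank deficient (ridge_singular), so
   that no almost sure full rank statement for Psi Y is needed. *)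
Definition penalized_error (R : realType) (delta : R) l m s n (Psi : 'M[quat R]_(l, m))
    (Y : 'M[quat R]_(m, s)) (A : 'M[quat R]_(m, n)) (e : R) : R :=
  ridge_error Psi Y A e + delta * `|rtr (ridgeZ Psi Y e)|.

Lemma penalized_error_ge0 (R : realType) (delta : R) l m s n (Psi : 'M[quat R]_(l, m))
    (Y : 'M[quat R]_(m, s)) (A : 'M[quat R]_(m, n)) (e : R) :
  0 <= delta -> 0 <= penalized_error delta Psi Y A e.
Proof. by move=> d0; apply: addr_ge0; [exact: norm2_ge0|exact: mulr_ge0]. Qed.

(* In the rank deficient case, F <= e F^2 / (4 delta) + delta / e by AM-GM. *)
Lemma penalized_error_lower (R : realType) (delta : R) l m s n
    (Psi : 'M[quat R]_(l, m)) (Y H : 'M[quat R]_(m, s)) (A : 'M[quat R]_(m, n)) :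
  0 < delta -> colspan H = colspan Y -> full_column_rank H ->
  exists c : R, forall e, 0 < e ->
  frobenius (H *m (mpinv (Psi *m H) *m (Psi *m A)) - A) ^+ 2 - e * c <=
  penalized_error delta Psi Y A e.
Proof.
move=> d0 HY Hfull; have Yfull := same_colspan_full HY Hfull.
have [Mfull|/not_full_column_rank[x Mx x0]] := pselect (full_column_rank (Psi *m Y)).
  rewrite sqr_frobenius (same_colspan_mpinv HY Hfull (Psi *m A) Mfull).
  have [c hc] := ridge_error_lower A Yfull Mfull.
  exists c => e e0; apply: le_trans (hc e e0) _.
  by rewrite lerDl mulr_ge0// ltW.
move: (frobenius _ ^+ 2) => F; exists (F ^+ 2 / (4 * delta)) => e e0.
have h := ridge_singular Yfull e0 Mx x0.
have r0 : 0 <= ridge_error Psi Y A e by exact: norm2_ge0.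
rewrite /penalized_error; move: (rtr _) (ridge_error _ _ _ _) h r0 => t g h g0.
have et : 1 <= e * `|t|.
  by apply: le_trans h _; rewrite ler_pM2l// ler_norm.
move: `|t| et => b et; rewrite -subr_ge0.
suff : 0 <= F ^+ 2 * e / (4 * delta) - F + delta * b by rewrite mulrCA mulrA; lra.
have -> : F ^+ 2 * e / (4 * delta) - F + delta * b =
    ((F * e - 2 * delta) ^+ 2 / (4 * delta) + delta * (e * b - 1)) / e.
  by field; rewrite !gt_eqF.
have d4 : 0 <= 4 * delta by rewrite mulr_ge0// ltW.
apply: divr_ge0; last exact: ltW.
by apply: addr_ge0; [apply: divr_ge0 => //; exact: sqr_ge0|rewrite mulr_ge0 ?subr_ge0// ltW].
Qed.

Lemma sketch_error_liminf (R : realType) (delta : R) l m s n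
    (Psi : 'M[quat R]_(l, m)) (Y H : 'M[quat R]_(m, s)) (A : 'M[quat R]_(m, n)) :
  0 < delta -> colspan H = colspan Y -> full_column_rank H ->
  ((frobenius (H *m (mpinv (Psi *m H) *m (Psi *m A)) - A) ^+ 2)%:E <=
   limn_einf (fun k => (penalized_error delta Psi Y A (k.+1%:R^-1))%:E))%E.
Proof.
move=> d0 HY Hfull; have [c] := penalized_error_lower Psi A d0 HY Hfull.
move: (frobenius _ ^+ 2) => F hF.
apply: (@le_limn_einf _ (fun k => F - k.+1%:R^-1 * c)) => [|k]; last first.
  by rewrite lee_fin; apply: hF; rewrite invr_gt0.
rewrite -[X in _ --> X]subr0 -[X in F - X](mul0r c).
apply: cvgB; first exact: cvg_cst.
by apply: cvgMl; exact: cvg_harmonic.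
Qed.

Section InnerBound.
Context d (T : measurableType d) (R : realType) (P : probability T R).
Variables (K : finType) (X : K -> T -> R).
Hypotheses (nX : forall k, standard_normal P (X k))
           (indX : mutually_independent P X).
Variables (p N q n : nat) (D : K -> 'M[quat R]_(p, N)).
Hypotheses (hD : frame D) (qp : (q <= p)%N).
Variables (Y : 'M[quat R]_(N, q)) (A : 'M[quat R]_(N, n)) (e delta : R).
Hypotheses (Yfull : full_column_rank Y) (e0 : 0 < e) (d0 : 0 <= delta).
Local Notation kappa := (q%:R / (4 * (p%:R - q%:R) + 2) : R).

Lemma expectation_penalized_error :
  (\int[P]_w (penalized_error delta (gmx D (joint X w)) Y A e)%:E <=
   ((1 + 4 * kappa) * norm2 (residual Y A) + delta * kappa)%:E)%E.
Proof.
pose u w := norm2 (Y *m qinv (ridge (gmx D (joint X w)) Y e) *m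
  adjmx (gmx D (joint X w) *m Y) *m gmx D (joint X w) *m residual Y A).
pose tau w := rtr (ridgeZ (gmx D (joint X w)) Y e).
have tau0 w : 0 <= tau w by exact: ridgeZ_ge0.
have u0 w : 0 <= u w by exact: norm2_ge0.
have mG := measurable_gmx D (measurable_joint nX).
have MS := subalgebra_measurable R T.
have mtau : measurable_fun setT tau.
  by apply: (in_rtr MS); apply: measurable_ridgeZ => //; exact: mx_in_cst.
have mu : measurable_fun setT u.
  apply: (in_norm2 MS); apply: (mx_in_mul MS); last exact: mx_in_cst.
  apply: (mx_in_mul MS) => //; apply: (mx_in_mul MS).
    apply: (mx_in_mul MS); first exact: mx_in_cst.
    by apply: measurable_ridgeV => //; exact: mx_in_cst.
  by apply: (mx_in_adj MS); apply: (mx_in_mul MS) => //; exact: mx_in_cst.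
have h1 : (\int[P]_w (u w)%:E <= (4 * norm2 (residual Y A) * kappa)%:E)%E.
  by apply: expectation_ridge_orth => //; exact: adjmx_residual.
have h2 : (\int[P]_w (tau w)%:E <= kappa%:E)%E by exact: expectation_ridgeZ.
have eqi w : (penalized_error delta (gmx D (joint X w)) Y A e)%:E =
    ((u w)%:E + (norm2 (residual Y A))%:E + delta%:E * (tau w)%:E)%E.
  by rewrite /penalized_error ridge_errorE// (ger0_norm (tau0 w)).
rewrite (eq_integral _ _ (fun w _ => eqi w)).
move: (norm2 (residual Y A)) (norm2_ge0 (residual Y A)) h1 => b b0 h1.
have mEu : measurable_fun setT (EFin \o u) by exact/measurable_EFinP.
have mEt : measurable_fun setT (EFin \o tau) by exact/measurable_EFinP.
have m2 : measurable_fun setT (fun w => (delta%:E * (tau w)%:E)%E).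
  by apply: emeasurable_funM.
rewrite ge0_integralD//; first last.
- by move=> w _; rewrite -EFinM lee_fin mulr_ge0.
- exact: emeasurable_funD.
- by move=> w _; rewrite -EFinD lee_fin addr_ge0.
rewrite ge0_integralD//; last by move=> w _; rewrite lee_fin.
rewrite (ge0_integral_scale P d0 mtau tau0).
rewrite integral_cst//= probability_setT mule1.
apply: (@le_trans _ _ ((4 * b * kappa)%:E + b%:E + delta%:E * kappa%:E)%E).
  by apply: leeD; [exact: leeD2r|apply: lee_wpmul2l].
rewrite -EFinM -!EFinD lee_fin le_eqVlt; apply/orP; left; apply/eqP; ring.
Qed.

End InnerBound.

Lemma limn_einf_le (R : realType) (u : nat -> \bar R) (c : \bar R) :
  (forall k, u k <= c)%E -> (limn_einf u <= c)%E.
Proof.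
move=> uc; rewrite limn_einf_lim; apply: lime_le; first exact: is_cvg_einfs.
apply: nearW => k; apply: le_trans (uc k); apply: ereal_inf_lbound.
by exists k => /=.
Qed.

(** * Averaging over the two Gaussian matrices *)

Section SketchError.
Context d (T : measurableType d) (R : realType) (P : probability T R).
Variables (m n s l : nat) (A : 'M[quat R]_(m, n)).
Variables (Omega : T -> 'M[quat R]_(n, s)) (Psi : T -> 'M[quat R]_(l, m)).
Hypotheses (hOmega : standard_gaussian P Omega) (hPsi : standard_gaussian P Psi)
  (hind : independent_matrices P Omega Psi) (hsl : (s <= l)%N).
Local Notation Y w := (A *m Omega w).
Hypothesis Yfull : {ae P, forall w, full_column_rank (Y w)}.
Local Notation D1 := (@basis_mx R n s).
Local Notation D2 := (@basis_mx R l m).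
Local Notation K1 := ('I_4 * 'I_n * 'I_s)%type.
Local Notation K2 := ('I_4 * 'I_l * 'I_m)%type.
Local Notation kappa := (s%:R / (4 * (l%:R - s%:R) + 2) : R).

Let mOmega : measurable_fun setT (joint (real_entries Omega)).
Proof. by apply: measurable_joint => k; have [h _] := hOmega; exact: h. Qed.

Let mPsi : measurable_fun setT (joint (real_entries Psi)).
Proof. by apply: measurable_joint => k; have [h _] := hPsi; exact: h. Qed.

(** Expressed in the real coordinates of [Omega] and [Psi], since [decoupling] asks for a measurable
    function on a product space. *)
Let error delta e (z : fspace K1 R * fspace K2 R) : \bar R :=
  (penalized_error delta (gmx D2 z.2) (A *m gmx D1 z.1) A e)%:E.

Let measurable_error delta e : measurable_fun setT (error delta e).
Proof.
have MS := subalgebra_measurable R (fspace K1 R * fspace K2 R)%type.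
have m1 := measurable_gmx D1 (@measurable_fst _ _ (fspace K1 R) (fspace K2 R)).
have m2 := measurable_gmx D2 (@measurable_snd _ _ (fspace K1 R) (fspace K2 R)).
have mY := mx_in_mul MS (mx_in_cst MS A) m1.
have mV := measurable_ridgeV e m2 mY.
apply/measurable_EFinP; apply: measurable_funD.
  apply: (in_norm2 MS); apply: (mx_in_sub MS); last exact: mx_in_cst.
  apply: (mx_in_mul MS); last exact: mx_in_cst.
  apply: (mx_in_mul MS); first exact: (mx_in_mul MS).
  apply: (mx_in_add MS).
    by apply: (mx_in_mul MS) => //; apply: (mx_in_adj MS); exact: (mx_in_mul MS).
  by apply: (mx_in_scale MS); [exact: quat_in_cst|exact: (mx_in_adj MS)].
apply: measurable_funM => //; apply: measurableT_comp => //.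
by apply: (in_rtr MS); exact: measurable_ridgeZ.
Qed.

Let errorE delta e w w' :
  error delta e (joint (real_entries Omega) w, joint (real_entries Psi) w') =
  (penalized_error delta (Psi w') (Y w) A e)%:E.
Proof. by rewrite /error /= !gmx_entries. Qed.

Lemma measurable_penalized_error delta e :
  measurable_fun setT (fun w => (penalized_error delta (Psi w) (Y w) A e)%:E).
Proof.
have -> : (fun w => (penalized_error delta (Psi w) (Y w) A e)%:E) =
    error delta e \o
    (fun w => (joint (real_entries Omega) w, joint (real_entries Psi) w)).
  by apply/funext => w; rewrite /= errorE.
exact: measurableT_comp (measurable_error _ _) (measurable_fun_pair mOmega mPsi).
Qed.

(** Independence allows [Psi] to be averaged with [Omega] frozen; Y is then a constant matrix and
    the moment bounds apply. The function [f] majorises the squared residual. *)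
Lemma expectation_penalized_error_le (delta e : R) (f : T -> R) :
  0 <= delta -> 0 < e -> measurable_fun setT f -> (forall w, 0 <= f w) ->
  (forall w, exists C, norm2 (A - Y w *m C) <= f w) ->
  (\int[P]_w (penalized_error delta (Psi w) (Y w) A e)%:E <=
   \int[P]_w ((1 + 4 * kappa) * f w + delta * kappa)%:E)%E.
Proof.
move=> d0 e0 mf f0 fC.
have k0 : 0 <= kappa.
  by rewrite divr_ge0// addr_ge0// mulr_ge0// subr_ge0 ler_nat.
have c0 : 0 <= 1 + 4 * kappa by rewrite addr_ge0// mulr_ge0.
have er0 z : (0 <= error delta e z)%E by rewrite lee_fin penalized_error_ge0.
have -> : (\int[P]_w (penalized_error delta (Psi w) (Y w) A e)%:E =
    \int[P]_w \int[P]_w' (penalized_error delta (Psi w') (Y w) A e)%:E)%E.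
  transitivity (\int[P]_w error delta e
      (joint (real_entries Omega) w, joint (real_entries Psi) w))%E.
    by apply: eq_integral => w _; rewrite errorE.
  transitivity (\int[P]_w \int[P]_w' error delta e
      (joint (real_entries Omega) w, joint (real_entries Psi) w'))%E.
    exact: (decoupling mOmega mPsi (independent_entries hind)
      (measurable_error delta e) er0).
  by apply: eq_integral => w _; apply: eq_integral => w' _; rewrite errorE.
apply: ge0_le_integral_ae.
- move=> w; apply: integral_ge0 => w' _.
  by rewrite lee_fin penalized_error_ge0.
- by move=> w; rewrite lee_fin addr_ge0// mulr_ge0.
- by apply/measurable_EFinP; apply: measurable_funD => //; exact: measurable_funM.
apply: filterS Yfull => w Yw.
have [nPsi iPsi] := hPsi.
have h := expectation_penalized_error nPsi iPsi (basis_frame R l m) hsl A Yw e0 d0.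
have eqi w' : (penalized_error delta (Psi w') (Y w) A e)%:E =
    (penalized_error delta (gmx D2 (joint (real_entries Psi) w')) (Y w) A e)%:E.
  by rewrite gmx_entries.
rewrite (eq_integral _ _ (fun w' _ => eqi w')); apply: le_trans h _.
rewrite lee_fin lerD2r ler_wpM2l//.
have [C hC] := fC w; apply: le_trans hC; exact: norm2_residual_le.
Qed.

End SketchError.

Lemma measurable_fun_limn_einf d (T : measurableType d) (R : realType)
    (f : nat -> T -> \bar R) :
  (forall k, measurable_fun setT (f k)) ->
  measurable_fun setT (fun x => limn_einf (f^~ x)).
Proof.
move=> mf.
have -> : (fun x => limn_einf (f^~ x)) =
    (fun x => - limn_esup ((fun k y => - f k y)^~ x))%E.
  apply/funext => x; rewrite -limn_einfN; congr limn_einf.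
  by apply/funext => k /=; rewrite oppeK.
apply: measurableT_comp => //; apply: measurable_fun_limn_esup => k.
exact: measurableT_comp.
Qed.

Section SketchBound.
Context d (T : measurableType d) (R : realType) (P : probability T R).
Variables (m n s l : nat) (A : 'M[quat R]_(m, n)).
Variables (Omega : T -> 'M[quat R]_(n, s)) (Psi : T -> 'M[quat R]_(l, m)).
Hypotheses (hOmega : standard_gaussian P Omega) (hPsi : standard_gaussian P Psi)
  (hind : independent_matrices P Omega Psi) (hsl : (s <= l)%N).
Variable rangefinder : 'M[quat R]_(m, s) -> 'M[quat R]_(m, s).
Local Notation Y w := (A *m Omega w).
Local Notation H w := (rangefinder (Y w)).
Hypothesis hH : {ae P, forall w, colspan (H w) = colspan (Y w) /\
                                 full_column_rank (H w)}.
Local Notation kappa := (s%:R / (4 * (l%:R - s%:R) + 2) : R).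

Lemma expectation_sketch_error_le (delta : R) (f : T -> R) :
  0 < delta -> measurable_fun setT f -> (forall w, 0 <= f w) ->
  (forall w, exists C, norm2 (A - Y w *m C) <= f w) ->
  (\int[P]_w (frobenius (H w *m (mpinv (Psi w *m H w) *m (Psi w *m A)) - A) ^+ 2)%:E <=
   \int[P]_w ((1 + 4 * kappa) * f w + delta * kappa)%:E)%E.
Proof.
move=> d0 mf f0 fC.
have Yfull : {ae P, forall w, full_column_rank (Y w)}.
  by apply: filterS hH => w [h1 h2]; exact: same_colspan_full h1 h2.
pose h k w := (penalized_error delta (Psi w) (Y w) A (k.+1%:R^-1))%:E.
have mh k : measurable_fun setT (h k) by exact: (measurable_penalized_error A hOmega hPsi).
have h0 k w : (0 <= h k w)%E by rewrite lee_fin; exact: (penalized_error_ge0 _ _ _ _ (ltW d0)).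
apply: (@le_trans _ _ (\int[P]_w limn_einf (h^~ w))%E).
  apply: ge0_le_integral_ae.
  - by move=> w; rewrite lee_fin sqr_ge0.
  - move=> w; apply: (@le_limn_einf _ (fun=> 0)); first exact: cvg_cst.
    by move=> k; exact: h0.
  - exact: measurable_fun_limn_einf.
  - by apply: filterS hH => w [h1 h2]; exact: sketch_error_liminf.
(* Fatou's lemma is applied to the regularised errors, which are measurable; the sketch error itself
   was only compared with their lower limit. *)
apply: le_trans (fatou P measurableT mh (fun k w _ => h0 k w)) _.
apply: limn_einf_le => k.
have e0 : 0 < k.+1%:R^-1 :> R by rewrite invr_gt0.
exact: (expectation_penalized_error_le hOmega hPsi hind hsl Yfull (ltW d0) e0 mf f0 fC).
Qed.

Variables (r : nat) (U : 'M[quat R]_m) (sigma : nat -> R) (V : 'M[quat R]_n).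
Hypotheses (hA : qsvd A U sigma V) (nm : (n <= m)%N) (rs : (r <= s)%N)
  (rn : (r <= n)%N).

Lemma sketch_error_bound :
  (\int[P]_w (frobenius (H w *m (mpinv (Psi w *m H w) *m (Psi w *m A)) - A) ^+ 2)%:E <=
   ((1 + ferr R s l) * (1 + ferr R r s) * \sum_(r <= j < n) sigma j ^+ 2)%:E)%E.
Proof.
rewrite -(norm2_svd_tail_sum r nm hA).
have hV : unitary V by case: hA.
have [nO iO] := hOmega.
have B1 := outer_bound nO iO rs (adjmx_frame (basis_frame R n s)) A
  (svd_headK rn hV) (svd_head_tail r hV) (svd_partition r hV) (svd_tail_proj r hV).
rewrite /ferr -!(mulrA 4).
have k20 : 0 <= kappa.
  by rewrite divr_ge0// addr_ge0// mulr_ge0// subr_ge0 ler_nat.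
have k10 : 0 <= r%:R / (4 * (s%:R - r%:R) + 2) :> R.
  by rewrite divr_ge0// addr_ge0// mulr_ge0// subr_ge0 ler_nat.
have S0 := norm2_ge0 (A *m svd_tail r V); have A0 := norm2_ge0 A.
have E1 := expectation_sketch_error_le.
move: (norm2 (A *m svd_tail r V)) (norm2 A) (r%:R / (4 * (s%:R - r%:R) + 2))
  S0 A0 k10 B1 => S a k1 S0 a0 k10 B1.
move: kappa k20 E1 => k2 k20 E1.
(* Collects all coefficients of eta once eta^2 <= eta; the last summand [k2] comes from the penalty,
   whose weight is also taken to be eta. *)
pose C := (1 + 4 * k2) * (4 * S * k1 + 2 * (r%:R * a * k1)) + k2.
have C0 : 0 <= C by rewrite /C !(addr_ge0, mulr_ge0).
apply/lee_addgt0Pr => eps eps0.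
(* The minimum with 1 ensures eta^2 <= eta, and the 1 added to [C] keeps the quotient defined when
   [C] is 0. *)
pose eta := Num.min 1 (eps / (C + 1)).
have eta0 : 0 < eta by rewrite lt_min ltr01 divr_gt0// ltr_wpDl.
have eta1 : eta <= 1 by rewrite ge_min lexx.
have etaC : eta * C <= eps.
  apply: (@le_trans _ _ (eps / (C + 1) * C)).
    by apply: ler_wpM2r => //; rewrite ge_min lexx orbT.
  rewrite -mulrA; apply: ler_piMr; first exact: ltW.
  by rewrite mulrC ler_pdivrMr ?mul1r ?lerDl// ltr_wpDl.
have [f [mf f0 fC fI]] := B1 eta eta0.
have fC' w : exists C, norm2 (A - Y w *m C) <= f w.
  have [C' hC'] := fC w; exists C'; apply: le_trans hC'.
  by rewrite gmx_adj adjmxK gmx_entries.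
apply: le_trans (E1 eta f eta0 mf f0 fC') _.
have c0 : 0 <= 1 + 4 * k2 by rewrite addr_ge0// mulr_ge0.
have mEf : measurable_fun setT (EFin \o f) by exact/measurable_EFinP.
have -> : (\int[P]_w ((1 + 4 * k2) * f w + eta * k2)%:E =
    (1 + 4 * k2)%:E * \int[P]_w (f w)%:E + (eta * k2)%:E)%E.
  under eq_integral do rewrite EFinD EFinM.
  rewrite ge0_integralD//.
  - by rewrite (ge0_integral_scale P c0 mf f0) integral_cst//= probability_setT mule1.
  - by move=> w _; rewrite -EFinM lee_fin mulr_ge0.
  - exact: emeasurable_funM.
  - by move=> w _; rewrite lee_fin mulr_ge0// ltW.
apply: le_trans (leeD2r _ (lee_wpmul2l _ fI)) _; first by rewrite lee_fin.
rewrite -EFinM -!EFinD lee_fin.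
have rak : 0 <= r%:R * a * k1 by rewrite !mulr_ge0.
apply: (@le_trans _ _ ((1 + 4 * k2) * (1 + 4 * k1) * S + eta * C)); last first.
  by rewrite lerD2l.
clear B1 fI fC fC' E1 etaC; rewrite /C; clearbody eta; clear C C0; move: (r%:R * a * k1) rak => b b0.
have e2 : eta ^+ 2 <= eta by rewrite expr2 ler_piMr// ltW.
have h : (1 + 4 * k2) * ((eta ^+ 2 + eta) * b) <= (1 + 4 * k2) * (2 * eta * b).
  by apply: ler_wpM2l => //; apply: ler_wpM2r => //; lra.
move: h; move: (1 + 4 * k2) => c h; lra.
Qed.

End SketchBound.

Lemma ferr1E (R : realType) (p q : nat) : (p <= q)%N ->
  1 + ferr R p q = (2 * q%:R + 1) / (2 * (q%:R - p%:R) + 1).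
Proof.
move=> pq; have pq0 : 0 <= q%:R - p%:R :> R by rewrite subr_ge0 ler_nat.
rewrite /ferr; field.
by apply/andP; split; rewrite gt_eqF//; lra.
Qed.

Theorem theorem4p3 (d : measure_display) (T : measurableType d) (R : realType)
    (P : probability T R) (m n r s l : nat)
    (hmn : (n <= m)%N) (hrs : (r <= s)%N) (hsl : (s <= l)%N)
    (hl : (l <= minn m n)%N)
    (A : 'M[quat R]_(m, n))
    (U : 'M[quat R]_m) (sigma : nat -> R) (V : 'M[quat R]_n)
    (hA : qsvd A U sigma V)
    (Omega : T -> 'M[quat R]_(n, s)) (Psi : T -> 'M[quat R]_(l, m))
    (hOmega : standard_gaussian P Omega) (hPsi : standard_gaussian P Psi)
    (hind : independent_matrices P Omega Psi)
    (rangefinder : 'M[quat R]_(m, s) -> 'M[quat R]_(m, s)) :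
  let Y := fun w => A *m Omega w in
  let W := fun w => Psi w *m A in
  let H := fun w => rangefinder (Y w) in
  let X := fun w => mpinv (Psi w *m H w) *m W w in
  let Sigma2_frob2 := \sum_(r <= j < n) sigma j ^+ 2 in
  {ae P, forall w, colspan (H w) = colspan (Y w) /\ full_column_rank (H w)} ->
  ('E_P[fun w => (frobenius (H w *m X w - A) ^+ 2)%R] <=
     ((1 + ferr R s l) * (1 + ferr R r s) * Sigma2_frob2)%:E)%E /\
  (1 + ferr R s l) * (1 + ferr R r s) * Sigma2_frob2 =
    ((2 * l%:R + 1) / (2 * (l%:R - s%:R) + 1)) *
    ((2 * s%:R + 1) / (2 * (s%:R - r%:R) + 1)) * Sigma2_frob2.
Proof.
move=> Y W H X S2 hH; split; last by rewrite !ferr1E.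
rewrite unlock; apply: (sketch_error_bound hOmega hPsi hind hsl hH hA) => //.
by apply: leq_trans hrs (leq_trans hsl (leq_trans hl (geq_minr m n))).
Qed.
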